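(* Let $\varphi:\mathbb{R}\to\mathbb{R}$ be a positive definite function with $\varphi(0)=1$ and $|\varphi(x)|<1$ for $x\neq0$, and assume $\varphi$ is monotone on $[0,\delta]$ for some $\delta>0$. Let $(X(u,t))_{u\in\mathbb{R},t\ge0}$ be the point motion of a Harris flow with infinitesimal covariation function $\varphi$, and let $(Y(u,t))$ be a tangent process of $X$. Define \[ E(t)=\mathsf{E}\sup_{0\le k<t^{-1/2}}\left|Y(kt^{1/2},t)-kt^{1/2}\right|, \] the supremum being over integers $k$. Then, almost surely, \[ \sup_{u\in[0,1]}|X(u,t)-u|=E(t)+O\!\left(\sqrt{t\ln\ln t^{-1}}\right),\qquad t\to0 . \]
   Context: The point motion of a Harris flow with infinitesimal covariation function $\varphi$ is a family $(X(u,t))_{u\in\mathbb{R},t\ge0}$ of continuous martingales adapted to a common filtration $(\mathcal{F}_t)$ such that: (1) for each $u$, $X(u,\cdot)$ is an $(\mathcal{F}_t)$-Brownian motion started at $u$; (2) for all $u,v$, $\frac{d}{dt}\langle X(u,t),X(v,t)\rangle=\varphi(X(u,t)-X(v,t))$ ($\langle\cdot,\cdot\rangle$ = quadratic covariation); (3) for each $t$, $u\mapsto X(u,t)$ is nondecreasing. $X$ is taken separable and continuous in $t$ for each $u$. A tangent process of $X$ is a Gaussian process $(Y(u,t))$ on a (possibly enlarged) probability space such that the $Y(u,\cdot)$ and $X(u,\cdot)$ are continuous martingales with respect to a common filtration, $Y(u,0)=u$, $\frac{d}{dt}\langle Y(u,t),Y(v,t)\rangle=\varphi(u-v)$ and $\frac{d}{dt}\langle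 X(u,t),Y(v,t)\rangle=\varphi(X(u,t)-v)$. In particular $(Y(u,t)-u)_{u}$ is a centered Gaussian family with covariance $t\varphi(u-v)$, so $E(t)$ depends only on $\varphi$ and $t$. *)

(* Defs.v *)
From HB Require Import structures.
From mathcomp Require Import all_boot all_order all_algebra.
From mathcomp Require Import all_classical all_reals all_analysis.
From mathcomp Require Import normal_distribution.

Set Implicit Arguments.
Unset Strict Implicit.
Unset Printing Implicit Defensive.

Import Order.TTheory GRing.Theory Num.Theory.
Import numFieldNormedType.Exports.
Local Open Scope classical_set_scope.
Local Open Scope ring_scope.

Section harris.
Context {R : realType} {d : measure_display} {T : measurableType d}.
Variable P : probability T R.

Definition is_filtration (F : R -> set (set T)) : Prop :=
  (forall t, 0 <= t -> sigma_algebra setT (F t) /\ F t `<=` measurable) /\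
  (forall s t, 0 <= s -> s <= t -> F s `<=` F t).

Definition adapted (F : R -> set (set T)) (M : R -> T -> R) : Prop :=
  forall t, 0 <= t -> forall B : set R, measurable B -> F t (M t @^-1` B).

Definition continuous_paths (M : R -> T -> R) : Prop :=
  forall x, {within `[0%R, +oo[, continuous (fun t => M t x)}.

Definition martingale (F : R -> set (set T)) (M : R -> T -> R) : Prop :=
  [/\ adapted F M,
      (forall t, 0 <= t -> P.-integrable setT (EFin \o M t)) &
      (forall s t, 0 <= s -> s <= t -> forall A, F s A ->
         (\int[P]_(x in A) (M t x)%:E = \int[P]_(x in A) (M s x)%:E)%E)].

Definition continuous_martingale F M := martingale F M /\ continuous_paths M.

Definition time_integral (g : R -> T -> R) (t : R) (x : T) : R :=
  fine (\int[lebesgue_measure]_(s in `[0%R, t]) (g s x)%:E)%E.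

(* d/dt <M, N>_t = g(t):  the quadratic covariation of the continuous
   (square-integrable) martingales M, N is int_0^t g ds, i.e.
   M N - int_0^. g ds is an (F)-martingale *)
Definition covariation_density (F : R -> set (set T)) (M N : R -> T -> R)
    (g : R -> T -> R) : Prop :=
  martingale F (fun t x => M t x * N t x - time_integral g t x).

Definition brownian_motion (F : R -> set (set T)) (B : R -> T -> R) (u : R)
  : Prop :=
  [/\ adapted F B, continuous_paths B, (forall x, B 0 x = u) &
      forall s t, 0 <= s -> s < t -> forall A C, F s A -> measurable C ->
        P (A `&` [set x | C (B t x - B s x)]) =
        (P A * normal_prob 0 (Num.sqrt (t - s)) C)%E].

Definition gaussian_rv (Z : T -> R) : Prop :=
  exists m sigma : R, 0 <= sigma /\
    forall C : set R, measurable C ->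
      P [set x | C (Z x)] =
      (if sigma == 0 then (\1_C m)%:E else normal_prob m sigma C).

Definition gaussian_process (Y : R -> R -> T -> R) : Prop :=
  forall (n : nat) (us ts cs : 'I_n -> R), (forall i, 0 <= ts i) ->
    gaussian_rv (fun x => \sum_(i < n) cs i * Y (us i) (ts i) x).

Definition separable_flow (X : R -> R -> T -> R) : Prop :=
  exists D : set R, countable D /\
    {ae P, forall x, forall t, 0 <= t -> forall u, exists dn : nat -> R,
        [/\ forall n, D (dn n), dn @ \oo --> u &
            (fun n => X (dn n) t x) @ \oo --> X u t x]}.

Definition harris_point_motion (F : R -> set (set T)) (phi : R -> R)
    (X : R -> R -> T -> R) : Prop :=
  [/\ forall u, continuous_martingale F (X u),
      forall u, brownian_motion F (X u) u,
      forall u v, covariation_density F (X u) (X v)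
                    (fun s x => phi (X u s x - X v s x)),
      forall t x, 0 <= t -> {homo (fun u => X u t x) : a b / a <= b} &
      separable_flow X].

Definition tangent_process (F : R -> set (set T)) (phi : R -> R)
    (X Y : R -> R -> T -> R) : Prop :=
  [/\ gaussian_process Y,
      forall u, continuous_martingale F (Y u),
      forall u x, Y u 0 x = u,
      forall u v, covariation_density F (Y u) (Y v) (fun _ _ => phi (u - v)) &
      forall u v, covariation_density F (X u) (Y v)
                    (fun s x => phi (X u s x - v))].

(* E(t) = E sup_{0 <= k < t^{-1/2}, k integer} |Y(k t^{1/2}, t) - k t^{1/2}|;
   the integers k with 0 <= k < t^{-1/2} are 0, ..., ceil(t^{-1/2}) - 1 *)
Definition Efun (Y : R -> R -> T -> R) (t : R) : R :=
  fine (\int[P]_x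
    (\big[Num.max/0]_(k < `|Num.ceil (Num.sqrt t)^-1|%N)
        `|Y (k%:R * Num.sqrt t) t x - k%:R * Num.sqrt t|)%:E)%E.

End harris.

Definition positive_definite {R : realType} (phi : R -> R) : Prop :=
  (forall x, phi (- x) = phi x) /\
  forall (n : nat) (xs cs : 'I_n -> R),
    0 <= \sum_(i < n) \sum_(j < n) cs i * cs j * phi (xs i - xs j).

Definition monotone_on_0_delta {R : realType} (phi : R -> R) (delta : R)
  : Prop :=
  (forall a b, 0 <= a -> a <= b -> b <= delta -> phi a <= phi b) \/
  (forall a b, 0 <= a -> a <= b -> b <= delta -> phi b <= phi a).

(* Main.v *)
(* While all the particles of a block stay near their starting points, and the
   block is shorter than delta, the monotonicity of phi compares the brackets
   phi (X_u - X_v) of the flow with the covariances phi (u - v) of the tangent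
   process at the same or at twice the spacing.  Slepian's inequality, proved by
   interpolating along the martingale X with the Gaussian semigroup of Y and
   applied to exp (- exp (ell - a)), where ell is the logarithm of the sum of the
   exponentials of the scaled deviations, then bounds the maximum over a block of
   the flow, in both directions, by Gaussian maxima.  These concentrate around
   their means at scale sqrt t, and all the blocks of the mesh of the same spacing
   have the same mean.  Taking points of spacing h sqrt (ln 1/t) in a block leaves
   only O (sqrt (ln 1/t)) blocks, so a union bound costs O (sqrt (t ln ln 1/t)) with
   failure probability O ((ln 1/t) ^ -4).  Along t_j = exp (- sqrt j) this is
   summable; between two such times a particle moves by O (sqrt t) uniformly over
   the mesh, and the monotonicity of the flow fills the gaps of the mesh. *)
Require Import Defs.
From HB Require Import structures.
From mathcomp Require Import all_boot all_order all_algebra.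
From mathcomp Require Import all_classical all_reals all_analysis.
From mathcomp Require Import normal_distribution measurable_realfun.
From mathcomp Require Import ring lra.
Import Order.TTheory GRing.Theory Num.Theory.
Import numFieldNormedType.Exports.
Local Open Scope classical_set_scope.
Local Open Scope ring_scope.

Set Implicit Arguments.
Unset Strict Implicit.
Unset Printing Implicit Defensive.

(** Stochastic calculus enters only through [one_step], a second-order Taylor expansion over a short
    time D: the linear term has mean zero, brackets replace the quadratic one, and the remainder is
    of order D^(3/2), so t / D steps cost O (sqrt D) in total. Interpolation and concentration are
    both sums of such steps. The event where the brackets are comparable concerns the whole path;
    off it the integrand is bounded crudely, at a price of m^2 times its failure probability. Hence
    particles must stay near their starting points up to a probability of order tau^8 each, which
    fixes the stride of about 16 sqrt L, L = ln (1 / tau), inside a block. The scaling c = L / sqrt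
    tau makes the loss ln m / c of log-sum-exp against the maximum O (sqrt tau). A second obstacle
    is that the mesh of E(t) moves with t, while one exceptional event must serve a whole time
    interval. The flow is controlled on the fixed mesh of spacing sqrt tau; the Gaussian means for
    two spacings, being numbers, are compared through the flow at one sample point outside two small
    events. *)

Lemma eq_ler {R : realType} (x y : R) : x = y -> x <= y.
Proof. by move=> ->. Qed.

(** * Expectations and probabilities as real numbers *)

Section expectation.
Context {R : realType} {d : measure_display} {T : measurableType d}.
Variable P : probability T R.
Implicit Types (f g : T -> R) (A B : set T).

Definition Li f := P.-integrable setT (EFin \o f).
Definition Ex f : R := \int[P]_x f x.
Definition pr A : R := fine (P A).

Lemma Li_meas f : Li f -> measurable_fun setT f.
Proof. by move=> /measurable_int/measurable_EFinP. Qed.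

Lemma Li_le f g : measurable_fun setT f -> (forall x, `|f x| <= g x) ->
  Li g -> Li f.
Proof.
move=> mf fg; apply: le_integrable => //; first exact/measurable_EFinP.
by move=> x _ /=; rewrite lee_fin (le_trans (fg x))// ler_norm.
Qed.

Lemma Li_cst c : Li (fun=> c).
Proof. exact: (finite_measure_integrable_cst P). Qed.

Lemma Li_bdd f c : measurable_fun setT f -> (forall x, `|f x| <= c) -> Li f.
Proof. by move=> mf fc; apply: Li_le fc _ => //; exact: Li_cst. Qed.

Lemma LiD f g : Li f -> Li g -> Li (fun x => f x + g x).
Proof. by move=> Lf Lg; apply: (integrableD measurableT Lf Lg). Qed.

Lemma LiZl c f : Li f -> Li (fun x => c * f x).
Proof. by move=> Lf; apply: (integrableZl measurableT c Lf). Qed.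

Lemma LiZr c f : Li f -> Li (fun x => f x * c).
Proof. by move=> /(LiZl c); under eq_fun do rewrite mulrC. Qed.

Lemma LiN f : Li f -> Li (fun x => - f x).
Proof. by move=> /(LiZl (-1)); under eq_fun do rewrite mulN1r. Qed.

Lemma LiB f g : Li f -> Li g -> Li (fun x => f x - g x).
Proof. by move=> Lf Lg; apply: LiD => //; exact: LiN. Qed.

Lemma Li_norm f : Li f -> Li (fun x => `|f x|).
Proof. by move=> Lf; apply: integrable_norm. Qed.

Lemma Li_sum I (s : seq I) (Q : pred I) (h : I -> T -> R) :
  (forall i, Q i -> Li (h i)) -> Li (fun x => \sum_(i <- s | Q i) h i x).
Proof.
move=> hs; rewrite /Li (_ : _ \o _ = fun x => (\sum_(i <- s | Q i) (h i x)%:E)%E).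
  exact: (integrable_sum measurableT).
by apply/funext => x /=; rewrite sumEFin.
Qed.

Lemma Ex_cst c : Ex (fun=> c) = c.
Proof.
rewrite /Ex (Rintegral_cst _ measurableT) -[RHS]mulr1; congr (_ * _).
exact: (congr1 fine (probability_setT P)).
Qed.

Lemma ExD f g : Li f -> Li g -> Ex (fun x => f x + g x) = Ex f + Ex g.
Proof. by move=> Lf Lg; rewrite /Ex RintegralD. Qed.

Lemma ExB f g : Li f -> Li g -> Ex (fun x => f x - g x) = Ex f - Ex g.
Proof. by move=> Lf Lg; rewrite /Ex RintegralB. Qed.

Lemma ExZl c f : Li f -> Ex (fun x => c * f x) = c * Ex f.
Proof. by move=> Lf; rewrite /Ex RintegralZl. Qed.

Lemma ExZr c f : Li f -> Ex (fun x => f x * c) = Ex f * c.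
Proof. by move=> Lf; rewrite /Ex RintegralZr. Qed.

Lemma ExN f : Li f -> Ex (fun x => - f x) = - Ex f.
Proof.
by move=> Lf; rewrite -mulN1r -ExZl//; under [in RHS]eq_fun do rewrite mulN1r.
Qed.

Lemma Ex_sum I (s : seq I) (Q : pred I) (h : I -> T -> R) :
  (forall i, Q i -> Li (h i)) ->
  Ex (fun x => \sum_(i <- s | Q i) h i x) = \sum_(i <- s | Q i) Ex (h i).
Proof.
move=> hs; elim: s => [|i s IH].
  by under eq_fun do rewrite big_nil; rewrite big_nil Ex_cst.
under eq_fun do rewrite big_cons; rewrite big_cons; case: ifPn => // Qi.
by rewrite ExD ?IH//; [exact: hs|exact: Li_sum].
Qed.

Lemma le_Ex f g : Li f -> Li g -> (forall x, f x <= g x) -> Ex f <= Ex g.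
Proof. by move=> Lf Lg fg; apply: le_Rintegral. Qed.

Lemma Ex_ge0 f : (forall x, 0 <= f x) -> 0 <= Ex f.
Proof. by move=> f0; apply: Rintegral_ge0. Qed.

Lemma norm_Ex f : Li f -> `|Ex f| <= Ex (fun x => `|f x|).
Proof. by move=> Lf; apply: le_normr_Rintegral. Qed.

Lemma norm_Ex_le f g : Li f -> Li g -> (forall x, `|f x| <= g x) ->
  `|Ex f| <= Ex g.
Proof.
by move=> Lf Lg fg; apply: le_trans (norm_Ex Lf) _; apply: le_Ex => //; exact: Li_norm.
Qed.

Lemma norm_Ex_cst f c : measurable_fun setT f -> (forall x, `|f x| <= c) ->
  `|Ex f| <= c.
Proof.
move=> mf fc; rewrite -[leRHS]Ex_cst.
by apply: norm_Ex_le => //; [exact: Li_bdd fc|exact: Li_cst].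
Qed.

Lemma eq_Ex f g : (forall x, f x = g x) -> Ex f = Ex g.
Proof. by move=> fg; congr Ex; apply/funext. Qed.

Lemma EFin_pr A : measurable A -> (pr A)%:E = P A.
Proof. by move=> mA; rewrite /pr fineK// fin_num_measure. Qed.

Lemma pr_le1 A : measurable A -> pr A <= 1.
Proof. by move=> mA; rewrite -lee_fin EFin_pr// probability_le1. Qed.

Lemma le_pr A B : measurable A -> measurable B -> A `<=` B -> pr A <= pr B.
Proof.
by move=> mA mB AB; rewrite -lee_fin !EFin_pr// le_measure ?inE.
Qed.

Lemma pr_setC A : measurable A -> pr (~` A) = 1 - pr A.
Proof.
move=> mA; apply: EFin_inj; rewrite EFin_pr; last exact: measurableC.
by rewrite EFinB EFin_pr// probability_setC.
Qed.

Lemma pr_setU A B : measurable A -> measurable B -> pr (A `|` B) <= pr A + pr B.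
Proof.
move=> mA mB; rewrite -lee_fin EFinD !EFin_pr//; last exact: measurableU.
exact: measureU2.
Qed.

Lemma pr_bigsetU (I : Type) (s : seq I) (Q : pred I) (A : I -> set T) :
  (forall i, measurable (A i)) ->
  pr (\big[setU/set0]_(i <- s | Q i) A i) <= \sum_(i <- s | Q i) pr (A i).
Proof.
move=> mA; elim: s => [|i s IH]; first by rewrite !big_nil /pr measure0.
rewrite !big_cons; case: ifPn => // _; apply: le_trans (pr_setU _ _) _ => //.
  exact: bigsetU_measurable.
by rewrite lerD2l.
Qed.

Lemma Li_indic A : measurable A -> Li (\1_A).
Proof.
move=> mA; apply: (@Li_bdd _ 1); first exact: measurable_indic.
by move=> x; rewrite indicE; case: (x \in A); rewrite ?normr1 ?normr0.
Qed.

Lemma Ex_indic A : measurable A -> Ex (\1_A) = pr A.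
Proof. by move=> mA; rewrite /Ex /Rintegral integral_indic// setIT. Qed.

Lemma measurable_ge f c : measurable_fun setT f -> measurable [set x | c <= f x].
Proof.
move=> mf; rewrite -[X in measurable X]setTI; apply: measurable_fun_le => //.
Qed.

Lemma markov_pr f A c : measurable A -> Li f -> (forall x, 0 <= f x) ->
  (forall x, A x -> c <= f x) -> c * pr A <= Ex f.
Proof.
move=> mA Lf f0 Af; rewrite -Ex_indic// -ExZl; last exact: Li_indic.
apply: le_Ex => //; first by apply: LiZl; exact: Li_indic.
move=> x; rewrite indicE; have [/set_mem/Af|] := boolP (x \in A).
  by rewrite mulr1.
by rewrite mulr0.
Qed.

End expectation.

Import HBNNSimple.

(** Both sides are monotone limits over simple functions, and for an indicator the identity is the
    hypothesis on [nu]. It turns a law given by [normal_prob] into an integral against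
    [normal_pdf]. *)
Lemma ge0_integral_density {R : realType} {d} {T : measurableType d}
    (mu nu : {measure set T -> \bar R}) (p : T -> R) (f : T -> \bar R) :
  measurable_fun setT p -> (forall x, 0 <= p x) ->
  (forall A, measurable A -> nu A = (\int[mu]_(x in A) (p x)%:E)%E) ->
  measurable_fun setT f -> (forall x, (0 <= f x)%E) ->
  (\int[nu]_x f x = \int[mu]_x ((p x)%:E * f x))%E.
Proof.
move=> mp p0 nuE mf f0.
have mpE : measurable_fun setT (EFin \o p) by exact/measurable_EFinP.
pose f_ := nnsfun_approx measurableT mf.
transitivity (lim (\int[nu]_x (f_ n x)%:E @[n --> \oo])%E).
  rewrite -monotone_convergence//=.
  - apply: eq_integral => ? /[!inE] xD; apply/esym/cvg_lim => //=.
    exact: cvg_nnsfun_approx.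
  - by move=> n; exact/measurable_EFinP/measurable_funTS.
  - by move=> n ? _; rewrite lee_fin.
  - by move=> ? _ ? ? mn; rewrite lee_fin; exact/lefP/nd_nnsfun_approx.
transitivity (lim (\int[mu]_x ((p x)%:E * (f_ n x)%:E) @[n --> \oo])%E); last first.
  rewrite -monotone_convergence//=.
  - apply: eq_integral => x _; apply/cvg_lim => //=.
    by apply: cvgeZl => //; exact: cvg_nnsfun_approx.
  - move=> n; apply: emeasurable_funM => //.
    exact/measurable_EFinP/measurable_funTS.
  - by move=> n ? _; rewrite mule_ge0 ?lee_fin.
  - move=> x _ ? ? mn; apply: lee_wpmul2l; rewrite ?lee_fin//.
    exact/lefP/nd_nnsfun_approx.
apply: congr_lim; apply/funext => n.
under [LHS]eq_integral do rewrite fimfunE -fsumEFin//.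
rewrite [LHS]ge0_integral_fsum//; last 2 first.
  - by move=> r; exact/measurable_EFinP/measurableT_comp.
  - by move=> r x _; rewrite EFinM nnfun_muleindic_ge0.
under [RHS]eq_integral.
  move=> x xD; rewrite fimfunE -fsumEFin// ge0_mule_fsumr; last first.
    by move=> r; rewrite EFinM nnfun_muleindic_ge0.
  over.
rewrite [RHS]ge0_integral_fsum//; last 2 first.
  - move=> r; apply: emeasurable_funM => //.
    by apply/measurable_EFinP; apply/measurableT_comp.
  - by move=> r x _; apply: mule_ge0; [rewrite lee_fin|rewrite EFinM nnfun_muleindic_ge0].
apply: eq_fsbigr => r _.
have mr : measurable (f_ n @^-1` [set r]) by [].
rewrite integralZl_indic_nnsfun//=.
rewrite integral_indic// setIT nuE// integral_mkcond.
transitivity (\int[mu]_x (r%:E * ((p x)%:E * (\1_(f_ n @^-1` [set r]) x)%:E)))%E; last first.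
  by apply: eq_integral => x _; rewrite EFinM muleCA.
(* The sum over values formally ranges over all reals; a negative value has empty preimage. *)
have [r0|r0] := leP 0 r.
  rewrite ge0_integralZl//; first last.
    by move=> x _; rewrite mule_ge0 ?lee_fin.
    by apply: emeasurable_funM => //; exact/measurable_EFinP/measurable_indic.
  congr (_ * _)%E; apply: eq_integral => x _.
  by rewrite patchE indicE; case: ifPn => _; rewrite ?mule1 ?mule0.
rewrite preimage_nnfun0//.
under eq_integral do rewrite patchE in_set0.
rewrite integral0 mule0 integral0_eq// => x _.
by rewrite indic0 !mule0.
Qed.

(** * Taylor expansions with explicit cubic remainders *)

Section calculus.
Context {R : realType}.
Implicit Types (f g : R -> R) (x y t : R).

Lemma in01M (a b : R) : 0 <= a <= 1 -> 0 <= b <= 1 -> 0 <= a * b <= 1.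
Proof. by move=> /andP[? ?] /andP[? ?]; rewrite mulr_ge0//= mulr_ile1. Qed.

Lemma mean_value f df x y :
  (forall t, 0 <= t <= 1 -> is_derive (x + t * y) 1 f (df (x + t * y))) ->
  exists2 t, 0 <= t <= 1 & f (x + y) - f x = df (x + t * y) * y.
Proof.
move=> fd.
have segE c : y != 0 -> (x <= c <= x + y) || (x + y <= c <= x) ->
    exists2 t, 0 <= t <= 1 & c = x + t * y.
  move=> y0 hc; exists ((c - x) / y); last by rewrite divfK// subrKC.
  have [yp|yn|y0'] := ltgtP y 0; last by rewrite y0' eqxx in y0.
    by rewrite ler_ndivlMr// ler_ndivrMr// mul0r mul1r; case/orP: hc => /andP[? ?]; apply/andP; split; lra.
  by rewrite ler_pdivlMr// ler_pdivrMr// mul0r mul1r; case/orP: hc => /andP[? ?]; apply/andP; split; lra.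
have [yn|yp|->] := ltgtP y 0; last first.
- by exists 0; rewrite ?lexx ?ler01// addr0 subrr mulr0.
- have fd' c : c \in `[x, x + y]%R -> is_derive c 1 f (df c).
    rewrite in_itv/= => hc; have [||t t01 ->] := segE c; last exact: fd.
      by rewrite gt_eqF.
    by rewrite hc.
  have cf : {within `[x, x + y], continuous f}.
    by apply: derivable_within_continuous => z /fd'[].
  have le : x <= x + y by rewrite lerDl ltW.
  have dd z : z \in `]x, x + y[%R -> is_derive z 1 f (df z).
    by rewrite in_itv/= => /andP[/ltW h1 /ltW h2]; apply: fd'; rewrite in_itv/= h1.
  have [c] := MVT_segment le dd cf.
  rewrite in_itv/= => hc E; have [||t t01 ct] := segE c.
  + by rewrite gt_eqF.
  + by rewrite hc.
  by exists t => //; rewrite -ct E addrAC subrr add0r.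
- have fd' c : c \in `[x + y, x]%R -> is_derive c 1 f (df c).
    rewrite in_itv/= => hc; have [||t t01 ->] := segE c; last exact: fd.
      by rewrite lt_eqF.
    by rewrite hc orbT.
  have cf : {within `[x + y, x], continuous f}.
    by apply: derivable_within_continuous => z /fd'[].
  have le : x + y <= x by rewrite gerDl ltW.
  have dd z : z \in `]x + y, x[%R -> is_derive z 1 f (df z).
    by rewrite in_itv/= => /andP[/ltW h1 /ltW h2]; apply: fd'; rewrite in_itv/= h1.
  have [c] := MVT_segment le dd cf.
  rewrite in_itv/= => hc E; have [||t t01 ct] := segE c.
  + by rewrite lt_eqF.
  + by rewrite hc orbT.
  by exists t => //; rewrite -ct -opprB E; ring.
Qed.

(** Three nested mean values, for the remainder, its derivative and [g2], write the error as g3 * s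
    * t^2 * y^3 with s and t in [0, 1]. The missing factor 1/6 is immaterial. *)
Lemma taylor2 g g1 g2 g3 x y (K : R) :
  (forall t, 0 <= t <= 1 -> is_derive (x + t * y) 1 g (g1 (x + t * y))) ->
  (forall t, 0 <= t <= 1 -> is_derive (x + t * y) 1 g1 (g2 (x + t * y))) ->
  (forall t, 0 <= t <= 1 -> is_derive (x + t * y) 1 g2 (g3 (x + t * y))) ->
  (forall t, 0 <= t <= 1 -> `|g3 (x + t * y)| <= K) ->
  `|g (x + y) - g x - g1 x * y - 2^-1 * g2 x * y ^+ 2| <= K * `|y| ^+ 3.
Proof.
move=> d0 d1 d2 b3.
pose r z := g z - g x - g1 x * (z - x) - 2^-1 * g2 x * (z - x) ^+ 2.
pose r1 z := g1 z - g1 x - g2 x * (z - x).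
have dr t : 0 <= t <= 1 -> is_derive (x + t * y) 1 r (r1 (x + t * y)).
  move=> t01; have := d0 t t01 => d0t.
  by rewrite /r; apply: is_derive_eq; rewrite /r1 /GRing.scale/=; field.
have dr1 t : 0 <= t <= 1 -> is_derive (x + t * y) 1 r1 (g2 (x + t * y) - g2 x).
  move=> t01; have := d1 t t01 => d1t.
  rewrite /r1; apply: is_derive_eq; rewrite /GRing.scale/=; ring.
have [t t01 E] := mean_value dr.
have [s s01 E1] : exists2 s, 0 <= s <= 1 &
    r1 (x + t * y) - r1 x = (g2 (x + s * (t * y)) - g2 x) * (t * y).
  apply: mean_value (fun z => g2 z - g2 x) _ _ _ => s s01; rewrite mulrA.
  by apply: dr1; apply: in01M.
have [u u01 E2] : exists2 u, 0 <= u <= 1 &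
    g2 (x + s * (t * y)) - g2 x = g3 (x + u * (s * (t * y))) * (s * (t * y)).
  apply: mean_value => u u01; rewrite !mulrA; apply: d2.
  by do 2 apply: in01M => //.
have -> : g (x + y) - g x - g1 x * y - 2^-1 * g2 x * y ^+ 2 = r (x + y) - r x.
  by rewrite /r; field.
have r1x : r1 x = 0 by rewrite /r1; ring.
move: E1; rewrite r1x subr0 => E1.
rewrite E E1 E2.
have -> : g3 (x + u * (s * (t * y))) * (s * (t * y)) * (t * y) * y =
  (s * t ^+ 2) * (g3 (x + (u * s * t) * y) * y ^+ 3) by rewrite !mulrA; ring.
have ust : 0 <= u * s * t <= 1 by do 2 apply: in01M => //.
have K0 : 0 <= K by exact: le_trans (b3 _ ust).
have st : `|s * t ^+ 2| <= 1.
  have /andP[? ?] : 0 <= s * t ^+ 2 <= 1 by rewrite expr2; do 2 apply: in01M => //.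
  by rewrite ger0_norm.
rewrite normrM -[leRHS]mul1r; apply: ler_pM => //.
by rewrite normrM normrX; apply: ler_wpM2r; [rewrite exprn_ge0|exact: b3].
Qed.

Lemma expR_taylor2 x :
  `|expR x - 1 - x - 2^-1 * x ^+ 2| <= expR `|x| * `|x| ^+ 3.
Proof.
have := @taylor2 expR expR expR expR 0 x (expR `|x|).
rewrite add0r expR0 mul1r mulr1; apply => t t01; try exact: is_derive_expR.
rewrite ger0_norm ?expR_ge0// ler_expR add0r (le_trans (ler_norm _))// normrM.
by rewrite -[leRHS]mul1r ler_wpM2r// ger0_norm; lra.
Qed.

Lemma is_derive_inv (z : R) : z != 0 ->
  is_derive z 1 (fun y => y^-1) (- (z^-1) ^+ 2).
Proof.
move=> z0; have dv := @is_deriveV R id z 1 1 z0 (is_derive_id z 1).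
by apply: is_derive_eq; rewrite /GRing.scale/= mulr1 exprVn.
Qed.

Lemma is_derive_inv_sq (z : R) : z != 0 ->
  is_derive z 1 (fun y => - (y^-1) ^+ 2) (2 * (z^-1) ^+ 3).
Proof.
move=> z0; have dv := is_derive_inv z0.
rewrite (_ : (fun _ => _) = (fun y : R => - (y^-1 * y^-1))); last first.
  by apply/funext => y; rewrite expr2.
by apply: is_derive_eq; rewrite /GRing.scale/=; field.
Qed.

(** On 1 + x >= 1/2 the third derivative 2 / z^3 of the logarithm is at most 16. *)
Lemma ln_taylor2 x : - 2^-1 <= x ->
  `|ln (1 + x) - x + 2^-1 * x ^+ 2| <= 16 * `|x| ^+ 3.
Proof.
move=> x2.
have pos t : 0 <= t <= 1 -> 2^-1 <= 1 + t * x by move=> ?; nra.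
have := @taylor2 (@ln R) (fun z => z^-1) (fun z => - (z^-1) ^+ 2)
   (fun z => 2 * (z^-1) ^+ 3) 1 x 16.
rewrite ln1 subr0 invr1 mul1r expr1n mulrN1 mulNr opprK; apply => t /pos p.
- by apply: is_derive1_ln; lra.
- by apply: is_derive_inv; lra.
- by apply: is_derive_inv_sq; lra.
- have p0 : 0 < 1 + t * x by lra.
  rewrite ger0_norm; last by rewrite mulr_ge0 ?exprn_ge0 ?invr_ge0//; lra.
  have : (1 + t * x)^-1 <= 2 by rewrite invf_ple ?posrE//; lra.
  move=> h; have : (1 + t * x)^-1 ^+ 3 <= 2 ^+ 3.
    by apply: lerXn2r; rewrite ?nnegrE ?invr_ge0//; lra.
  by lra.
Qed.

End calculus.

(** * Subgaussian variables *)

Section gaussian.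
Context {R : realType} {d : measure_display} {T : measurableType d}.
Variable P : probability T R.
Local Notation Li := (Li P).
Local Notation Ex := (Ex P).
Local Notation pr := (pr P).
Implicit Types (W : T -> R).

(** Completing the square: the tilted density is a shifted Gaussian density times a constant, and
    the constant is the moment generating function. *)
Lemma normal_pdf_tilt (m s th y : R) : s != 0 ->
  normal_pdf m s y * expR (th * y) =
  expR (th * m + 2^-1 * th ^+ 2 * s ^+ 2) * normal_pdf (m + th * s ^+ 2) s y.
Proof.
move=> s0; rewrite /normal_pdf (negbTE s0) /= -[LHS]mulrA [RHS]mulrCA; congr (_ * _).

by rewrite /normal_fun -!expRD; congr expR; rewrite -mulr_natr; field.
Qed.

Lemma normal_mgf W (m s th : R) : measurable_fun setT W -> s != 0 ->
  (forall C : set R, measurable C -> P [set x | C (W x)] = normal_prob m s C) ->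
  Li (fun x => expR (th * W x)) /\
  Ex (fun x => expR (th * W x)) = expR (th * m + 2^-1 * th ^+ 2 * s ^+ 2).
Proof.
move=> mW s0 law.
have mE : measurable_fun setT (fun x => expR (th * W x)).
  by apply: measurableT_comp => //; apply: measurable_funM.
have mE' : measurable_fun setT (fun y : R => expR (th * y)).
  by apply: measurableT_comp => //; apply: measurable_funM.
set c := expR _.
have I : (\int[P]_x (expR (th * W x))%:E = c%:E)%E.
  have mW' : measurable_fun setT (W : T -> measurableTypeR R) by [].
  pose W' : {RV P >-> measurableTypeR R} := @mfun_Sub _ _ T (measurableTypeR R) W (mem_set mW').
  transitivity (\int[distribution P W']_y (expR (th * y))%:E)%E.
    by rewrite ge0_integral_distribution//; exact/measurable_EFinP.
  have dE (A : set (measurableTypeR R)) : measurable A ->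
      distribution P W' A = (\int[lebesgue_measure]_(y in A) (normal_pdf m s y)%:E)%E.
    by move=> mA; exact: law.
  have fE : measurable_fun setT (fun y : measurableTypeR R => (expR (th * y))%:E).
    exact/measurable_EFinP.
  rewrite (@ge0_integral_density R _ (measurableTypeR R) (@lebesgue_measure R)
    (distribution P W') _ _ (measurable_normal_pdf m s) (normal_pdf_ge0 m s)
    dE fE (fun y => expR_ge0 _)).
  transitivity (\int[lebesgue_measure]_y (c%:E * (normal_pdf (m + th * s ^+ 2) s y)%:E))%E.
    by apply: eq_integral => y _; rewrite -!EFinM normal_pdf_tilt.
  rewrite ge0_integralZl//.
  + by rewrite integral_normal_pdf mule1.
  + by apply/measurable_EFinP; exact: measurable_normal_pdf.
  + by move=> y _; rewrite lee_fin normal_pdf_ge0.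
  + by rewrite lee_fin expR_ge0.
split; last by rewrite /Ex /Rintegral I.
apply/integrableP; split; first exact/measurable_EFinP.
under eq_integral do rewrite /= ger0_norm ?expR_ge0//.
by rewrite I ltry.
Qed.

(** The form in which the law of an increment enters the expansions and the maximal inequality; the
    increments of [X] and of [Y] both satisfy it with [v] their variance. *)
Definition subgaussian W (v : R) := measurable_fun setT W /\
  forall th, Li (fun x => expR (th * W x)) /\
    Ex (fun x => expR (th * W x)) <= expR (2^-1 * th ^+ 2 * v).

Lemma subgaussian_scale W v c : subgaussian W v -> subgaussian (fun x => c * W x) (c ^+ 2 * v).
Proof.
move=> [mW sW]; split; first exact: measurable_funM.
move=> th; have [] := sW (th * c) => L E.
rewrite (_ : (fun x => _) = (fun x => expR (th * c * W x))); last first.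
  by apply/funext => x; rewrite mulrA.
by split => //; rewrite (le_trans E)// ler_expR; apply: eq_ler; ring.
Qed.

Lemma subgaussian_Li_exp_norm W v th : subgaussian W v ->
  Li (fun x => expR (th * `|W x|)).
Proof.
move=> [mW sW].
apply: (@Li_le _ _ _ _ _ (fun x => expR (th * W x) + expR (- th * W x))).
- by apply: measurableT_comp => //; apply: measurable_funM => //; exact: measurableT_comp.
- move=> x; rewrite ger0_norm ?expR_ge0//; have [w|w] := ger0P (W x).
    by rewrite lerDl expR_ge0.
  by rewrite mulrN -mulNr lerDr expR_ge0.
- by apply: LiD; apply: (sW _).1.
Qed.

Lemma cube_le_expR (y : R) : 0 <= y -> y ^+ 3 <= 6 * expR y.
Proof.
by move=> y0; have := expR_ge1Dxn 2 y0; rewrite (_ : 3`! = 6)%N//; lra.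
Qed.

Lemma subgaussian_Li_cube W v : subgaussian W v -> Li (fun x => `|W x| ^+ 3).
Proof.
move=> sW; apply: (@Li_le _ _ _ _ _ (fun x => 6 * expR (1 * `|W x|))).
- by apply: measurable_funX; apply: measurableT_comp => //; case: sW.
- by move=> x; rewrite normrX normr_id mul1r cube_le_expR.
- by apply: LiZl; exact: subgaussian_Li_exp_norm sW.
Qed.

(** At the natural scale th = 1 / sqrt v both exponential moments are at most e^(1/2), and (th
    |W|)^3 <= 6 exp (th |W|); the factor 12 e rounds this up. *)
Lemma subgaussian_cube W v : subgaussian W v -> 0 < v ->
  Ex (fun x => `|W x| ^+ 3) <= 12 * expR 1 * (Num.sqrt v) ^+ 3.
Proof.
move=> sW v0; have [mW sW'] := sW.
have s0 : 0 < Num.sqrt v by rewrite sqrtr_gt0.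
pose th := (Num.sqrt v)^-1.
have th0 : 0 < th by rewrite invr_gt0.
have [L1 E1] := sW' th; have [L2 E2] := sW' (- th).
apply: (@le_trans _ _ (Ex (fun x => (6 * Num.sqrt v ^+ 3) *
    (expR (th * W x) + expR (- th * W x))))).
  apply: le_Ex.
  - exact: subgaussian_Li_cube sW.
  - by apply: LiZl; exact: LiD.
  - move=> x; apply: (@le_trans _ _ (Num.sqrt v ^+ 3 * (6 * expR (th * `|W x|)))).
      rewrite -ler_pdivrMl ?exprn_gt0// -exprVn -exprMn.
      by apply: cube_le_expR; rewrite mulr_ge0// ltW.
    rewrite mulrA [_ * 6]mulrC; apply: ler_wpM2l.
      by rewrite mulr_ge0// exprn_ge0// ltW.
    have [w|w] := ger0P (W x); first by rewrite lerDl expR_ge0.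
    by rewrite mulrN -mulNr lerDr expR_ge0.
rewrite ExZl ?ExD//; last exact: LiD.
rewrite (_ : 12 * _ * _ = (6 * Num.sqrt v ^+ 3) * (2 * expR 1)); last by ring.
apply: ler_wpM2l; first by rewrite mulr_ge0// exprn_ge0// ltW.
have h : expR (2^-1 * th ^+ 2 * v) <= expR 1.
  rewrite ler_expR /th exprVn sqr_sqrtr; last exact: ltW.
  by rewrite -mulrA mulVf ?gt_eqF//; lra.
by rewrite sqrrN in E2; lra.
Qed.

Lemma subgaussian_Li_sq W v : subgaussian W v -> Li (fun x => W x ^+ 2).
Proof.
move=> sW; apply: (@Li_le _ _ _ _ _ (fun x => 1 + `|W x| ^+ 3)).
- by apply: measurable_funX; case: sW.
- move=> x; rewrite normrX; have := normr_ge0 (W x); move: (`|W x|) => w w0.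
  have : 0 <= (1 - w) ^+ 2 * (1 + w) by rewrite mulr_ge0 ?sqr_ge0 ?addr_ge0.
  by nra.
- by apply: LiD; [exact: Li_cst|exact: subgaussian_Li_cube sW].
Qed.

(** Uniqueness of Taylor coefficients at 0: divide by th, then by th^2, and let th tend to 0. *)
Lemma linear_cube_eq0 (p q C : R) :
  (forall th, 0 < th <= 1 -> `|th * p + th ^+ 2 * q| <= C * th ^+ 3) ->
  p = 0 /\ q = 0.
Proof.
move=> h.
have C0 : 0 <= C.
  by have := h 1; rewrite ltr01 lexx !expr1n mulr1 => /(_ isT); apply: le_trans.
have p0 : p = 0.
  apply/eqP; rewrite -normr_le0; apply/ler_addgt0Pl => e e0; rewrite addr0.
  pose th := Num.min 1 (e / (C + `|q| + 1)).
  have D0 : 0 < C + `|q| + 1 by rewrite ltr_wpDl// addr_ge0.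
  have th0 : 0 < th by rewrite lt_min ltr01 divr_gt0.
  have th1 : th <= 1 by rewrite ge_min lexx.
  have thD : th * (C + `|q| + 1) <= e by rewrite -ler_pdivlMr// ge_min lexx orbT.
  have : `|th * p| <= C * th ^+ 3 + th ^+ 2 * `|q|.
    have -> : th * p = (th * p + th ^+ 2 * q) - th ^+ 2 * q by ring.
    apply: le_trans (ler_normB _ _) _; rewrite normrM (ger0_norm (sqr_ge0 th)).
    by rewrite lerD2r h// th0.
  rewrite normrM gtr0_norm// => H.
  have : `|p| <= C * th ^+ 2 + th * `|q|.
    by rewrite -(ler_pM2l th0); apply: le_trans H _; apply: eq_ler; ring.
  have th2 : C * th ^+ 2 <= C * th by rewrite ler_wpM2l// expr2 ger_pMl.
  by move/le_trans; apply; have := normr_ge0 q; lra.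
split=> //; subst p.
apply/eqP; rewrite -normr_le0; apply/ler_addgt0Pl => e e0; rewrite addr0.
pose th := Num.min 1 (e / (C + 1)).
have D0 : 0 < C + 1 by rewrite ltr_wpDl.
have th0 : 0 < th by rewrite lt_min ltr01 divr_gt0.
have th1 : th <= 1 by rewrite ge_min lexx.
have thD : th * (C + 1) <= e by rewrite -ler_pdivlMr// ge_min lexx orbT.
have := h th; rewrite th0 th1 => /(_ isT); rewrite mulr0 add0r normrM.
rewrite (ger0_norm (sqr_ge0 th)) => H.
have : `|q| <= C * th by rewrite -(ler_pM2l (exprn_gt0 2 th0)); apply: le_trans H _; apply: eq_ler; ring.
by move/le_trans; apply; nra.
Qed.

(** [gaussian_rv] provides a normal law with unknown parameters, while mean and variance are known
    as expectations. They are matched by expanding E exp (th W) to second order in two ways, from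
    the moments and from the closed form in [normal_mgf]. *)
Lemma gaussian_rv_subgaussian W v : measurable_fun setT W -> 0 < v ->
  Li W -> Li (fun x => W x ^+ 2) -> Ex W = 0 -> Ex (fun x => W x ^+ 2) = v ->
  gaussian_rv P W -> subgaussian W v.
Proof.
move=> mW v0 LW LW2 EW EW2 [m [s [s0 law]]].
(* A point mass would make the second moment m^2 = (E W)^2 = 0, against 0 < v. *)
have [sz|sz] := eqVneq s 0.
  exfalso; have mA : measurable [set x | W x = m].
    rewrite (_ : [set x | _] = W @^-1` [set m]); last by apply/seteqP; split.
    by rewrite -[X in measurable X]setTI; exact: mW.
  have P1 : pr [set x | W x = m] = 1.
    have := law [set m] (measurable_set1 m); rewrite sz eqxx indicE mem_set//.
    by rewrite /pr => ->.
  have P0 : pr (~` [set x | W x = m]) = 0 by rewrite pr_setC// P1 subrr.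
  have Pae : {ae P, forall x, [set: T] x -> W x = m}.
    exists (~` [set x | W x = m]); split; first exact: measurableC.
      by rewrite -EFin_pr ?P0//; exact: measurableC.
    by move=> x /= h hh; apply: h => _.
  have E1 : Ex W = m.
    rewrite -(@Ex_cst _ _ _ P m) /Ex /Rintegral; congr fine.
    apply: ae_eq_integral => //; first exact/measurable_EFinP.
    by apply: filterS Pae => x /= h t; rewrite h.
  have E2 : Ex (fun x => W x ^+ 2) = m ^+ 2.
    rewrite -(@Ex_cst _ _ _ P (m ^+ 2)) /Ex /Rintegral; congr fine.
    apply: ae_eq_integral => //.
      by apply/measurable_EFinP; exact: measurable_funX.
    by apply: filterS Pae => x /= h t; rewrite h.
  by move: E2; rewrite EW2 -E1 EW expr0n/= => v00; rewrite v00 ltxx in v0.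
have mgf th : Li (fun x => expR (th * W x)) /\
    Ex (fun x => expR (th * W x)) = expR (th * m + 2^-1 * th ^+ 2 * s ^+ 2).
  by apply: normal_mgf => // C mC; rewrite law// (negbTE sz).
have LE th : Li (fun x => expR (th * `|W x|)).
  apply: (@Li_le _ _ _ _ _ (fun x => expR (th * W x) + expR (- th * W x))).
  - by apply: measurableT_comp => //; apply: measurable_funM => //; exact: measurableT_comp.
  - move=> x; rewrite ger0_norm ?expR_ge0//; have [w|w] := ger0P (W x).
      by rewrite lerDl expR_ge0.
    by rewrite mulrN -mulNr lerDr expR_ge0.
  - by apply: LiD; apply: (mgf _).1.
pose K := Ex (fun x => 6 * expR (2 * `|W x|)).
have h1 th : 0 < th <= 1 ->
    `|Ex (fun x => expR (th * W x)) - 1 - 2^-1 * th ^+ 2 * v| <= K * th ^+ 3.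
  move=> /andP[th0 th1].
  have -> : Ex (fun x => expR (th * W x)) - 1 - 2^-1 * th ^+ 2 * v =
      Ex (fun x => expR (th * W x) - 1 - th * W x - 2^-1 * th ^+ 2 * W x ^+ 2).
    rewrite !ExB ?Ex_cst ?ExZl ?EW ?EW2 ?mulr0 ?subr0//.
    - exact: (mgf th).1.
    - exact: Li_cst.
    - by apply: LiB; [exact: (mgf th).1|exact: Li_cst].
    - exact: LiZl.
    - by apply: LiB; [apply: LiB; [exact: (mgf th).1|exact: Li_cst]|exact: LiZl].
    - exact: LiZl.
  have -> : K * th ^+ 3 = Ex (fun x => 6 * expR (2 * `|W x|) * th ^+ 3).
    by rewrite ExZr//; apply: LiZl.
  apply: norm_Ex_le.
  - apply: LiB; last exact: LiZl.
    by apply: LiB; [apply: LiB; [exact: (mgf th).1|exact: Li_cst]|exact: LiZl].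
  - by apply: LiZr; apply: LiZl.
  - move=> x; have := expR_taylor2 (th * W x); rewrite exprMn.
    rewrite mulrA => /le_trans; apply.
    rewrite normrM (gtr0_norm th0) exprMn mulrCA [leRHS]mulrC.
    rewrite ler_wpM2l ?exprn_ge0 ?(ltW th0)//.
    have w0 := normr_ge0 (W x).
    have -> : 6 * expR (2 * `|W x|) = expR `|W x| * (6 * expR `|W x|).
      by rewrite mulrCA -expRD; congr (_ * expR _); ring.
    apply: ler_pM; rewrite ?expR_ge0 ?exprn_ge0//; last exact: cube_le_expR.
    by rewrite ler_expR; nra.
pose A := `|m| + s ^+ 2.
have A0 : 0 <= A by rewrite addr_ge0 ?sqr_ge0.
pose K' := expR A * A ^+ 3.
have h2 th : 0 < th <= 1 -> `|expR (th * m + 2^-1 * th ^+ 2 * s ^+ 2) - 1 -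
    (th * m + 2^-1 * th ^+ 2 * s ^+ 2) -
    2^-1 * (th * m + 2^-1 * th ^+ 2 * s ^+ 2) ^+ 2| <= K' * th ^+ 3.
  move=> /andP[th0 th1].
  have B : `|th * m + 2^-1 * th ^+ 2 * s ^+ 2| <= th * A.
    apply: le_trans (ler_normD _ _) _; rewrite normrM gtr0_norm//.
    rewrite (ger0_norm (_ : 0 <= 2^-1 * th ^+ 2 * s ^+ 2)).
      by rewrite /A; have := sqr_ge0 s; nra.
    by rewrite mulr_ge0 ?sqr_ge0// mulr_ge0 ?sqr_ge0// invr_ge0.
  apply: le_trans (expR_taylor2 _) _; rewrite /K' -[leRHS]mulrA -[A ^+ 3 * _]exprMn.
  apply: ler_pM; rewrite ?expR_ge0 ?exprn_ge0//.
    by rewrite ler_expR (le_trans B)//; nra.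
  by rewrite [A * th]mulrC; apply: lerXn2r; rewrite ?nnegrE ?mulr_ge0 ?(ltW th0).
(* The coefficients of th and th^2 in the difference of the two expansions; the rest of the squared
   exponent is of third and fourth order and goes into the constant. *)
have [m0 q0] : m = 0 /\ 2^-1 * (s ^+ 2 + m ^+ 2 - v) = 0.
  apply: (@linear_cube_eq0 _ _ (K + K' + (`|m * s ^+ 2| + s ^+ 4))) => th th01.
  have /andP[th0 th1] := th01.
  rewrite [X in `|X|](_ : _ = (Ex (fun x => expR (th * W x)) - 1 - 2^-1 * th ^+ 2 * v)
    - (expR (th * m + 2^-1 * th ^+ 2 * s ^+ 2) - 1 -
    (th * m + 2^-1 * th ^+ 2 * s ^+ 2) -
    2^-1 * (th * m + 2^-1 * th ^+ 2 * s ^+ 2) ^+ 2) -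
    (2^-1 * (m * s ^+ 2) + th * 8^-1 * s ^+ 4) * th ^+ 3); last first.
    by rewrite (mgf th).2; set ee := expR _; field.
  have b3 : `|(2^-1 * (m * s ^+ 2) + th * 8^-1 * s ^+ 4) * th ^+ 3| <=
      (`|m * s ^+ 2| + s ^+ 4) * th ^+ 3.
    rewrite normrM (ger0_norm (exprn_ge0 3 (ltW th0))).
    apply: ler_wpM2r; first by rewrite exprn_ge0// ltW.
    apply: le_trans (ler_normD _ _) _; apply: lerD.
      by rewrite normrM ger0_norm ?invr_ge0//; have := normr_ge0 (m * s ^+ 2); lra.
    have := exprn_ge0 4 s0 => s40.
    by rewrite ger0_norm; [nra|rewrite mulr_ge0// mulr_ge0 ?invr_ge0// ltW].
  rewrite [(K + K' + _) * _]mulrDl [(K + K') * _]mulrDl.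
  apply: le_trans (ler_normB _ _) (lerD _ b3).
  exact: le_trans (ler_normB _ _) (lerD (h1 _ th01) (h2 _ th01)).
split => // th; have [L E] := mgf th; split => //; rewrite E ler_expR.
by apply: eq_ler; move: q0; rewrite m0 expr0n/= addr0; nra.
Qed.

End gaussian.

(** * Martingales *)

Section martingale.
Context {R : realType} {d : measure_display} {T : measurableType d}.
Variable P : probability T R.
Local Notation Li := (Li P).
Local Notation Ex := (Ex P).
Local Notation pr := (pr P).

Lemma cvg_Ex (f_ : nat -> T -> R) (f g : T -> R) :
  (forall n, measurable_fun setT (f_ n)) -> measurable_fun setT f ->
  (forall x, f_ ^~ x @ \oo --> f x) -> (forall n x, `|f_ n x| <= g x) -> Li g ->
  (fun n => Ex (f_ n)) @ \oo --> Ex f.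
Proof.
move=> mf_ mf cf fg Lg.
have [|||||LfE _ c] := @dominated_convergence _ _ _ P setT measurableT
    (fun n => EFin \o f_ n) (EFin \o f) (EFin \o g).
- by move=> n; exact/measurable_EFinP.
- exact/measurable_EFinP.
- by apply: aeW => x _; apply/cvg_EFin; [exact: nearW|exact: cf].
- exact: Lg.
- by apply: aeW => x n _; rewrite /= lee_fin.
apply: fine_cvg; rewrite fineK; first exact: c.
exact: integrable_fin_num LfE.
Qed.

(** The filtration consists of bare sets of sets; [GmeasE] passes to the generated sigma-algebra,
    where closure under sums, products and compositions is at hand. *)
Definition Gmeas (G : set (set T)) (f : T -> R) :=
  forall B : set R, measurable B -> G (f @^-1` B).

Lemma GmeasE G f : sigma_algebra setT G ->
  Gmeas G f <-> measurable_fun setT (f : g_sigma_algebraType G -> R).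
Proof.
move=> sG; split=> [h _ B mB|h B mB].
  by rewrite setTI measurable_g_measurableTypeE//; exact: h.
by have := h measurableT B mB; rewrite setTI measurable_g_measurableTypeE.
Qed.

Lemma Gmeas_measurable G f : G `<=` measurable -> Gmeas G f -> measurable_fun setT f.
Proof. by move=> Gm h _ B mB; rewrite setTI; apply: Gm; exact: h. Qed.

(** The sum is [y] rounded down to the grid of step 1 / m: exactly one of the half-open cells
    contains [y]. *)
Lemma indic_preimage_cell (m : nat) (y : R) (J : nat) : (0 < m)%N ->
  - J%:R <= m%:R * y < J%:R ->
  `|y - \sum_(j < J.*2) ((j%:R - J%:R) / m%:R) *
     \1_(`[(j%:R - J%:R) / m%:R, (j%:R + 1 - J%:R) / m%:R[%classic) y| <= m%:R^-1.
Proof.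
move=> m0 /andP[yl yu].
have mp : 0 < m%:R :> R by rewrite ltr0n.
have w0 : 0 <= m%:R * y + J%:R by lra.
pose j0 := Num.truncn (m%:R * y + J%:R).
have /andP[j1 j2] := truncn_itv w0.
have j0J : (j0 < J.*2)%N.
  by rewrite -(ltr_nat R) (le_lt_trans j1)// -addnn natrD; lra.
rewrite (bigD1 (Ordinal j0J))//= big1 ?addr0 => [|j jj0].
  rewrite indicE mem_set ?mulr1; last first.
    rewrite /= in_itv/= ler_pdivrMr// ltr_pdivlMr// mulrC.
    by rewrite -natr1 in j2; apply/andP; split; move: j1 j2; rewrite -/j0; lra.
  rewrite ler_norml; rewrite -natr1 in j2; move: j1 j2; rewrite -/j0 => j1 j2.
  have -> : y = (m%:R * y) / m%:R by rewrite mulrC mulKf ?gt_eqF.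
  have mi : 0 < (m%:R : R)^-1 by rewrite invr_gt0.
  by rewrite -mulrBl; apply/andP; split; nra.
rewrite indicE memNset ?mulr0// /= in_itv/= ler_pdivrMr// ltr_pdivlMr// mulrC.
move=> /andP[h1 h2].
have jj : (j <= j0)%N by rewrite -ltnS -(ltr_nat R) (le_lt_trans _ j2)//; lra.
have jj' : (j0 <= j)%N.
  by rewrite -ltnS -(ltr_nat R) -natr1 (le_lt_trans j1)//; lra.
by move/eqP: jj0; apply; apply/val_inj/eqP; rewrite /= eqn_leq jj.
Qed.

(** The martingale identity is given on events only. Rounding [xi] to a finite combination of
    indicators of events of [G] changes the expectation by at most E |N| / m, which can be made
    smaller than any [e]. *)
Lemma Ex_weight_bounded G (N xi : T -> R) (c : R) : sigma_algebra setT G ->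
  G `<=` measurable -> Li N -> (forall A, G A -> Ex (fun x => \1_A x * N x) = 0) ->
  Gmeas G xi -> (forall x, `|xi x| <= c) -> Ex (fun x => xi x * N x) = 0.
Proof.
move=> sG Gm LN N0 mxi bxi.
have mx := Gmeas_measurable Gm mxi.
have LxN : Li (fun x => xi x * N x).
  apply: (@Li_le _ _ _ _ _ (fun x => c * `|N x|)).
  - by apply: measurable_funM => //; exact: Li_meas LN.
  - by move=> x; rewrite normrM ler_wpM2r.
  - by apply: LiZl; exact: Li_norm.
apply/eqP; rewrite -normr_le0; apply/ler_addgt0Pl => e e0; rewrite addr0.
set A := Ex (fun x => `|N x|); have A0 : 0 <= A by exact: Ex_ge0.
pose m := (Num.truncn (A / e)).+1.
have mp : 0 < m%:R :> R by rewrite ltr0n.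
have Am : A <= m%:R * e.
  rewrite -ler_pdivrMr//; apply: ltW; rewrite /m.
  by have /andP[_] := truncn_itv (divr_ge0 A0 (ltW e0)).
pose J := (Num.truncn (m%:R * c)).+1.
have c0 : 0 <= c by apply: le_trans (bxi point).
have Jc : m%:R * c < J%:R by have /andP[_] := truncn_itv (mulr_ge0 (ltW mp) c0).
pose B (j : 'I_J.*2) : set R :=
  `[(j%:R - J%:R) / m%:R, (j%:R + 1 - J%:R) / m%:R[%classic.
pose xm (x : T) : R := \sum_(j < J.*2) ((j%:R - J%:R) / m%:R) * \1_(B j) (xi x).
have xE x j : \1_(B j) (xi x) = \1_(xi @^-1` B j) x :> R.
  by rewrite !indicE; congr (nat_of_bool _)%:R; apply/idP/idP => /set_mem h; apply/mem_set.
have GB j : G (xi @^-1` B j) by apply: mxi; exact: measurable_itv.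
have L1 (j : 'I_J.*2) : Li (fun x => ((j%:R - J%:R) / m%:R) * (\1_(xi @^-1` B j) x * N x)).
  apply: LiZl; apply: (@Li_le _ _ _ _ _ (fun x => `|N x|)).
  - by apply: measurable_funM; [exact/measurable_indic/Gm|exact: Li_meas LN].
  - move=> x; rewrite normrM indicE; case: (x \in _); rewrite ?normr1 ?mul1r//.
    by rewrite normr0 mul0r.
  - exact: Li_norm.
have xmE x : xm x * N x =
    \sum_(j < J.*2) ((j%:R - J%:R) / m%:R) * (\1_(xi @^-1` B j) x * N x).
  by rewrite mulr_suml; apply: eq_bigr => j _; rewrite xE mulrA.
have Lxm : Li (fun x => xm x * N x).
  by under eq_fun do rewrite xmE; apply: Li_sum => j _; exact: L1.
have Exm : Ex (fun x => xm x * N x) = 0.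
  under eq_Ex do rewrite xmE.
  rewrite Ex_sum => [|j _]; last exact: L1.
  apply: big1 => j _; rewrite ExZl ?N0 ?mulr0//.
  apply: (@Li_le _ _ _ _ _ (fun x => `|N x|)).
  - by apply: measurable_funM; [exact/measurable_indic/Gm|exact: Li_meas LN].
  - move=> x; rewrite normrM indicE; case: (x \in _); rewrite ?normr1 ?mul1r//.
    by rewrite normr0 mul0r.
  - exact: Li_norm.
rewrite -[X in `|X|]subr0 -{1}Exm -ExB//.
apply: (@le_trans _ _ (Ex (fun x => m%:R^-1 * `|N x|))).
  apply: norm_Ex_le; first exact: LiB.
    by apply: LiZl; exact: Li_norm.
  move=> x; rewrite -mulrBl normrM ler_wpM2r//.
  apply: indic_preimage_cell => //.
  have := bxi x; rewrite ler_norml => /andP[b1 b2].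
  by apply/andP; split; nra.
rewrite ExZl; last exact: Li_norm.
by rewrite mulrC ler_pdivrMr// mulrC.
Qed.

(** Truncation and dominated convergence. Unbounded weights such as xi Z_k occur in the computation
    of second moments of increments. *)
Lemma Ex_weight G (N xi : T -> R) : sigma_algebra setT G ->
  G `<=` measurable -> Li N -> (forall A, G A -> Ex (fun x => \1_A x * N x) = 0) ->
  Gmeas G xi -> Li (fun x => xi x * N x) -> Ex (fun x => xi x * N x) = 0.
Proof.
move=> sG Gm LN N0 mxi LxN.
have mx := Gmeas_measurable Gm mxi.
pose x_ (n : nat) x := \1_[set x | `|xi x| <= n%:R] x * xi x.
have GA (n : nat) : G [set x | `|xi x| <= n%:R].
  rewrite (_ : [set x | _] = xi @^-1` `[- n%:R, n%:R]%classic).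
    by apply: mxi; exact: measurable_itv.
  by apply/seteqP; split => x /=; rewrite in_itv/= ler_norml.
have mx_ n : Gmeas G (x_ n).
  apply/(GmeasE _ sG); apply: measurable_funM; last exact/(GmeasE _ sG).
  by apply: measurable_indic; rewrite measurable_g_measurableTypeE.
have E0 n : Ex (fun x => x_ n x * N x) = 0.
  apply: (@Ex_weight_bounded G N (x_ n) n%:R) => // x.
  rewrite /x_ indicE; have [/set_mem/= h|_] := boolP (x \in _).
    by rewrite mul1r.
  by rewrite mul0r normr0.
have := @cvg_Ex (fun n x => x_ n x * N x) (fun x => xi x * N x)
  (fun x => `|xi x * N x|).
rewrite (_ : (fun n => Ex _) = fun=> 0); last by apply/funext => n; exact: E0.
move=> H.
suff /cvg_unique : (fun n : nat => 0 : R) @ \oo --> Ex (fun x => xi x * N x).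
  by move=> /(_ (@Rhausdorff R) _ (cvg_cst 0)) ->.
apply: H.
- move=> n; apply: measurable_funM; last exact: Li_meas LN.
  exact: Gmeas_measurable Gm (mx_ n).
- exact: Li_meas LxN.
- move=> x; apply: cvg_near_cst; exists (Num.truncn `|xi x|).+1 => // n /= hn.
  rewrite /x_ indicE mem_set ?mul1r//=.
  have /andP[_ h] := truncn_itv (normr_ge0 (xi x)).
  by apply: le_trans (ltW h) _; rewrite ler_nat.
- move=> n x; rewrite /x_ -mulrA normrM indicE.
  by case: (x \in _); rewrite ?normr1 ?mul1r// normr0 mul0r.
- exact: Li_norm.
Qed.

Lemma Rintegral_indicM A (f : T -> R) : measurable A ->
  Ex (fun x => \1_A x * f x) = fine (\int[P]_(x in A) (f x)%:E)%E.
Proof.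
move=> mA; rewrite /Ex /Rintegral [in RHS]integral_mkcond; congr fine.
apply: eq_integral => x _; rewrite patchE indicE.
by case: ifPn => _; rewrite ?mul1r ?mul0r.
Qed.

Variable F : R -> set (set T).
Hypothesis filtF : is_filtration F.

Lemma filt_sa t : 0 <= t -> sigma_algebra setT (F t).
Proof. by move=> t0; exact: (filtF.1 t t0).1. Qed.

Lemma filt_meas t : 0 <= t -> F t `<=` measurable.
Proof. by move=> t0; exact: (filtF.1 t t0).2. Qed.

Lemma adapted_Gmeas M t : adapted F M -> 0 <= t -> Gmeas (F t) (M t).
Proof. by move=> aM t0 B mB; exact: aM. Qed.

Lemma Gmeas_filt s t f : 0 <= s -> s <= t -> Gmeas (F s) f -> Gmeas (F t) f.
Proof. by move=> s0 st h B mB; apply: (filtF.2 s t s0 st); exact: h. Qed.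

Lemma martingale_increment M s t xi : martingale P F M -> 0 <= s -> s <= t ->
  Gmeas (F s) xi -> Li (fun x => xi x * (M t x - M s x)) ->
  Ex (fun x => xi x * (M t x - M s x)) = 0.
Proof.
move=> [aM LM mM] s0 st mxi Lxi.
have t0 := le_trans s0 st.
apply: (@Ex_weight (F s)) => //.
- exact: filt_sa.
- exact: filt_meas.
- by apply: LiB; exact: LM.
- move=> A FA; have mA := filt_meas s0 FA.
  have LA u : 0 <= u -> Li (fun x => \1_A x * M u x).
    move=> u0; have := LM u u0 => Lu.
    apply: (@Li_le _ _ _ _ _ (fun x => `|M u x|)).
    + by apply: measurable_funM; [exact: measurable_indic|exact: Li_meas Lu].
    + move=> x; rewrite normrM indicE.
      by case: (x \in _); rewrite ?normr1 ?mul1r// normr0 mul0r.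
    + exact: Li_norm.
  under eq_Ex do rewrite mulrBr.
  have E := mM s t s0 st A FA.
  rewrite ExB; [|exact: LA|exact: LA].
  by rewrite !Rintegral_indicM// E subrr.
Qed.

End martingale.

(** * Slepian comparison for martingales *)

Section smooth_functions.
Context {R : realType} {n : nat}.
Implicit Types (F : ('I_n -> R) -> R) (z v : 'I_n -> R).

Definition vadd z v : 'I_n -> R := fun k => z k + v k.
Definition l1 v : R := \sum_(k < n) `|v k|.
Definition lin1 (D1 : 'I_n -> R) v : R := \sum_(k < n) D1 k * v k.
Definition quad (D2 : 'I_n -> 'I_n -> R) v : R :=
  \sum_(k < n) \sum_(l < n) D2 k l * (v k * v l).

(* measurability of F on R^n, stated without a sigma-algebra on 'I_n -> R *)
Definition mfunc F := forall d' (T' : measurableType d') (Z : 'I_n -> T' -> R),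
  (forall k, measurable_fun setT (Z k)) ->
  measurable_fun setT (fun x => F (fun k => Z k x)).

(* C^2 functions with bounded derivatives D1, D2 and a cubic Taylor remainder; the
   remainder bound is all that the third derivatives would be used for *)
Record C3 (K : R) F (D1 : 'I_n -> ('I_n -> R) -> R)
    (D2 : 'I_n -> 'I_n -> ('I_n -> R) -> R) : Prop := MkC3 {
  c3_m0 : mfunc F;
  c3_m1 : forall k, mfunc (D1 k);
  c3_m2 : forall k l, mfunc (D2 k l);
  c3_b0 : forall z, `|F z| <= K;
  c3_b1 : forall k z, `|D1 k z| <= K;
  c3_b2 : forall k l z, `|D2 k l z| <= K;
  c3_taylor : forall z v, `|F (vadd z v) - F z - lin1 (D1 ^~ z) v -
    2^-1 * quad (fun k l => D2 k l z) v| <= K * l1 v ^+ 3 }.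

Lemma l1_ge0 v : 0 <= l1 v.
Proof. exact: sumr_ge0. Qed.

Lemma l1_cube v : l1 v ^+ 3 <= n%:R ^+ 3 * \sum_(k < n) `|v k| ^+ 3.
Proof.
have [n0|n0] := posnP n.
  rewrite /l1 big1 ?expr0n/=; first by rewrite mulr_ge0 ?exprn_ge0// sumr_ge0.
  by move=> [k kn]; exfalso; rewrite n0 in kn.
pose k0 := [arg max_(i > Ordinal n0) `|v i|]%O.
have k0P i : `|v i| <= `|v k0|.
  by rewrite /k0; case: arg_maxP => //= j _ h; exact: h.
have h1 : l1 v <= n%:R * `|v k0|.
  apply: (@le_trans _ _ (\sum_(k < n) `|v k0|)); first exact: ler_sum.
  by rewrite sumr_const card_ord mulr_natl.
apply: (@le_trans _ _ ((n%:R * `|v k0|) ^+ 3)).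
  by apply: lerXn2r; rewrite ?nnegrE ?l1_ge0 ?mulr_ge0.
rewrite exprMn ler_wpM2l ?exprn_ge0// (bigD1 k0)//= lerDl.
by apply: sumr_ge0 => i _; rewrite exprn_ge0.
Qed.

End smooth_functions.

Section systems.
Context {R : realType} {d : measure_display} {T : measurableType d}.
Variable P : probability T R.
Local Notation Li := (Li P).
Local Notation Ex := (Ex P).
Local Notation pr := (pr P).
Variable F : R -> set (set T).
Hypothesis filtF : is_filtration F.

(* TI k l t is the bracket of Z k and Z l at time t *)
Record msys n (Z : 'I_n -> R -> T -> R) (TI : 'I_n -> 'I_n -> R -> T -> R)
    (kap : R) : Prop := MSys {
  ms_kap : 0 < kap;
  ms_mart : forall k, martingale P F (Z k);
  ms_cov : forall k l, martingale P F (fun t x => Z k t x * Z l t x - TI k l t x);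
  ms_sub : forall k s t, 0 <= s -> s < t ->
    subgaussian P (fun x => Z k t x - Z k s x) (kap ^+ 2 * (t - s));
  ms_TI : forall k l s t x, 0 <= s -> s <= t ->
    `|TI k l t x - TI k l s x| <= kap ^+ 2 * (t - s);
  ms_0 : forall k x, Z k 0 x = 0 }.

Lemma Li_mul_sq (f g : T -> R) : measurable_fun setT f -> measurable_fun setT g ->
  Li (fun x => f x ^+ 2) -> Li (fun x => g x ^+ 2) -> Li (fun x => f x * g x).
Proof.
move=> mf mg Lf Lg.
apply: (@Li_le _ _ _ _ _ (fun x => f x ^+ 2 + g x ^+ 2)).
- exact: measurable_funM.
- move=> x; rewrite ler_norml; apply/andP; split; nra.
- exact: LiD.
Qed.

Section one_system.
Variables (n : nat) (Z : 'I_n -> R -> T -> R) (TI : 'I_n -> 'I_n -> R -> T -> R).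
Variable kap : R.
Hypothesis ZS : msys Z TI kap.

Lemma sys_Li k t : 0 <= t -> Li (Z k t).
Proof. by move=> t0; have [_ L _] := ms_mart ZS k; exact: L. Qed.

Lemma sys_meas k t : 0 <= t -> measurable_fun setT (Z k t).
Proof. by move=> /(sys_Li k)/Li_meas. Qed.

Lemma sys_Gmeas k s : 0 <= s -> Gmeas (F s) (Z k s).
Proof. by move=> s0; have [a _ _] := ms_mart ZS k; exact: adapted_Gmeas. Qed.

Lemma sys_Lisq k t : 0 <= t -> Li (fun x => Z k t x ^+ 2).
Proof.
move=> t0; have [->|t00] := eqVneq t 0.
  by under eq_fun do rewrite (ms_0 ZS) expr0n/=; exact: Li_cst.
have tp : 0 < t by rewrite lt_def t00.
have := subgaussian_Li_sq (ms_sub ZS k (lexx 0) tp).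
by under eq_fun do rewrite (ms_0 ZS) subr0.
Qed.

Lemma sys_Li2 k l s t : 0 <= s -> 0 <= t -> Li (fun x => Z k s x * Z l t x).
Proof.
by move=> s0 t0; apply: Li_mul_sq; [exact: sys_meas..|exact: sys_Lisq|exact: sys_Lisq].
Qed.

Lemma sys_LiTI k l t : 0 <= t -> Li (TI k l t).
Proof.
move=> t0; have [_ L _] := ms_cov ZS k l.
have -> : TI k l t = fun x => Z k t x * Z l t x -
    (Z k t x * Z l t x - TI k l t x) by apply/funext => x; ring.
by apply: LiB; [exact: sys_Li2|exact: L].
Qed.

Lemma Li_bweight (xi f : T -> R) c : measurable_fun setT xi ->
  (forall x, `|xi x| <= c) -> Li f -> Li (fun x => xi x * f x).
Proof.
move=> mx bx Lf; apply: (@Li_le _ _ _ _ _ (fun x => c * `|f x|)).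
- by apply: measurable_funM => //; exact: Li_meas Lf.
- by move=> x; rewrite normrM ler_wpM2r.
- by apply: LiZl; exact: Li_norm.
Qed.

Lemma sys_inc1 k s t (xi : T -> R) c : 0 <= s -> s <= t -> Gmeas (F s) xi ->
  (forall x, `|xi x| <= c) -> Ex (fun x => xi x * (Z k t x - Z k s x)) = 0.
Proof.
move=> s0 st mxi bxi; apply: (martingale_increment filtF (ms_mart ZS k)) => //.
apply: Li_bweight bxi _; first exact: Gmeas_measurable (filt_meas filtF s0) mxi.
by apply: LiB; apply: sys_Li => //; exact: le_trans st.
Qed.

(** The product of the increments is the increment of the martingale Z_k Z_l - TI, plus the bracket
    increment, minus two terms Z_k (s) dZ_l and Z_l (s) dZ_k; against a weight known at time s only
    the bracket survives. *)
Lemma sys_inc2 k l s t (xi : T -> R) c : 0 <= s -> s <= t -> Gmeas (F s) xi ->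
  (forall x, `|xi x| <= c) ->
  Ex (fun x => xi x * ((Z k t x - Z k s x) * (Z l t x - Z l s x))) =
  Ex (fun x => xi x * (TI k l t x - TI k l s x)).
Proof.
move=> s0 st mxi bxi; have t0 := le_trans s0 st.
have mx : measurable_fun setT xi by exact: Gmeas_measurable (filt_meas filtF s0) mxi.
have sa := filt_sa filtF s0.
have W j : Gmeas (F s) (fun x => xi x * Z j s x).
  apply/(GmeasE _ sa); apply: measurable_funM; apply/(GmeasE _ sa) => //.
  exact: sys_Gmeas.
have L1 i j : Li (fun x => xi x * Z i s x * (Z j t x - Z j s x)).
  under eq_fun do rewrite -mulrA.
  apply: Li_bweight bxi _ => //; under eq_fun do rewrite mulrBr.
  by apply: LiB; apply: sys_Li2.
have LN u : 0 <= u -> Li (fun x => Z k u x * Z l u x - TI k l u x).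
  by move=> u0; apply: LiB; [exact: sys_Li2|exact: sys_LiTI].
have L2 : Li (fun x => xi x * ((Z k t x * Z l t x - TI k l t x) -
    (Z k s x * Z l s x - TI k l s x))).
  by apply: Li_bweight bxi _ => //; apply: LiB; apply: LN.
have L3 : Li (fun x => xi x * (TI k l t x - TI k l s x)).
  by apply: Li_bweight bxi _ => //; apply: LiB; apply: sys_LiTI.
have E1 := martingale_increment filtF (ms_mart ZS l) s0 st (W k) (L1 k l).
have E2 := martingale_increment filtF (ms_mart ZS k) s0 st (W l) (L1 l k).
have E3 := martingale_increment filtF (ms_cov ZS k l) s0 st mxi L2.
transitivity (Ex (fun x => xi x * (TI k l t x - TI k l s x) +
   (xi x * ((Z k t x * Z l t x - TI k l t x) -
    (Z k s x * Z l s x - TI k l s x)) -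
    xi x * Z k s x * (Z l t x - Z l s x) -
    xi x * Z l s x * (Z k t x - Z k s x)))).
  by apply: eq_Ex => x; ring.
rewrite ExD//; last by apply: LiB => //; exact: LiB.
rewrite ExB//; last exact: LiB.
by rewrite ExB// E1 E2 E3 !subr0 addr0.
Qed.

(** n^3 comes from [l1_cube], one more n from the number of coordinates, and 12 e kap^3 from
    [subgaussian_cube]. *)
Definition stepc : R := n%:R ^+ 4 * (12 * expR 1) * kap ^+ 3.

Lemma stepc_ge0 : 0 <= stepc.
Proof.
rewrite /stepc; apply: mulr_ge0; last by rewrite exprn_ge0// ltW// (ms_kap ZS).
by rewrite mulr_ge0 ?exprn_ge0// mulr_ge0 ?expR_ge0.
Qed.

Lemma sys_mfunc u z s : mfunc u -> 0 <= s ->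
  Gmeas (F s) (fun x => u (vadd z (fun k => Z k s x))).
Proof.
move=> mu s0; have sa := filt_sa filtF s0; apply/(GmeasE _ sa).
apply: (mu _ (g_sigma_algebraType (F s)) (fun k x => z k + Z k s x)) => k.
apply: measurable_funD; first exact: measurable_cst.
by apply/(GmeasE _ sa); exact: sys_Gmeas.
Qed.

Lemma sys_mfunc_meas u z s : mfunc u -> 0 <= s ->
  measurable_fun setT (fun x => u (vadd z (fun k => Z k s x))).
Proof.
move=> mu s0; exact: Gmeas_measurable (filt_meas filtF s0) (sys_mfunc z mu s0).
Qed.

(** Plays the part of Ito's formula on [s, t]: given time s, the linear Taylor term has mean zero
    and the quadratic one becomes the bracket increment weighted by the Hessian at time s. The order
    3/2 of the error makes it vanish when summed over many short steps. *)
Lemma one_step K u D1 D2 z s t : C3 K u D1 D2 -> 0 <= s -> s < t ->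
  `|Ex (fun x => u (vadd z (fun k => Z k t x))) -
    Ex (fun x => u (vadd z (fun k => Z k s x))) -
    2^-1 * \sum_(k < n) \sum_(l < n)
      Ex (fun x => D2 k l (vadd z (fun k => Z k s x)) * (TI k l t x - TI k l s x))|
  <= K * stepc * Num.sqrt (t - s) ^+ 3.
Proof.
move=> cu s0 st; have t0 := le_trans s0 (ltW st).
have K0 : 0 <= K by exact: le_trans (c3_b0 cu z).
pose y x := vadd z (fun k => Z k s x).
pose v x : 'I_n -> R := fun k => Z k t x - Z k s x.
have ev x : vadd z (fun k => Z k t x) = vadd (y x) (v x).
  by apply/funext => k; rewrite /vadd /v /y /vadd; ring.
have Lu r : 0 <= r -> Li (fun x => u (vadd z (fun k => Z k r x))).
  move=> r0; apply: (@Li_bdd _ _ _ _ _ K); last by move=> x; exact: (c3_b0 cu).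
  exact: sys_mfunc_meas (c3_m0 cu) r0.
have G1 k : Gmeas (F s) (fun x => D1 k (y x)) by exact: sys_mfunc (c3_m1 cu k) s0.
have G2 k l : Gmeas (F s) (fun x => D2 k l (y x)) by exact: sys_mfunc (c3_m2 cu k l) s0.
have M1 k := Gmeas_measurable (filt_meas filtF s0) (G1 k).
have M2 k l := Gmeas_measurable (filt_meas filtF s0) (G2 k l).
have L1 k : Li (fun x => D1 k (y x) * v x k).
  apply: Li_bweight (M1 k) (fun x => c3_b1 cu k (y x)) _.
  by apply: LiB; apply: sys_Li.
have Lvv k l : Li (fun x => v x k * v x l).
  rewrite /v; under eq_fun do rewrite mulrBl !mulrBr.
  by apply: LiB; apply: LiB; exact: sys_Li2.
have L2 k l : Li (fun x => D2 k l (y x) * (v x k * v x l)).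
  by apply: Li_bweight (M2 k l) (fun x => c3_b2 cu k l (y x)) _.
have Llin : Li (fun x => lin1 (D1 ^~ (y x)) (v x)) by apply: Li_sum => k _.
have Lquad : Li (fun x => quad (fun k l => D2 k l (y x)) (v x)).
  by apply: Li_sum => k _; apply: Li_sum.
have E1 : Ex (fun x => lin1 (D1 ^~ (y x)) (v x)) = 0.
  rewrite Ex_sum//; apply: big1 => k _.
  by apply: sys_inc1 (ltW st) (G1 k) (fun x => c3_b1 cu k (y x)).
have E2 : Ex (fun x => quad (fun k l => D2 k l (y x)) (v x)) =
    \sum_(k < n) \sum_(l < n) Ex (fun x => D2 k l (y x) * (TI k l t x - TI k l s x)).
  rewrite Ex_sum => [|k _]; last exact: Li_sum.
  apply: eq_bigr => k _; rewrite Ex_sum//; apply: eq_bigr => l _.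
  by apply: sys_inc2 (ltW st) (G2 k l) (fun x => c3_b2 cu k l (y x)).
have -> : Ex (fun x => u (vadd z (fun k => Z k t x))) -
    Ex (fun x => u (vadd z (fun k => Z k s x))) -
    2^-1 * \sum_(k < n) \sum_(l < n)
      Ex (fun x => D2 k l (vadd z (fun k => Z k s x)) * (TI k l t x - TI k l s x)) =
  Ex (fun x => u (vadd (y x) (v x)) - u (y x) - lin1 (D1 ^~ (y x)) (v x) -
    2^-1 * quad (fun k l => D2 k l (y x)) (v x)).
  have -> : (fun x => u (vadd (y x) (v x)) - u (y x) - lin1 (D1 ^~ (y x)) (v x) -
      2^-1 * quad (fun k l => D2 k l (y x)) (v x)) =
    (fun x => u (vadd z (fun k => Z k t x)) - u (vadd z (fun k => Z k s x))
      - lin1 (D1 ^~ (y x)) (v x) - 2^-1 * quad (fun k l => D2 k l (y x)) (v x)).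
    by apply/funext => x; rewrite ev.
  rewrite ExB; [|by apply: LiB => //; apply: LiB; apply: Lu|exact: LiZl].
  rewrite ExB//; last by apply: LiB; apply: Lu.
  by rewrite ExB ?ExZl ?E1 ?E2 ?subr0//; apply: Lu.
have sub k := ms_sub ZS k s0 st.
have vp : 0 < kap ^+ 2 * (t - s).
  by rewrite mulr_gt0 ?exprn_gt0 ?(ms_kap ZS)// subr_gt0.
have Lc k : Li (fun x => `|v x k| ^+ 3) by exact: subgaussian_Li_cube (sub k).
have LS : Li (fun x => \sum_(k < n) `|v x k| ^+ 3) by apply: Li_sum.
apply: (@le_trans _ _ (Ex (fun x => K * (n%:R ^+ 3 * \sum_(k < n) `|v x k| ^+ 3)))).
  apply: norm_Ex_le.
  - apply: LiB; last exact: LiZl.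
    apply: LiB => //; apply: LiB; last exact: Lu.
    by under eq_fun do rewrite -ev; exact: Lu.
  - by apply: LiZl; exact: LiZl.
  - move=> x; apply: le_trans (c3_taylor cu _ _) _.
    by rewrite ler_wpM2l// l1_cube.
rewrite !ExZl//; last exact: LiZl.
rewrite -mulrA ler_wpM2l// Ex_sum//.
have -> : stepc * Num.sqrt (t - s) ^+ 3 =
  n%:R ^+ 3 * (n%:R * (12 * expR 1 * (kap * Num.sqrt (t - s)) ^+ 3)).
  by rewrite /stepc exprMn; ring.
rewrite ler_wpM2l ?exprn_ge0//.
apply: (@le_trans _ _ (\sum_(k < n) (12 * expR 1 * (kap * Num.sqrt (t - s)) ^+ 3))).
  apply: ler_sum => k _; apply: le_trans (subgaussian_cube (sub k) vp) _.
  rewrite sqrtrM ?exprn_ge0//; last by rewrite ltW// (ms_kap ZS).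
  by rewrite sqrtr_sqr gtr0_norm// (ms_kap ZS).
by rewrite sumr_const card_ord [n%:R * _]mulr_natl.
Qed.

End one_system.
End systems.

Section c3_mul.
Context {R : realType} {n : nat}.
Implicit Types (z v : 'I_n -> R).

Lemma lin1_le (D1 : 'I_n -> R) K v : (forall k, `|D1 k| <= K) ->
  `|lin1 D1 v| <= K * l1 v.
Proof.
move=> bD; rewrite /lin1 /l1 mulr_sumr; apply: le_trans (ler_norm_sum _ _ _) _.
by apply: ler_sum => k _; rewrite normrM ler_wpM2r.
Qed.

Lemma quad_le (D2 : 'I_n -> 'I_n -> R) K v : (forall k l, `|D2 k l| <= K) ->
  `|quad D2 v| <= K * l1 v ^+ 2.
Proof.
move=> bD; rewrite /quad expr2 [l1 v * _]mulr_suml mulr_sumr.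
apply: le_trans (ler_norm_sum _ _ _) _; apply: ler_sum => k _.
rewrite /l1 !mulr_sumr; apply: le_trans (ler_norm_sum _ _ _) _.
by apply: ler_sum => l _; rewrite !normrM ler_wpM2r// mulr_ge0.
Qed.

Lemma mfuncM (f g : ('I_n -> R) -> R) : mfunc f -> mfunc g ->
  mfunc (fun z => f z * g z).
Proof.
by move=> mf mg d' T' Z mZ; apply: measurable_funM; [exact: mf|exact: mg].
Qed.

Lemma mfuncD (f g : ('I_n -> R) -> R) : mfunc f -> mfunc g ->
  mfunc (fun z => f z + g z).
Proof.
by move=> mf mg d' T' Z mZ; apply: measurable_funD; [exact: mf|exact: mg].
Qed.

Lemma C3_mul K f f1 f2 g g1 g2 : @C3 R n K f f1 f2 -> @C3 R n K g g1 g2 ->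
  C3 (6 * K ^+ 2) (fun z => f z * g z)
    (fun k z => f1 k z * g z + f z * g1 k z)
    (fun k l z => f2 k l z * g z + f1 k z * g1 l z + f1 l z * g1 k z
                  + f z * g2 k l z).
Proof.
move=> cf cg.
have K0 : 0 <= K by exact: le_trans (c3_b0 cf (fun=> 0)).
have bM (x y : R) : `|x| <= K -> `|y| <= K -> `|x * y| <= K ^+ 2.
  by move=> bx ky; rewrite normrM expr2 ler_pM.
have K2 : 0 <= K ^+ 2 by rewrite sqr_ge0.
split.
- by apply: mfuncM; [exact: c3_m0 cf|exact: c3_m0 cg].
- move=> k; apply: mfuncD; apply: mfuncM; [exact: (c3_m1 cf)|exact: (c3_m0 cg)|
    exact: (c3_m0 cf)|exact: (c3_m1 cg)].
- move=> k l; apply: mfuncD; last first.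
    by apply: mfuncM; [exact: (c3_m0 cf)|exact: (c3_m2 cg)].
  apply: mfuncD; last by apply: mfuncM; [exact: (c3_m1 cf)|exact: (c3_m1 cg)].
  apply: mfuncD; apply: mfuncM; [exact: (c3_m2 cf)|exact: (c3_m0 cg)|
    exact: (c3_m1 cf)|exact: (c3_m1 cg)].
- move=> z; have := bM _ _ (c3_b0 cf z) (c3_b0 cg z); lra.
- move=> k z; have := bM _ _ (c3_b1 cf k z) (c3_b0 cg z).
  have := bM _ _ (c3_b0 cf z) (c3_b1 cg k z) => h1 h2.
  by apply: le_trans (ler_normD _ _) _; lra.
- move=> k l z; have := bM _ _ (c3_b2 cf k l z) (c3_b0 cg z) => h1.
  have := bM _ _ (c3_b0 cf z) (c3_b2 cg k l z) => h2.
  have := bM _ _ (c3_b1 cf k z) (c3_b1 cg l z) => h3.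
  have := bM _ _ (c3_b1 cf l z) (c3_b1 cg k z) => h4.
  apply: le_trans (ler_normD _ _) _; apply: le_trans (lerD (ler_normD _ _) (lexx _)) _.
  by apply: le_trans (lerD (lerD (ler_normD _ _) (lexx _)) (lexx _)) _; lra.
move=> z v.
pose lf := lin1 (f1 ^~ z) v; pose lg := lin1 (g1 ^~ z) v.
pose qf := quad (fun k l => f2 k l z) v; pose qg := quad (fun k l => g2 k l z) v.
set l := l1 v; have l0 : 0 <= l by exact: l1_ge0.
have -> : lin1 ((fun k z => f1 k z * g z + f z * g1 k z) ^~ z) v =
    lf * g z + f z * lg.
  rewrite /lin1 /lf /lg /lin1 mulr_suml mulr_sumr -big_split/=.
  by apply: eq_bigr => k _; ring.
have -> : quad (fun k l => f2 k l z * g z + f1 k z * g1 l z + f1 l z * g1 k z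
     + f z * g2 k l z) v = qf * g z + 2 * (lf * lg) + f z * qg.
  have -> : 2 * (lf * lg) = lf * lg + lg * lf by ring.
  rewrite /quad /qf /qg /quad /lf /lg /lin1 !mulr_suml !mulr_sumr -!big_split/=.
  apply: eq_bigr => k _; rewrite !mulr_suml !mulr_sumr -!big_split/=.
  by apply: eq_bigr => m _; ring.
pose e1 := f (vadd z v) - f z - lf - 2^-1 * qf.
pose e2 := g (vadd z v) - g z - lg - 2^-1 * qg.
have b1 : `|e1| <= K * l ^+ 3 by exact: (c3_taylor cf z v).
have b2 : `|e2| <= K * l ^+ 3 by exact: (c3_taylor cg z v).
have blf : `|lf| <= K * l by apply: lin1_le => k; exact: c3_b1 cf k z.
have blg : `|lg| <= K * l by apply: lin1_le => k; exact: c3_b1 cg k z.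
have bqf : `|qf| <= K * l ^+ 2 by apply: quad_le => k m; exact: c3_b2 cf k m z.
have bqg : `|qg| <= K * l ^+ 2 by apply: quad_le => k m; exact: c3_b2 cg k m z.
have bf := c3_b0 cf z; have bg := c3_b0 cg z.
have bf' := c3_b0 cf (vadd z v); have bg' := c3_b0 cg (vadd z v).
have MM (x y a b : R) : `|x| <= a -> `|y| <= b -> `|x * y| <= a * b.
  by move=> bx ky; rewrite normrM ler_pM.
have half (x a : R) : `|x| <= a -> `|2^-1 * x| <= 2^-1 * a.
  by move=> h; rewrite normrM ger0_norm ?invr_ge0// ler_wpM2l ?invr_ge0.
have l2 : 0 <= l ^+ 2 by exact: exprn_ge0.
have l3 : 0 <= l ^+ 3 by exact: exprn_ge0.
(* For short increments the two expansions are multiplied out and every excess term carries a factor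
   l^3; for l > 1 each term separately is bounded by a multiple of K^2 l^3. *)
have [lle|lgt] := leP l 1.
- have -> : f (vadd z v) * g (vadd z v) - f z * g z - (lf * g z + f z * lg) -
      2^-1 * (qf * g z + 2 * (lf * lg) + f z * qg) =
    f (vadd z v) * e2 + e1 * (g z + lg + 2^-1 * qg) +
    (2^-1 * (lf * qg) + 2^-1 * (qf * lg) + (2^-1 * qf) * (2^-1 * qg)).
    by rewrite /e1 /e2; field.
  have h1 := MM _ _ _ _ bf' b2.
  have bG : `|g z + lg + 2^-1 * qg| <= K + K * l + 2^-1 * (K * l ^+ 2).
    apply: le_trans (ler_normD _ _) (lerD _ (half _ _ bqg)).
    exact: le_trans (ler_normD _ _) (lerD bg blg).
  have h2 := MM _ _ _ _ b1 bG.
  have h3 := half _ _ (MM _ _ _ _ blf bqg).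
  have h4 := half _ _ (MM _ _ _ _ bqf blg).
  have h5 := MM _ _ _ _ (half _ _ bqf) (half _ _ bqg).
  apply: le_trans (ler_normD _ _) _; apply: le_trans (lerD (ler_normD _ _) (ler_normD _ _)) _.
  apply: le_trans (lerD (lexx _) (lerD (ler_normD _ _) (lexx _))) _.
  apply: le_trans (lerD (lerD h1 h2) (lerD (lerD h3 h4) h5)) _.
  have -> : K * (K * l ^+ 3) + K * l ^+ 3 * (K + K * l + 2^-1 * (K * l ^+ 2)) +
     (2^-1 * (K * l * (K * l ^+ 2)) + 2^-1 * (K * l ^+ 2 * (K * l)) +
      2^-1 * (K * l ^+ 2) * (2^-1 * (K * l ^+ 2))) =
     (K ^+ 2 * l ^+ 3) * (3 + l + 2^-1 * l ^+ 2 + 4^-1 * l) by field.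
  rewrite (_ : 6 * K ^+ 2 * l ^+ 3 = K ^+ 2 * l ^+ 3 * 6); last by ring.
  by rewrite ler_wpM2l ?mulr_ge0//; nra.
- have h1 := MM _ _ _ _ bf' bg'.
  have h2 := MM _ _ _ _ bf bg.
  have h3 := MM _ _ _ _ blf bg.
  have h4 := MM _ _ _ _ bf blg.
  have h5 := MM _ _ _ _ bqf bg.
  have h6 := MM _ _ _ _ bf bqg.
  have h7 := MM _ _ _ _ blf blg.
  have lge : 1 <= l ^+ 3 by rewrite exprn_ege1// ltW.
  have lge2 : l <= l ^+ 3 by rewrite exprS ler_peMr// exprn_ege1// ltW.
  have lge3 : l ^+ 2 <= l ^+ 3 by rewrite [l ^+ 3]exprS ler_peMl// ltW.
  have tri (a b c e : R) : `|a - b - c - e| <= `|a| + `|b| + `|c| + `|e|.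
    apply: le_trans (ler_normB _ _) (lerD _ (lexx _)).
    apply: le_trans (ler_normB _ _) (lerD _ (lexx _)); exact: ler_normB.
  apply: le_trans (tri _ _ _ _) _.
  have t1 := le_trans (ler_normD _ _) (lerD h3 h4).
  have t2 : `|2^-1 * (qf * g z + 2 * (lf * lg) + f z * qg)| <=
     2^-1 * (K * l ^+ 2 * K + 2 * (K * l * (K * l)) + K * (K * l ^+ 2)).
    apply: half; apply: le_trans (ler_normD _ _) (lerD _ h6).
    apply: le_trans (ler_normD _ _) (lerD h5 _).
    by rewrite normrM ger0_norm// ler_wpM2l.
  apply: le_trans (lerD (lerD (lerD h1 h2) t1) t2) _.
  have -> : K * K + K * K + (K * l * K + K * (K * l)) + 2^-1 *
     (K * l ^+ 2 * K + 2 * (K * l * (K * l)) + K * (K * l ^+ 2)) =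
     K ^+ 2 * (2 + 2 * l + 2 * l ^+ 2) by field.
  rewrite (_ : 6 * K ^+ 2 * l ^+ 3 = K ^+ 2 * (6 * l ^+ 3)); last by ring.
  by rewrite ler_wpM2l//; lra.
Qed.

End c3_mul.

Lemma discrete_gronwall {R : realType} (q : nat -> R) (a b : R) (N : nat) :
  0 <= a -> 0 <= b -> 0 <= q 0 -> (forall i, (i < N)%N -> q i.+1 <= (1 + a) * q i + b) ->
  q N <= expR (a * N%:R) * (q 0 + N%:R * b).
Proof.
move=> a0 b0 q0; elim: N => [|N IH] h.
  by rewrite mulr0 expR0 mul1r mul0r addr0.
apply: le_trans (h N (ltnSn N)) _.
have {}IH := IH (fun i iN => h i (ltnW iN)).
have e1 : 1 + a <= expR a by exact: expR_ge1Dx.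
have X0 : 0 <= expR (a * N%:R) * (q 0 + N%:R * b).
  by rewrite mulr_ge0 ?expR_ge0// addr_ge0// mulr_ge0.
have s1 : (1 + a) * q N <= expR a * (expR (a * N%:R) * (q 0 + N%:R * b)).
  apply: (@le_trans _ _ ((1 + a) * (expR (a * N%:R) * (q 0 + N%:R * b)))).
    by rewrite ler_wpM2l// addr_ge0.
  by rewrite ler_wpM2r.
apply: le_trans (lerD s1 (lexx b)) _.
rewrite mulrA -expRD -natr1 (_ : a * (N%:R + 1) = a + a * N%:R); last by ring.
rewrite mulrDl mul1r addrA [in leRHS]mulrDr lerD2l.
by rewrite ler_peMl// -[leLHS]expR0 ler_expR addr_ge0// mulr_ge0.
Qed.

(** Sends the number N of time steps to infinity: N errors of order (t / N)^(3/2) add up to order t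
    sqrt (t / N). *)
Lemma le_of_sqrt_error {R : realType} (x a b t : R) : 0 <= t ->
  (forall N : nat, (0 < N)%N -> x <= a + b * Num.sqrt (t / N%:R)) -> x <= a.
Proof.
move=> t0 h; apply/ler_addgt0Pl => e e0.
pose c := `|b| + 1; have c0 : 0 < c by rewrite ltr_wpDl.
pose N := (Num.truncn (t / (e / c) ^+ 2)).+1.
have N0 : 0 < N%:R :> R by rewrite ltr0n.
have ec : 0 < e / c by rewrite divr_gt0.
have /andP[_ hN] := truncn_itv (divr_ge0 t0 (sqr_ge0 (e / c))).
have s1 : Num.sqrt (t / N%:R) <= e / c.
  rewrite -[leRHS]gtr0_norm// -sqrtr_sqr ler_sqrt ?sqr_ge0//.
  rewrite ler_pdivrMr// mulrC -ler_pdivrMr ?exprn_gt0//; exact: ltW.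
apply: le_trans (h N (ltn0Sn _)) _; rewrite addrC lerD2r.
apply: (@le_trans _ _ (`|b| * (e / c))).
  apply: (@le_trans _ _ (`|b| * Num.sqrt (t / N%:R))).
    by rewrite ler_wpM2r ?sqrtr_ge0// ler_norm.
  by rewrite ler_wpM2l.
rewrite mulrCA ger_pMr// ler_pdivrMr// mul1r lerDl//.
Qed.

(** * Heat flow of a system with deterministic brackets *)

Section comparison.
Context {R : realType} {d : measure_display} {T : measurableType d}.
Variable P : probability T R.
Local Notation Li := (Li P).
Local Notation Ex := (Ex P).
Local Notation pr := (pr P).
Variable F : R -> set (set T).
Hypothesis filtF : is_filtration F.
Local Notation msys := (msys P F).

Variables (n : nat) (W : 'I_n -> R -> T -> R) (q : 'I_n -> 'I_n -> R) (kap : R).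
Hypothesis WS : msys W (fun k l t _ => q k l * t) kap.
Hypothesis qb : forall k l, `|q k l| <= kap ^+ 2.

Definition heat (r : R) (f : ('I_n -> R) -> R) (z : 'I_n -> R) : R :=
  Ex (fun x => f (vadd z (fun k => W k r x))).

Lemma mfunc_heat r f K : 0 <= r -> mfunc f -> (forall z, `|f z| <= K) ->
  mfunc (heat r f).
Proof.
move=> r0 mf bf d' T' Z mZ.
have mg : measurable_fun setT (fun p : T' * T => f (vadd (fun k => Z k p.1)
    (fun k => W k r p.2))).
  apply: (mf _ (T' * T)%type (fun k p => Z k p.1 + W k r p.2)) => k.
  apply: measurable_funD.
    by apply: (measurableT_comp (mZ k)); exact: measurable_fst.
  by apply: (measurableT_comp (sys_meas WS k r0)); exact: measurable_snd.
(* The shift by K makes the integrand nonnegative, as Tonelli's theorem requires; it is subtracted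
   again below. *)
pose g (p : T' * T) : \bar R := (f (vadd (fun k => Z k p.1) (fun k => W k r p.2)) + K)%:E.
have mg' : measurable_fun setT g.
  by apply/measurable_EFinP; apply: measurable_funD.
have g0 p : (0 <= g p)%E.
  rewrite /g lee_fin; have := bf (vadd (fun k => Z k p.1) (fun k => W k r p.2)).
  by rewrite ler_norml => /andP[]; lra.
have mI := @measurable_fun_fubini_tonelli_F _ _ T' T R P g mg' g0.
have -> : (fun x => heat r f (fun k => Z k x)) =
    (fun x => fine (fubini_F P g x) - K).
  apply/funext => x; rewrite /heat /fubini_F.
  have Lf : Li (fun y => f (vadd (fun k => Z k x) (fun k => W k r y))).
    apply: (@Li_bdd _ _ _ _ _ K) => //.
    by apply: (sys_mfunc_meas filtF WS).
  rewrite -[X in _ = _ - X](@Ex_cst _ _ _ P K).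
  rewrite (_ : fine _ = Ex (fun y => f (vadd (fun k => Z k x) (fun k => W k r y)) + K))//.
  by rewrite ExD//; [rewrite addrK|exact: Li_cst].
by apply: measurable_funB => //; apply: measurableT_comp mI.
Qed.

Lemma heat_bound r f K z : 0 <= r -> mfunc f -> (forall z, `|f z| <= K) ->
  `|heat r f z| <= K.
Proof.
move=> r0 mf bf; apply: norm_Ex_cst => //.
by apply: (sys_mfunc_meas filtF WS).
Qed.

(** Every clause of [C3] is stable under averaging over translates, the Taylor inequality included,
    so the derivatives are averaged and [K] is unchanged. *)
Lemma C3_heat r K f f1 f2 : 0 <= r -> C3 K f f1 f2 ->
  C3 K (heat r f) (fun k => heat r (f1 k)) (fun k l => heat r (f2 k l)).
Proof.
move=> r0 cf.
have Lf g b z : mfunc g -> (forall z, `|g z| <= b) ->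
    Li (fun x => g (vadd z (fun k => W k r x))).
  by move=> mg bg; apply: (@Li_bdd _ _ _ _ _ b) => //; apply: (sys_mfunc_meas filtF WS).
split.
- by apply: (mfunc_heat r0 (c3_m0 cf) (c3_b0 cf)).
- by move=> k; apply: (mfunc_heat r0 (c3_m1 cf k) (c3_b1 cf k)).
- by move=> k l; apply: (mfunc_heat r0 (c3_m2 cf k l) (c3_b2 cf k l)).
- by move=> z; apply: (heat_bound _ r0 (c3_m0 cf) (c3_b0 cf)).
- by move=> k z; apply: (heat_bound _ r0 (c3_m1 cf k) (c3_b1 cf k)).
- by move=> k l z; apply: (heat_bound _ r0 (c3_m2 cf k l) (c3_b2 cf k l)).
move=> z v; pose y x := vadd z (fun k => W k r x).
have ev x : vadd (vadd z v) (fun k => W k r x) = vadd (y x) v.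
  by apply/funext => k; rewrite /vadd /y /vadd; ring.
have L0 : Li (fun x => f (y x)) by apply: (Lf f K z (c3_m0 cf) (c3_b0 cf)).
have L0' : Li (fun x => f (vadd (y x) v)).
  under eq_fun do rewrite -ev.
  by apply: (Lf f K (vadd z v) (c3_m0 cf) (c3_b0 cf)).
have L1 k : Li (fun x => f1 k (y x) * v k).
  by apply: LiZr; apply: (Lf (f1 k) K z (c3_m1 cf k) (c3_b1 cf k)).
have L2 k l : Li (fun x => f2 k l (y x) * (v k * v l)).
  by apply: LiZr; apply: (Lf (f2 k l) K z (c3_m2 cf k l) (c3_b2 cf k l)).
have L2' k : Li (fun x => \sum_(l < n) f2 k l (y x) * (v k * v l)) by apply: Li_sum.
have Ll : Li (fun x => lin1 (f1 ^~ (y x)) v) by apply: Li_sum.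
have Lq : Li (fun x => quad (fun k l => f2 k l (y x)) v) by apply: Li_sum.
have -> : heat r f (vadd z v) - heat r f z - lin1 ((fun k => heat r (f1 k)) ^~ z) v -
    2^-1 * quad (fun k l => heat r (f2 k l) z) v =
   Ex (fun x => f (vadd (y x) v) - f (y x) - lin1 (f1 ^~ (y x)) v
     - 2^-1 * quad (fun k l => f2 k l (y x)) v).
  rewrite ExB; [|by apply: LiB => //; exact: LiB|exact: LiZl].
  rewrite ExB//; last exact: LiB.
  rewrite ExB// ExZl//; congr (_ - _ - _ - _ * _).
  - by apply: eq_Ex => x; rewrite ev.
  - rewrite Ex_sum//; apply: eq_bigr => k _; rewrite ExZr//.
    by apply: (Lf (f1 k) K z (c3_m1 cf k) (c3_b1 cf k)).
  - rewrite Ex_sum//; apply: eq_bigr => k _; rewrite Ex_sum//.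
    apply: eq_bigr => l _; rewrite ExZr//.
    by apply: (Lf (f2 k l) K z (c3_m2 cf k l) (c3_b2 cf k l)).
rewrite -[leRHS](@Ex_cst _ _ _ P); apply: norm_Ex_le.
- by apply: LiB; [apply: LiB => //; exact: LiB|exact: LiZl].
- exact: Li_cst.
- by move=> x; exact: (c3_taylor cf).
Qed.

Lemma heat0 f z : heat 0 f z = f z.
Proof.
rewrite /heat -[RHS](@Ex_cst _ _ _ P); apply: eq_Ex => x; congr f.
by apply/funext => k; rewrite /vadd (ms_0 WS) addr0.
Qed.

Lemma heat_step r r' K f f1 f2 z : C3 K f f1 f2 -> 0 <= r -> r < r' ->
  `|heat r' f z - heat r f z - 2^-1 * ((r' - r) *
     \sum_(k < n) \sum_(l < n) q k l * heat r (f2 k l) z)|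
   <= K * stepc n kap * Num.sqrt (r' - r) ^+ 3.
Proof.
move=> cf r0 rr; have := one_step filtF WS z cf r0 rr.
rewrite -/(heat r' f z) -/(heat r f z).
congr (_ <= _); congr (`|_ - _ * _|); rewrite mulr_sumr.
apply: eq_bigr => k _; rewrite mulr_sumr; apply: eq_bigr => l _.
under eq_Ex do rewrite -mulrBr.
rewrite ExZr; first by rewrite /heat; ring.
apply: (@Li_bdd _ _ _ _ _ K); last by move=> x; exact: (c3_b2 cf).
by apply: (sys_mfunc_meas filtF WS) => //; exact: (c3_m2 cf).
Qed.

End comparison.

Lemma slepian_arith {R : realType} (eps Q1 Q2 M S1 S2 E X : R) :
  eps * (Q2 - M - 2^-1 * S2) <= E -> - (eps * (Q1 - M - 2^-1 * S1)) <= E ->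
  - (eps * (S1 - S2)) <= 2 * X -> eps * (Q2 - Q1) <= X + 2 * E.
Proof. by lra. Qed.

Lemma decouple_arith1 {R : realType} (D c AB Sx : R) : 0 <= D ->
  `|Sx| <= 2 * c * AB -> - (2^-1 * (D * Sx)) <= c * D * AB.
Proof.
move=> D0; rewrite ler_norml => /andP[h _]; have := ler_wpM2l D0 h; lra.
Qed.

Lemma decouple_arith2 {R : realType} (D c AB Sx U p1 p2 p3 X1 X2 X3 X : R) :
  `|p1| <= X1 -> `|p2| <= X2 -> `|p3| <= X3 -> X1 + X2 + X3 <= X ->
  - (2^-1 * (D * Sx)) <= c * D * AB ->
  AB + 2^-1 * (D * U) + (p1 + p2 + p3) <=
  (1 + c * D) * AB + 2^-1 * (D * (U + Sx)) + X.
Proof.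
move=> /(le_trans (ler_norm _)) h1 /(le_trans (ler_norm _)) h2.
by move=> /(le_trans (ler_norm _)) h3 h4 h5; lra.
Qed.

Lemma decouple_arith3 {R : realType} (L c D M DS X Q B Y Z : R) : 0 <= c * D ->
  L <= (1 + c * D) * M + 2^-1 * DS + X -> `|Q - M - 2^-1 * DS| <= B ->
  `|2^-1 * DS| <= Y -> c * D * (B + Y) <= Z ->
  L <= (1 + c * D) * Q + (B + X + Z).
Proof.
move=> cD h1; rewrite !ler_norml => /andP[h2 _] /andP[h3 _] h4.
have h5 : M <= Q + B + Y by lra.
have := ler_wpM2l cD h5; lra.
Qed.

(** * Interpolation: Slepian's inequality and decoupling *)

Section comparison.
Context {R : realType} {d : measure_display} {T : measurableType d}.
Variable P : probability T R.
Local Notation Li := (Li P).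
Local Notation Ex := (Ex P).
Local Notation pr := (pr P).
Variable F : R -> set (set T).
Hypothesis filtF : is_filtration F.
Local Notation msys := (msys P F).

Variables (n : nat) (W : 'I_n -> R -> T -> R) (q : 'I_n -> 'I_n -> R) (kap : R).
Hypothesis WS : msys W (fun k l t _ => q k l * t) kap.
Hypothesis qb : forall k l, `|q k l| <= kap ^+ 2.
Local Notation heat := (heat P W).
Local Notation z0 := (fun _ : 'I_n => 0 : R).

Lemma vadd0 (v : 'I_n -> R) : vadd z0 v = v.
Proof. by apply/funext => k; rewrite /vadd add0r. Qed.

Lemma vadd0E : vadd z0 = id.
Proof. by apply/funext => v; exact: vadd0. Qed.

Lemma sum_const2 (c : R) : \sum_(k < n) \sum_(l < n) c = n%:R ^+ 2 * c.
Proof.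
under eq_bigr do rewrite sumr_const card_ord.
by rewrite sumr_const card_ord -mulrnA -[LHS]mulr_natl natrM expr2.
Qed.

(** Both expectations are expanded around E heat r f (Z s): lengthening the heat flow contributes q
    D, letting Z run contributes the random bracket increment. Diagonal terms cancel, off-diagonal
    ones have a sign on [G], and outside [G] each costs at most 2 K kap^2 D. The values 1 and -1 of
    [eps] serve the two directions of the comparison. *)
Lemma slepian_step Z TI K f f1 f2 r s D G eps : msys Z TI kap ->
  C3 K f f1 f2 -> 0 <= r -> 0 <= s -> 0 < D -> measurable G -> `|eps| <= 1 ->
  (forall k l z, k != l -> 0 <= f2 k l z) ->
  (forall x, G x -> forall k l, k != l ->
     0 <= eps * (TI k l (s + D) x - TI k l s x - q k l * D)) ->
  (forall k x, TI k k (s + D) x - TI k k s x = q k k * D) ->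
  eps * (Ex (fun x => heat (r + D) f (fun k => Z k s x)) -
         Ex (fun x => heat r f (fun k => Z k (s + D) x))) <=
  n%:R ^+ 2 * (K * kap ^+ 2 * D * pr (~` G)) +
  2 * (K * stepc n kap * Num.sqrt D ^+ 3).
Proof.
move=> ZS cf r0 s0 D0 mG eps1 pos hG hd.
have K0 : 0 <= K by exact: le_trans (c3_b0 cf z0).
have kap2 : 0 <= kap ^+ 2 by exact: sqr_ge0.
have cu := C3_heat filtF WS r0 cf.
have sD : s < s + D by rewrite ltrDl.
have rD : r < r + D by rewrite ltrDl.
have r'0 : 0 <= r + D by rewrite addr_ge0// ltW.
have cu' := C3_heat filtF WS r'0 cf.
pose y x := (fun k => Z k s x) : 'I_n -> R.
have DsE : s + D - s = D by ring.
have DrE : r + D - r = D by ring.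
have H1 := one_step filtF ZS z0 cu s0 sD.
have mF g : mfunc g -> measurable_fun setT (fun x => g (y x)).
  move=> mg; have := sys_mfunc_meas filtF ZS z0 mg s0.
  by under eq_fun do rewrite vadd0.
pose h k l x := heat r (f2 k l) (y x).
have mh k l : measurable_fun setT (h k l) by apply: mF; exact: (c3_m2 cu).
have bh k l x : `|h k l x| <= K by exact: (c3_b2 cu).
have Lh k l : Li (h k l) by apply: Li_bdd (bh k l).
pose M := Ex (fun x => heat r f (y x)).
pose DT k l x := TI k l (s + D) x - TI k l s x.
have s'0 : 0 <= s + D by rewrite addr_ge0// ltW.
have LDT k l : Li (DT k l) by apply: LiB; apply: (sys_LiTI ZS).
have LhDT k l : Li (fun x => h k l x * DT k l x) by exact: Li_bweight (bh k l) _.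
have Lhq k l : Li (fun x => q k l * D * h k l x) by exact: LiZl.
set E := K * stepc n kap * Num.sqrt D ^+ 3.
have H1' : `|Ex (fun x => heat r f (fun k => Z k (s + D) x)) - M -
    2^-1 * \sum_(k < n) \sum_(l < n) Ex (fun x => h k l x * DT k l x)| <= E.
  by move: H1; rewrite vadd0E DsE.
have H2 : `|Ex (fun x => heat (r + D) f (y x)) - M -
    2^-1 * \sum_(k < n) \sum_(l < n) Ex (fun x => q k l * D * h k l x)| <= E.
  have Lf g : mfunc g -> (forall z, `|g z| <= K) -> Li (fun x => g (y x)).
    by move=> mg bg; apply: (@Li_bdd _ _ _ _ _ K) => //; exact: mF.
  have L1 := Lf _ (c3_m0 cu') (c3_b0 cu').
  have L2 := Lf _ (c3_m0 cu) (c3_b0 cu).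
  have L3' k : Li (fun x => \sum_(l < n) q k l * D * h k l x) by apply: Li_sum.
  have L3 : Li (fun x => \sum_(k < n) \sum_(l < n) q k l * D * h k l x).
    by apply: Li_sum.
  have -> : \sum_(k < n) \sum_(l < n) Ex (fun x => q k l * D * h k l x) =
      Ex (fun x => \sum_(k < n) \sum_(l < n) q k l * D * h k l x).
    by rewrite Ex_sum//; apply: eq_bigr => k _; rewrite Ex_sum.
  rewrite -ExZl// -ExB// -ExB//; [|exact: LiB|exact: LiZl].
  rewrite -[leRHS](@Ex_cst _ _ _ P); apply: norm_Ex_le.
  - by apply: LiB; [exact: LiB|exact: LiZl].
  - exact: Li_cst.
  - move=> x; have := heat_step filtF WS (y x) cf r0 rD.
    rewrite DrE (_ : \sum_(k < n) \sum_(l < n) q k l * D * h k l x =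
      D * \sum_(k < n) \sum_(l < n) q k l * h k l x)//.
    rewrite mulr_sumr; apply: eq_bigr => k _; rewrite mulr_sumr.
    by apply: eq_bigr => l _; ring.
have H3 k l : - (eps * (Ex (fun x => h k l x * DT k l x) -
     Ex (fun x => q k l * D * h k l x))) <= 2 * (K * kap ^+ 2 * D * pr (~` G)).
  have mGc : measurable (~` G) by exact: measurableC.
  rewrite -ExB// -ExZl; last exact: LiB.
  rewrite -ExN; last by apply: LiZl; exact: LiB.
  rewrite (_ : 2 * _ = (2 * (K * kap ^+ 2 * D)) * pr (~` G)); last by ring.
  rewrite -Ex_indic// -ExZl; last exact: Li_indic.
  apply: le_Ex.
  - by apply: LiN; apply: LiZl; exact: LiB.
  - by apply: LiZl; exact: Li_indic.
  move=> x.
  have -> : - (eps * (h k l x * DT k l x - q k l * D * h k l x)) =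
     - (h k l x * (eps * (DT k l x - q k l * D))) by ring.
  have KD0 : 0 <= K * kap ^+ 2 * D.
    by apply: mulr_ge0; [exact: mulr_ge0|exact: ltW].
  have [Gx|Gx] := pselect (G x).
    rewrite indicE memNset/=; last by move=> /(_ Gx).
    rewrite mulr0 oppr_le0; have [kl|kl] := eqVneq k l.
      by rewrite kl /DT hd subrr !mulr0.
    rewrite mulr_ge0 ?hG//; apply: Ex_ge0 => w; exact: pos.
  rewrite indicE mem_set// mulr1; apply: le_trans (ler_norm _) _.
  rewrite normrN normrM; apply: (@le_trans _ _ (K * (1 * (2 * (kap ^+ 2 * D))))).
    apply: ler_pM => //; rewrite normrM; apply: ler_pM => //.
    apply: le_trans (ler_normB _ _) _; rewrite mulr2n mulrDl mul1r; apply: lerD.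
      have := ms_TI ZS k l x s0 (ltW sD).
      by rewrite DsE.
    by rewrite normrM (gtr0_norm D0) ler_wpM2r// ltW.
  by rewrite mul1r; apply: eq_ler; ring.
have H4 : - (eps * (\sum_(k < n) \sum_(l < n) Ex (fun x => h k l x * DT k l x) -
    \sum_(k < n) \sum_(l < n) Ex (fun x => q k l * D * h k l x))) <=
    2 * (n%:R ^+ 2 * (K * kap ^+ 2 * D * pr (~` G))).
  rewrite mulrCA -sum_const2 -sumrB mulr_sumr -sumrN; apply: ler_sum => k _.
  rewrite -sumrB mulr_sumr -sumrN; apply: ler_sum => l _; exact: H3.
move: H1' H2 H4; rewrite -/(y _).
set S1 := \sum_(k < n) _; set S2 := \sum_(k < n) _.
set Q1 := Ex _; set Q2 := Ex (fun x => heat (r + D) f _).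
move=> H1' H2 H4.
have e1 : eps * (Q2 - M - 2^-1 * S2) <= E.
  apply: le_trans (ler_norm _) _; rewrite normrM -[E]mul1r; exact: ler_pM.
have e2 : - (eps * (Q1 - M - 2^-1 * S1)) <= E.
  apply: le_trans (ler_norm _) _; rewrite normrN normrM -[E]mul1r; exact: ler_pM.
exact: slepian_arith e1 e2 H4.
Qed.

Lemma slepian Z TI K f f1 f2 t G eps : msys Z TI kap ->
  C3 K f f1 f2 -> 0 < t -> measurable G -> `|eps| <= 1 ->
  (forall k l z, k != l -> 0 <= f2 k l z) ->
  (forall x, G x -> forall k l s s', k != l -> 0 <= s -> s <= s' -> s' <= t ->
     0 <= eps * (TI k l s' x - TI k l s x - q k l * (s' - s))) ->
  (forall k s s' x, 0 <= s -> s <= s' ->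
     TI k k s' x - TI k k s x = q k k * (s' - s)) ->
  eps * (Ex (fun x => f (fun k => W k t x)) - Ex (fun x => f (fun k => Z k t x)))
   <= n%:R ^+ 2 * (K * kap ^+ 2 * t * pr (~` G)).
Proof.
move=> ZS cf t0 mG eps1 pos hG hd.
set c1 := n%:R ^+ 2 * (K * kap ^+ 2 * t * pr (~` G)).
apply: (@le_of_sqrt_error _ _ c1 (2 * (K * stepc n kap) * t) t (ltW t0)) => N N0.
have Np : 0 < N%:R :> R by rewrite ltr0n.
set D := t / N%:R; have D0 : 0 < D by rewrite divr_gt0.
have ND : N%:R * D = t by rewrite mulrC divfK ?gt_eqF.
(* In Q i the system Z has run for i steps and the heat flow of W takes the remaining time, so Q 0
   is the expectation for W and Q N the one for Z. *)
pose Q i := Ex (fun x => heat (t - i%:R * D) f (fun k => Z k (i%:R * D) x)).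
pose c := n%:R ^+ 2 * (K * kap ^+ 2 * D * pr (~` G)) +
  2 * (K * stepc n kap * Num.sqrt D ^+ 3).
have step i : (i < N)%N -> eps * (Q i - Q i.+1) <= c.
  move=> iN; have si : 0 <= i%:R * D by rewrite mulr_ge0// ltW.
  have iD : i.+1%:R * D = i%:R * D + D by rewrite -natr1 mulrDl mul1r.
  have r0 : 0 <= t - i.+1%:R * D.
    by rewrite subr_ge0 -ND ler_wpM2r ?ler_nat// ltW.
  have rE : t - i%:R * D = t - i.+1%:R * D + D by rewrite iD; ring.
  have := @slepian_step Z TI K f f1 f2 (t - i.+1%:R * D) (i%:R * D) D G eps
    ZS cf r0 si D0 mG eps1 pos.
  rewrite /Q rE iD; apply.
    move=> x Gx k l kl; have := hG x Gx k l (i%:R * D) (i%:R * D + D) kl si.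
    rewrite (addrC _ D) addrK -(addrC _ D); apply; first by rewrite lerDl ltW.
    by rewrite -iD -subr_ge0.
  move=> k x; rewrite hd//; last by rewrite lerDl ltW.
  by rewrite (addrC _ D) addrK.
have tele i : (i <= N)%N -> eps * (Q 0 - Q i) <= i%:R * c.
  elim: i => [_|i IH iN]; first by rewrite subrr mulr0 mul0r.
  have := lerD (IH (ltnW iN)) (step i iN); rewrite -mulrDr addrA subrK.
  by move/le_trans; apply; rewrite -natr1 mulrDl mul1r.
have QN : Q N = Ex (fun x => f (fun k => Z k t x)).
  by rewrite /Q ND subrr; apply: eq_Ex => x; rewrite (heat0 WS).
have Q0 : Q 0%N = Ex (fun x => f (fun k => W k t x)).
  rewrite /Q mul0r subr0 -[RHS](@Ex_cst _ _ _ P); apply: eq_Ex => x.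
  rewrite /heat; apply: eq_Ex => w; congr f; apply/funext => k.
  by rewrite /vadd (ms_0 ZS) add0r.
rewrite -QN -Q0; apply: le_trans (tele N (leqnn N)) _.
rewrite /c /c1 mulrDr; apply: eq_ler; congr (_ + _).
  by rewrite -ND; ring.
by rewrite -[in RHS]ND exprS sqr_sqrtr ?ltW//; ring.
Qed.

(** A bound on the logarithmic gradient passes to the heat flow, because absolute values can be
    taken inside the expectation. *)
Lemma heat_sum_norm r a (a1 : 'I_n -> ('I_n -> R) -> R) K lam z : 0 <= r ->
  mfunc a -> (forall k, mfunc (a1 k)) -> (forall z, `|a z| <= K) ->
  (forall k z, `|a1 k z| <= K) ->
  (forall z, \sum_(k < n) `|a1 k z| <= lam * a z) ->
  \sum_(k < n) `|heat r (a1 k) z| <= lam * heat r a z.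
Proof.
move=> r0 ma ma1 ba ba1 h.
have L g : mfunc g -> (forall z, `|g z| <= K) ->
    Li (fun x => g (vadd z (fun k => W k r x))).
  by move=> mg bg; apply: (@Li_bdd _ _ _ _ _ K) => //; exact: (sys_mfunc_meas filtF WS).
have L1 k : Li (fun x => `|a1 k (vadd z (fun k => W k r x))|).
  by apply: Li_norm; exact: L.
apply: (@le_trans _ _ (\sum_(k < n) Ex (fun x => `|a1 k (vadd z (fun k => W k r x))|))).
  by apply: ler_sum => k _; apply: norm_Ex; exact: L.
rewrite -Ex_sum// /heat -ExZl; last exact: L.
by apply: le_Ex => //; [exact: Li_sum|apply: LiZl; exact: L].
Qed.

(** For two heat flows A and B the generator applied to A B differs from the time derivative of A B
    only by the cross term of the gradients. By [la] and [lb], inherited by the flows, this term is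
    at most kap^2 lam^2 A B, hence the factor 1 + kap^2 lam^2 D. *)
Lemma decouple_step a a1 a2 b b1 b2 K lam t : C3 K a a1 a2 -> C3 K b b1 b2 ->
  0 <= lam -> 0 < t -> (forall z, 0 <= a z) -> (forall z, 0 <= b z) ->
  (forall z, \sum_(k < n) `|a1 k z| <= lam * a z) ->
  (forall z, \sum_(k < n) `|b1 k z| <= lam * b z) ->
  exists2 C, 0 <= C & forall r w D, 0 <= r -> 0 <= w -> 0 < D -> D <= t ->
    heat w (fun z => heat (r + D) a z * heat (r + D) b z) z0 <=
    (1 + kap ^+ 2 * lam ^+ 2 * D) *
      heat (w + D) (fun z => heat r a z * heat r b z) z0 + C * Num.sqrt D ^+ 3.
Proof.
move=> ca cb lam0 t0 a0 b0 la lb.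
have K0 : 0 <= K by exact: le_trans (c3_b0 ca z0).
have kap2 : 0 <= kap ^+ 2 by exact: sqr_ge0.
have sc0 := stepc_ge0 WS.
set c := kap ^+ 2 * lam ^+ 2; have c0 : 0 <= c by rewrite mulr_ge0 ?sqr_ge0.
pose st := Num.sqrt t; have st0 : 0 <= st by rewrite sqrtr_ge0.
pose m := 2^-1 * (n%:R ^+ 2 * (kap ^+ 2 * K)).
have n2 : 0 <= n%:R ^+ 2 :> R by exact: sqr_ge0.
have m0 : 0 <= m by rewrite mulr_ge0 ?invr_ge0// mulr_ge0// mulr_ge0.
pose K' := 6 * K ^+ 2; have K'0 : 0 <= K' by rewrite mulr_ge0 ?sqr_ge0.
pose m' := 2^-1 * (n%:R ^+ 2 * (kap ^+ 2 * K')).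
have m'0 : 0 <= m' by rewrite mulr_ge0 ?invr_ge0// mulr_ge0// mulr_ge0.
pose C2 := 2 * (K * (K * stepc n kap)) + st * m ^+ 2 + K * stepc n kap * t * m.
exists (K' * stepc n kap + C2 + c * (m' * st + K' * stepc n kap * t)).
  have h1 : 0 <= K * stepc n kap by exact: mulr_ge0.
  have h2 : 0 <= m ^+ 2 by exact: sqr_ge0.
  have h3 : 0 <= C2.
    apply: addr_ge0; last by apply: mulr_ge0 => //; apply: mulr_ge0 => //; exact: ltW.
    by apply: addr_ge0; apply: mulr_ge0 => //; exact: mulr_ge0.
  have h4 : 0 <= K' * stepc n kap by exact: mulr_ge0.
  apply: addr_ge0; first exact: addr_ge0.
  by apply: mulr_ge0 => //; apply: addr_ge0; apply: mulr_ge0 => //; exact: ltW.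
move=> r w D r0 w0 D0 Dt.
pose sD := Num.sqrt D; have sD0 : 0 <= sD by rewrite sqrtr_ge0.
have sDD : sD ^+ 2 = D by rewrite sqr_sqrtr// ltW.
have sDt : sD <= st by rewrite ler_sqrt// ltW.
have r'0 : 0 <= r + D by rewrite addr_ge0// ltW.
have rD : r < r + D by rewrite ltrDl.
have wD : w < w + D by rewrite ltrDl.
pose A := heat r a; pose B := heat r b.
have cA := C3_heat filtF WS r0 ca; have cB := C3_heat filtF WS r0 cb.
have cA' := C3_heat filtF WS r'0 ca; have cB' := C3_heat filtF WS r'0 cb.
pose d2 k l z := heat r (a2 k l) z * B z + heat r (a1 k) z * heat r (b1 l) z +
  heat r (a1 l) z * heat r (b1 k) z + A z * heat r (b2 k l) z.
have cAB : C3 K' (fun z => A z * B z)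
    (fun k z => heat r (a1 k) z * B z + A z * heat r (b1 k) z) d2 := C3_mul cA cB.
have DwE : w + D - w = D by ring.
have DrE : r + D - r = D by ring.
have H1 := heat_step filtF WS z0 cAB w0 wD.
move: H1; rewrite DwE.
rewrite -/A -/B; set Qi := heat (w + D) (fun z => A z * B z) z0.
set M := heat w (fun z => A z * B z) z0 => H1.
pose S z := \sum_(k < n) \sum_(l < n) q k l * d2 k l z.
pose Sa z := \sum_(k < n) \sum_(l < n) q k l * heat r (a2 k l) z.
pose Sb z := \sum_(k < n) \sum_(l < n) q k l * heat r (b2 k l) z.
pose Sx z := \sum_(k < n) \sum_(l < n) q k l *
   (heat r (a1 k) z * heat r (b1 l) z + heat r (a1 l) z * heat r (b1 k) z).
have SE z : S z = Sa z * B z + A z * Sb z + Sx z.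
  rewrite /S /Sa /Sb /Sx mulr_suml mulr_sumr -!big_split/=; apply: eq_bigr => k _.
  rewrite mulr_suml mulr_sumr -!big_split/=; apply: eq_bigr => l _.
  by rewrite /d2 -/A -/B; ring.
have A0 z : 0 <= A z by apply: Ex_ge0 => x; exact: a0.
have B0 z : 0 <= B z by apply: Ex_ge0 => x; exact: b0.
have SxB z : `|Sx z| <= 2 * c * (A z * B z).
  have sa : \sum_(k < n) `|heat r (a1 k) z| <= lam * A z.
    exact: (heat_sum_norm z r0 (c3_m0 ca) (c3_m1 ca) (c3_b0 ca) (c3_b1 ca) la).
  have sb : \sum_(k < n) `|heat r (b1 k) z| <= lam * B z.
    exact: (heat_sum_norm z r0 (c3_m0 cb) (c3_m1 cb) (c3_b0 cb) (c3_b1 cb) lb).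
  have sab : (\sum_(k < n) `|heat r (a1 k) z|) * (\sum_(k < n) `|heat r (b1 k) z|) <=
      lam * A z * (lam * B z) by apply: ler_pM => //; apply: sumr_ge0.
  have t1 : \sum_(k < n) \sum_(l < n) kap ^+ 2 * (`|heat r (a1 k) z| * `|heat r (b1 l) z|)
      = kap ^+ 2 * ((\sum_(k < n) `|heat r (a1 k) z|) * (\sum_(k < n) `|heat r (b1 k) z|)).
    rewrite mulr_suml mulr_sumr; apply: eq_bigr => k _.
    by rewrite !mulr_sumr; apply: eq_bigr.
  have t2 : \sum_(k < n) \sum_(l < n) kap ^+ 2 * (`|heat r (a1 l) z| * `|heat r (b1 k) z|)
      = kap ^+ 2 * ((\sum_(k < n) `|heat r (a1 k) z|) * (\sum_(k < n) `|heat r (b1 k) z|)).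
    by rewrite exchange_big/= t1.
  apply: (@le_trans _ _ (\sum_(k < n) \sum_(l < n)
     (kap ^+ 2 * (`|heat r (a1 k) z| * `|heat r (b1 l) z|) +
      kap ^+ 2 * (`|heat r (a1 l) z| * `|heat r (b1 k) z|)))).
    apply: le_trans (ler_norm_sum _ _ _) _; apply: ler_sum => k _.
    apply: le_trans (ler_norm_sum _ _ _) _; apply: ler_sum => l _.
    rewrite -mulrDr normrM; apply: ler_pM => //.
    by apply: le_trans (ler_normD _ _) _; rewrite !normrM.
  under eq_bigr do rewrite big_split/=.
  rewrite big_split/= t1 t2 /c.
  rewrite (_ : 2 * _ * _ = kap ^+ 2 * (lam * A z * (lam * B z)) +
    kap ^+ 2 * (lam * A z * (lam * B z))); last by ring.
  by apply: lerD; exact: ler_wpM2l.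
have bSa z : `|2^-1 * (D * Sa z)| <= D * m.
  rewrite normrM ger0_norm ?invr_ge0// normrM (gtr0_norm D0) /m mulrCA.
  rewrite ler_wpM2l ?(ltW D0)// ler_wpM2l ?invr_ge0// -sum_const2.
  apply: le_trans (ler_norm_sum _ _ _) _; apply: ler_sum => k _.
  apply: le_trans (ler_norm_sum _ _ _) _; apply: ler_sum => l _.
  by rewrite normrM; apply: ler_pM => //; exact: (c3_b2 cA).
have bSb z : `|2^-1 * (D * Sb z)| <= D * m.
  rewrite normrM ger0_norm ?invr_ge0// normrM (gtr0_norm D0) /m mulrCA.
  rewrite ler_wpM2l ?(ltW D0)// ler_wpM2l ?invr_ge0// -sum_const2.
  apply: le_trans (ler_norm_sum _ _ _) _; apply: ler_sum => k _.
  apply: le_trans (ler_norm_sum _ _ _) _; apply: ler_sum => l _.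
  by rewrite normrM; apply: ler_pM => //; exact: (c3_b2 cB).
set E := K * stepc n kap * sD ^+ 3.
have E0 : 0 <= E by apply: mulr_ge0; [exact: mulr_ge0|exact: exprn_ge0].
have bK z : `|A z| <= K by exact: (c3_b0 cA).
have H2 z : heat (r + D) a z * heat (r + D) b z <=
    (1 + c * D) * (A z * B z) + 2^-1 * (D * S z) + C2 * sD ^+ 3.
  have Ha := heat_step filtF WS z ca r0 rD.
  have Hb := heat_step filtF WS z cb r0 rD.
  move: Ha Hb; rewrite DrE -/E -/(Sa z) -/(Sb z) -/A -/B.
  set a' := heat (r + D) a z; set b' := heat (r + D) b z.
  set e1 := a' - _ - _; set e2 := b' - _ - _ => he1 he2.
  have -> : a' * b' = A z * B z + 2^-1 * (D * (Sa z * B z + A z * Sb z)) +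
     (a' * e2 + (2^-1 * (D * Sa z)) * (2^-1 * (D * Sb z)) +
      e1 * (B z + 2^-1 * (D * Sb z))).
    by rewrite /e1 /e2; field.
  have SX := decouple_arith1 (ltW D0) (SxB z).
  have x1 : `|a' * e2| <= K * E.
    by rewrite normrM; apply: ler_pM => //; exact: (c3_b0 cA').
  have x2 : `|(2^-1 * (D * Sa z)) * (2^-1 * (D * Sb z))| <= (D * m) * (D * m).
    by rewrite normrM; apply: ler_pM.
  have x3 : `|e1 * (B z + 2^-1 * (D * Sb z))| <= E * (K + D * m).
    rewrite normrM; apply: ler_pM => //; apply: le_trans (ler_normD _ _) (lerD _ (bSb z)).
    exact: (c3_b0 cB).
  have x4 : K * E + (D * m) * (D * m) + E * (K + D * m) <= C2 * sD ^+ 3.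
    have -> : K * E + (D * m) * (D * m) + E * (K + D * m) =
      sD ^+ 3 * (2 * (K * (K * stepc n kap)) + sD * m ^+ 2 + K * stepc n kap * D * m).
      by rewrite /E -sDD; ring.
    rewrite mulrC ler_wpM2r ?exprn_ge0// /C2; apply: lerD; first apply: lerD => //.
      by rewrite ler_wpM2r ?sqr_ge0.
    by rewrite ler_wpM2r// ler_wpM2l// mulr_ge0.
  by rewrite SE; exact: decouple_arith2 x1 x2 x3 x4 SX.
have LL g K1 : mfunc g -> (forall z, `|g z| <= K1) ->
    Li (fun x => g (vadd z0 (fun k => W k w x))).
  by move=> mg bg; apply: (@Li_bdd _ _ _ _ _ K1) => //; exact: (sys_mfunc_meas filtF WS).
have LAB := LL _ _ (c3_m0 cAB) (c3_b0 cAB).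
have LAB' := LL _ _ (c3_m0 (C3_mul cA' cB')) (c3_b0 (C3_mul cA' cB')).
have Ld2 k l := LL _ _ (c3_m2 cAB k l) (c3_b2 cAB k l).
have LS1 k : Li (fun x => \sum_(l < n) q k l * d2 k l (vadd z0 (fun k => W k w x))).
  by apply: Li_sum => l _; apply: LiZl; exact: Ld2.
have LS : Li (fun x => S (vadd z0 (fun k => W k w x))) by apply: Li_sum.
have ES : Ex (fun x => S (vadd z0 (fun k => W k w x))) =
    \sum_(k < n) \sum_(l < n) q k l * heat w (d2 k l) z0.
  rewrite Ex_sum//; apply: eq_bigr => k _; rewrite Ex_sum => [|l _]; last first.
    by apply: LiZl; exact: Ld2.
  by apply: eq_bigr => l _; rewrite ExZl//; exact: Ld2.
have H3 : heat w (fun z => heat (r + D) a z * heat (r + D) b z) z0 <=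
   (1 + c * D) * M + 2^-1 * (D * \sum_(k < n) \sum_(l < n) q k l * heat w (d2 k l) z0)
   + C2 * sD ^+ 3.
  rewrite -ES /M /heat -ExZl// -ExZl// -ExZl; last exact: LiZl.
  rewrite -ExD; [|exact: LiZl|by apply: LiZl; exact: LiZl].
  rewrite -[X in _ <= _ + X](@Ex_cst _ _ _ P) -ExD; last 2 first.
  - by apply: LiD; [exact: LiZl|by apply: LiZl; exact: LiZl].
  - exact: Li_cst.
  apply: le_Ex => //; last by move=> x; exact: H2.
  by apply: LiD; [apply: LiD; [exact: LiZl|by apply: LiZl; exact: LiZl]|exact: Li_cst].
move: H1 H3; set SS := \sum_(k < n) _ => H1 H3.
have bSS : `|2^-1 * (D * SS)| <= D * m'.
  rewrite normrM ger0_norm ?invr_ge0// normrM (gtr0_norm D0) /m' mulrCA.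
  rewrite ler_wpM2l ?(ltW D0)// ler_wpM2l ?invr_ge0// -sum_const2.
  apply: le_trans (ler_norm_sum _ _ _) _; apply: ler_sum => k _.
  apply: le_trans (ler_norm_sum _ _ _) _; apply: ler_sum => l _.
  rewrite normrM; apply: ler_pM => //.
  exact: (heat_bound filtF WS _ w0 (c3_m2 cAB k l) (c3_b2 cAB k l)).
have cD0 : 0 <= c * D by rewrite mulr_ge0// ltW.
have M4 : c * D * (K' * stepc n kap * sD ^+ 3 + D * m') <=
    c * (m' * st + K' * stepc n kap * t) * sD ^+ 3.
  have -> : c * D * (K' * stepc n kap * sD ^+ 3 + D * m') =
     c * (m' * sD + K' * stepc n kap * D) * sD ^+ 3 by rewrite -sDD; ring.
  rewrite ler_wpM2r ?exprn_ge0// ler_wpM2l//; apply: lerD; rewrite ler_wpM2l//.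
  by rewrite mulr_ge0.
have h := decouple_arith3 cD0 H3 H1 bSS M4.
by move: h; rewrite -/sD -!mulrDl.
Qed.

(** Interpolates from E (a b), where both factors see the same W, to E a E b; Gronwall's inequality
    collects the step factors. The bound is free of [K], so unbounded functions can be reached by
    approximation. *)
Lemma decouple a a1 a2 b b1 b2 K lam t : C3 K a a1 a2 -> C3 K b b1 b2 ->
  0 <= lam -> 0 < t -> (forall z, 0 <= a z) -> (forall z, 0 <= b z) ->
  (forall z, \sum_(k < n) `|a1 k z| <= lam * a z) ->
  (forall z, \sum_(k < n) `|b1 k z| <= lam * b z) ->
  Ex (fun x => a (fun k => W k t x)) * Ex (fun x => b (fun k => W k t x)) <=
  expR (kap ^+ 2 * lam ^+ 2 * t) *
    Ex (fun x => a (fun k => W k t x) * b (fun k => W k t x)).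
Proof.
move=> ca cb lam0 t0 a0 b0 la lb.
have [C C0 step] := decouple_step ca cb lam0 t0 a0 b0 la lb.
set c := kap ^+ 2 * lam ^+ 2; have c0 : 0 <= c by rewrite mulr_ge0 ?sqr_ge0.
set Q0 := Ex (fun x => a _ * b _).
apply: (@le_of_sqrt_error _ _ _ (expR (c * t) * C * t) t (ltW t0)) => N N0.
have Np : 0 < N%:R :> R by rewrite ltr0n.
set D := t / N%:R; have D0 : 0 < D by rewrite divr_gt0.
have ND : N%:R * D = t by rewrite mulrC divfK ?gt_eqF.
have Dt : D <= t by rewrite ler_pdivrMr// ler_peMr ?ler1n// ltW.
pose Q i := heat (t - i%:R * D) (fun z => heat (i%:R * D) a z * heat (i%:R * D) b z) z0.
have QE0 : Q 0%N = Q0.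
  rewrite /Q mul0r subr0; apply: eq_Ex => x; rewrite vadd0 !(heat0 WS)//.
have QN : Q N = Ex (fun x => a (fun k => W k t x)) * Ex (fun x => b (fun k => W k t x)).
  rewrite /Q ND subrr (heat0 WS) /heat.
  by congr (_ * _); apply: eq_Ex => x; rewrite vadd0.
have Q00 : 0 <= Q 0%N.
  by apply: Ex_ge0 => x; rewrite mulr_ge0//; apply: Ex_ge0.
have C30 : 0 <= C * Num.sqrt D ^+ 3 by rewrite mulr_ge0// exprn_ge0// sqrtr_ge0.
have := @discrete_gronwall _ Q (c * D) (C * Num.sqrt D ^+ 3) N
  (mulr_ge0 c0 (ltW D0)) C30 Q00.
rewrite QN QE0 => H; apply: le_trans (H _) _; last first.
  rewrite -mulrA [D * _]mulrC ND mulrDr; apply: eq_ler; congr (_ + _).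
  transitivity (expR (c * t) * C * (N%:R * D) * Num.sqrt D); last by rewrite ND.
  by rewrite exprS sqr_sqrtr ?ltW//; ring.
move=> i iN; have iD : i.+1%:R * D = i%:R * D + D by rewrite -natr1 mulrDl mul1r.
have r0 : 0 <= t - i.+1%:R * D by rewrite subr_ge0 -ND ler_wpM2r ?ler_nat// ltW.
have i0 : 0 <= i%:R * D by rewrite mulr_ge0// ltW.
have := step (i%:R * D) (t - i.+1%:R * D) D i0 r0 D0 Dt.
rewrite /Q (_ : t - i.+1%:R * D + D = t - i%:R * D); last by rewrite iD; ring.
by rewrite -iD.
Qed.

End comparison.

(** * Concentration and comparison of log-sum-exp *)

Section softmax.
Context {R : realType} {n : nat}.
Hypothesis n0 : (0 < n)%N.
Implicit Types (z v : 'I_n -> R).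

Definition esum_exp z : R := \sum_(k < n) expR (z k).
Definition ell z : R := ln (esum_exp z).
Definition gibbs z (k : 'I_n) : R := expR (z k - ell z).

Lemma esum_exp_gt0 z : 0 < esum_exp z.
Proof.
rewrite /esum_exp (bigD1 (Ordinal n0))//= ltr_pwDl ?expR_gt0//.
by apply: sumr_ge0 => k _; exact: expR_ge0.
Qed.

Lemma expR_ell z : expR (ell z) = esum_exp z.
Proof. by rewrite /ell lnK// posrE esum_exp_gt0. Qed.

Lemma gibbs_ge0 z k : 0 <= gibbs z k.
Proof. exact: expR_ge0. Qed.

Lemma sum_gibbs z : \sum_(k < n) gibbs z k = 1.
Proof.
under eq_bigr do rewrite /gibbs expRD expRN.
by rewrite -mulr_suml expR_ell mulfV// gt_eqF// esum_exp_gt0.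
Qed.

Lemma gibbs_le1 z k : gibbs z k <= 1.
Proof.
rewrite -(sum_gibbs z) (bigD1 k)//= lerDl.
by apply: sumr_ge0 => l _; exact: gibbs_ge0.
Qed.

Lemma le_ell z k : z k <= ell z.
Proof.
rewrite -ler_expR expR_ell /esum_exp (bigD1 k)//= lerDl.
by apply: sumr_ge0 => l _; exact: expR_ge0.
Qed.

Lemma ell_le z (m : R) : (forall k, z k <= m) -> ell z <= m + ln n%:R.
Proof.
move=> zm; rewrite -ler_expR expR_ell expRD lnK ?posrE ?ltr0n//.
apply: (@le_trans _ _ (\sum_(k < n) expR m)).
  by apply: ler_sum => k _; rewrite ler_expR.
by rewrite sumr_const card_ord mulr_natr.
Qed.

Lemma ell_vadd z v : ell (vadd z v) - ell z = ln (\sum_(k < n) gibbs z k * expR (v k)).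
Proof.
have -> : \sum_(k < n) gibbs z k * expR (v k) = esum_exp (vadd z v) / esum_exp z.
  rewrite /esum_exp mulr_suml; apply: eq_bigr => k _.
  by rewrite /gibbs /vadd expRD expRN expR_ell [in RHS]expRD; rewrite /esum_exp; ring.
by rewrite ln_div ?posrE ?esum_exp_gt0.
Qed.

Definition pmean z v : R := \sum_(k < n) gibbs z k * v k.

Lemma gibbs_mean_le z (f : 'I_n -> R) b : (forall k, `|f k| <= b) ->
  `|pmean z f| <= b.
Proof.
move=> fb; apply: le_trans (ler_norm_sum _ _ _) _.
rewrite -[leRHS]mul1r -(sum_gibbs z) mulr_suml; apply: ler_sum => k _.
by rewrite normrM ger0_norm ?gibbs_ge0// ler_wpM2l ?gibbs_ge0.
Qed.

Lemma norm_le_l1 v k : `|v k| <= l1 v.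
Proof. by rewrite /l1 (bigD1 k)//= lerDl; apply: sumr_ge0. Qed.

(** By [ell_vadd] the increment is the logarithm of a Gibbs average of exp (v k), whose first two
    cumulants are the mean and variance of v under the Gibbs weights. The remainders of exp and ln
    add up to 128 + 2 + 3 <= 200. *)
Lemma ell_taylor z v : l1 v <= 2^-1 ->
  `|ell (vadd z v) - ell z - pmean z v -
    2^-1 * (pmean z (fun k => v k ^+ 2) - pmean z v ^+ 2)| <= 200 * l1 v ^+ 3.
Proof.
move=> l2; set m1 := pmean z v; set m2 := pmean z _; set l := l1 v; have l0 : 0 <= l := l1_ge0 v.
have vl k : `|v k| <= l by exact: norm_le_l1.
pose r k := expR (v k) - 1 - v k - 2^-1 * v k ^+ 2.
have e2 : expR (2^-1 : R) <= 2.
  have := expR_ge1Dx (- 2^-1 : R); rewrite expRN => h.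
  have : 2^-1 <= (expR 2^-1 : R)^-1 by lra.
  by rewrite lef_pV2 ?posrE ?expR_gt0.
have rl k : `|r k| <= 2 * l ^+ 3.
  apply: le_trans (expR_taylor2 (v k)) _; apply: ler_pM; rewrite ?expR_ge0//.
    by apply: le_trans e2; rewrite ler_expR (le_trans (vl k)).
  by apply: lerXn2r; rewrite ?nnegrE.
pose rho := pmean z r.
have rhob : `|rho| <= 2 * l ^+ 3 by exact: gibbs_mean_le.
pose w := m1 + 2^-1 * m2 + rho.
have wE : \sum_(k < n) gibbs z k * expR (v k) = 1 + w.
  rewrite /w /m1 /m2 /rho /pmean mulr_sumr -[X in X + _](sum_gibbs z) -!big_split/=.
  by apply: eq_bigr => k _; rewrite /r; ring.
have m1b : `|m1| <= l by exact: gibbs_mean_le.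
have m2b : `|m2| <= l ^+ 2.
  apply: gibbs_mean_le => k; rewrite normrX; apply: lerXn2r; rewrite ?nnegrE//.
have l20 : 0 <= l ^+ 2 by exact: exprn_ge0.
have l30 : 0 <= l ^+ 3 by exact: exprn_ge0.
have l2l : l ^+ 2 <= 2^-1 * l by rewrite expr2 ler_wpM2r.
have l3l : l ^+ 3 <= 2^-1 * l ^+ 2 by rewrite exprS ler_wpM2r.
have w2 : - 2^-1 <= w.
  have : 1 - l <= 1 + w.
    rewrite -wE; apply: (@le_trans _ _ (\sum_(k < n) gibbs z k * (1 - l))).
      by rewrite -mulr_suml sum_gibbs mul1r.
    apply: ler_sum => k _; rewrite ler_wpM2l ?gibbs_ge0//.
    apply: le_trans (expR_ge1Dx (v k)); have := vl k; rewrite ler_norml => /andP[]; lra.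
  by move: l2; rewrite -/l; lra.
have wb : `|w| <= 2 * l.
  move: m1b m2b rhob; rewrite !ler_norml /w => /andP[? ?] /andP[? ?] /andP[? ?].
  by apply/andP; split; lra.
have wm : `|w - m1| <= 2 * l ^+ 2.
  move: m2b rhob; rewrite !ler_norml /w => /andP[? ?] /andP[? ?].
  by apply/andP; split; lra.
have lt := ln_taylor2 w2.
rewrite ell_vadd wE.
have -> : ln (1 + w) - m1 - 2^-1 * (m2 - m1 ^+ 2) =
  (ln (1 + w) - w + 2^-1 * w ^+ 2) + rho - 2^-1 * ((w - m1) * (w + m1)).
  by rewrite /w; field.
have t1 : 16 * `|w| ^+ 3 <= 16 * (8 * l ^+ 3).
  have -> : 8 * l ^+ 3 = (2 * l) ^+ 3 by rewrite exprMn; congr (_ * _); ring.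
  by rewrite ler_wpM2l//; apply: lerXn2r; rewrite ?nnegrE ?mulr_ge0.
have t2 : `|2^-1 * ((w - m1) * (w + m1))| <= 3 * l ^+ 3.
  rewrite normrM ger0_norm ?invr_ge0// normrM.
  have -> : 3 * l ^+ 3 = 2^-1 * (2 * l ^+ 2 * (3 * l)) by field.
  rewrite ler_wpM2l ?invr_ge0//; apply: ler_pM => //.
  by apply: le_trans (ler_normD _ _) _; lra.
apply: le_trans (ler_normB _ _) _; apply: le_trans (lerD (ler_normD _ _) t2) _.
by apply: le_trans (lerD (lerD lt rhob) (lexx _)) _; lra.
Qed.

Lemma mfunc_ell : mfunc (ell : ('I_n -> R) -> R).
Proof.
move=> d' T' Z mZ; apply: (measurableT_comp (@measurable_ln R)).
apply: measurable_sum => k; exact: (measurableT_comp (@measurable_expR R) (mZ k)).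
Qed.

Lemma mfunc_gibbs k : mfunc (fun z => gibbs z k).
Proof.
move=> d' T' Z mZ; apply: (measurableT_comp (@measurable_expR R)).
by apply: measurable_funB; [exact: mZ|exact: mfunc_ell].
Qed.

Lemma mfunc_comp (g : R -> R) (f : ('I_n -> R) -> R) :
  measurable_fun setT g -> mfunc f -> mfunc (fun z => g (f z)).
Proof. by move=> mg mf d' T' Z mZ; apply: (measurableT_comp mg (mf _ _ _ mZ)). Qed.

Lemma mfunc_cst (c : R) : mfunc (fun _ : 'I_n -> R => c).
Proof. by move=> d' T' Z mZ; exact: measurable_cst. Qed.

(** Chain rule for g o ell: the gradient of [ell] is [gibbs], written p, and the derivative of p is
    delta_kl p_k - p_k p_l. For k != l the second derivative is (g2 - g1) p_k p_l, which decides the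
    sign in Slepian's inequality. *)
Definition ellD1 (g1 : R -> R) (k : 'I_n) z : R := g1 (ell z) * gibbs z k.
Definition ellD2 (g1 g2 : R -> R) (k l : 'I_n) z : R :=
  g2 (ell z) * (gibbs z k * gibbs z l) +
  g1 (ell z) * ((k == l)%:R * gibbs z k - gibbs z k * gibbs z l).

Lemma lin1_ell (g1 : R -> R) z v :
  lin1 (fun k => ellD1 g1 k z) v = g1 (ell z) * pmean z v.
Proof.
rewrite /lin1 /pmean mulr_sumr; apply: eq_bigr => k _.
by rewrite /ellD1 mulrA.
Qed.

Lemma quad_ell (g1 g2 : R -> R) z v :
  quad (fun k l => ellD2 g1 g2 k l z) v = g2 (ell z) * pmean z v ^+ 2 +
    g1 (ell z) * (pmean z (fun k => v k ^+ 2) - pmean z v ^+ 2).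
Proof.
rewrite /quad.
have sq : pmean z v ^+ 2 =
    \sum_(k < n) \sum_(l < n) (gibbs z k * gibbs z l) * (v k * v l).
  rewrite expr2 /pmean mulr_suml; apply: eq_bigr => k _.
  by rewrite mulr_sumr; apply: eq_bigr => l _; ring.
have dg : pmean z (fun k => v k ^+ 2) =
    \sum_(k < n) \sum_(l < n) ((k == l)%:R * gibbs z k) * (v k * v l).
  apply: eq_bigr => k _; rewrite (bigD1 k)//= eqxx big1 ?addr0.
    by rewrite mul1r expr2.
  by move=> l; rewrite eq_sym => /negbTE ->; rewrite !mul0r.
rewrite sq dg -sumrB !mulr_sumr -big_split/=; apply: eq_bigr => k _.
rewrite -sumrB !mulr_sumr -big_split/=; apply: eq_bigr => l _.
by rewrite /ellD2; ring.
Qed.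

Lemma comp_ell_arith (K x1 x2 y m s l l2 l3 r : R) : 0 <= K ->
  `|x1| <= K -> `|x2| <= K -> l2 = l ^+ 2 -> l3 = l ^+ 3 -> 0 <= l -> l <= 2^-1 ->
  `|m| <= l -> `|s| <= 2 * l2 -> `|y - m - 2^-1 * s| <= 200 * l3 ->
  `|r| <= K * `|y| ^+ 3 ->
  `|x1 * y + 2^-1 * x2 * y ^+ 2 + r - x1 * m - 2^-1 * (x2 * m ^+ 2 + x1 * s)|
    <= 60 ^+ 3 * K * l3.
Proof.
move=> K0 b1 b2 -> -> l0 lh bm bs by_ br.
have l20 : 0 <= l ^+ 2 by exact: exprn_ge0.
have l30 : 0 <= l ^+ 3 by exact: exprn_ge0.
have l2l : l ^+ 2 <= 2^-1 * l by rewrite expr2 ler_wpM2r.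
have l3l : l ^+ 3 <= 2^-1 * l ^+ 2 by rewrite exprS ler_wpM2r.
have ym : `|y - m| <= 101 * l ^+ 2.
  move: bs by_; rewrite !ler_norml => /andP[? ?] /andP[? ?].
  by apply/andP; split; lra.
have yb : `|y| <= 52 * l.
  move: ym bm; rewrite !ler_norml => /andP[? ?] /andP[? ?].
  by apply/andP; split; lra.
have y3 : `|y| ^+ 3 <= 52 ^+ 3 * l ^+ 3.
  have -> : 52 ^+ 3 * l ^+ 3 = (52 * l) ^+ 3 by ring.
  by apply: lerXn2r; rewrite ?nnegrE ?mulr_ge0.
have -> : x1 * y + 2^-1 * x2 * y ^+ 2 + r - x1 * m - 2^-1 * (x2 * m ^+ 2 + x1 * s) =
  x1 * (y - m - 2^-1 * s) + x2 * (2^-1 * ((y - m) * (y + m))) + r by field.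
have h1 : `|x1 * (y - m - 2^-1 * s)| <= K * (200 * l ^+ 3).
  by rewrite normrM; apply: ler_pM.
have h2 : `|2^-1 * ((y - m) * (y + m))| <= 2^-1 * (101 * l ^+ 2 * (53 * l)).
  rewrite normrM ger0_norm ?invr_ge0// ler_wpM2l ?invr_ge0// normrM.
  by apply: ler_pM => //; apply: le_trans (ler_normD _ _) _; lra.
have h3 : `|x2 * (2^-1 * ((y - m) * (y + m)))| <= K * (2^-1 * (101 * l ^+ 2 * (53 * l))).
  by rewrite normrM; apply: ler_pM.
have h4 := le_trans br (ler_wpM2l K0 y3).
apply: le_trans (ler_normD _ _) _; apply: le_trans (lerD (ler_normD _ _) h4) _.
apply: le_trans (lerD (lerD h1 h3) (lexx _)) _.
have -> : K * (200 * l ^+ 3) + K * (2^-1 * (101 * l ^+ 2 * (53 * l))) +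
  K * (52 ^+ 3 * l ^+ 3) = (K * l ^+ 3) * (200 + 2^-1 * 5353 + 52 ^+ 3) by field.
have -> : 60 ^+ 3 * K * l ^+ 3 = (K * l ^+ 3) * 60 ^+ 3 by ring.
by rewrite ler_wpM2l ?mulr_ge0//; lra.
Qed.

(** For l1 v <= 1/2 the expansions of [g] and of [ell] are composed; otherwise l1 v is bounded below
    and the individual terms are absorbed by 60^3 K l^3. The constant is generous: the composition
    needs less than 53^3. *)
Lemma C3_ell (g g1 g2 g3 : R -> R) (K : R) :
  measurable_fun setT g -> measurable_fun setT g1 -> measurable_fun setT g2 ->
  (forall x : R, is_derive x 1 g (g1 x)) -> (forall x : R, is_derive x 1 g1 (g2 x)) ->
  (forall x : R, is_derive x 1 g2 (g3 x)) ->
  (forall x, `|g x| <= K) -> (forall x, `|g1 x| <= K) -> (forall x, `|g2 x| <= K) ->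
  (forall x, `|g3 x| <= K) ->
  C3 (60 ^+ 3 * K) (fun z => g (ell z)) (ellD1 g1) (ellD2 g1 g2).
Proof.
move=> mg mg1 mg2 d0 d1 d2 b0 b1 b2 b3.
have K0 : 0 <= K := le_trans (normr_ge0 _) (b0 0).
have K60 : 2 * K <= 60 ^+ 3 * K by rewrite ler_wpM2r//; lra.
have mu (x : R) : `|x| <= K -> `|x| <= 60 ^+ 3 * K by move=> h; lra.
have g01 z k l : `|gibbs z k * gibbs z l| <= 1.
  by rewrite ger0_norm ?mulr_ge0 ?gibbs_ge0// mulr_ile1 ?gibbs_ge0 ?gibbs_le1.
have g02 z k l : `|(k == l)%:R * gibbs z k - gibbs z k * gibbs z l| <= 1.
  have h1 := gibbs_ge0 z k; have h2 := gibbs_le1 z k.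
  have h3 := gibbs_ge0 z l; have h4 := gibbs_le1 z l.
  have h5 : 0 <= gibbs z k * gibbs z l by exact: mulr_ge0.
  have h6 : gibbs z k * gibbs z l <= gibbs z k by rewrite ler_piMr.
  by rewrite ler_norml; case: eqP => _; rewrite ?mul1r ?mul0r; apply/andP; split; lra.
have bD1 k z : `|ellD1 g1 k z| <= K.
  rewrite /ellD1 normrM -[leRHS]mulr1; apply: ler_pM => //.
  by rewrite ger0_norm ?gibbs_ge0 ?gibbs_le1.
have bD2 k l z : `|ellD2 g1 g2 k l z| <= 2 * K.
  rewrite /ellD2; apply: le_trans (ler_normD _ _) _; rewrite mulr2n mulrDl mul1r.
  by apply: lerD; rewrite normrM -[leRHS]mulr1; apply: ler_pM.
split.
- exact: mfunc_comp mg mfunc_ell.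
- by move=> k; apply: mfuncM; [exact: mfunc_comp mg1 mfunc_ell|exact: mfunc_gibbs].
- move=> k l; apply: mfuncD; apply: mfuncM.
  + exact: mfunc_comp mg2 mfunc_ell.
  + by apply: mfuncM; exact: mfunc_gibbs.
  + exact: mfunc_comp mg1 mfunc_ell.
  + apply: mfuncD.
      by apply: mfuncM; [exact: mfunc_cst|exact: mfunc_gibbs].
    apply: (@mfunc_comp (fun y => - y)); first exact: measurable_funN.
    by apply: mfuncM; exact: mfunc_gibbs.
- by move=> z; apply: mu.
- by move=> k z; apply: mu.
- by move=> k l z; apply: le_trans (bD2 k l z) _.
move=> z v; set l := l1 v; have l0 : 0 <= l := l1_ge0 v.
have [lh|lh] := leP l 2^-1.
  rewrite lin1_ell quad_ell.
  pose y := ell (vadd z v) - ell z.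
  have yE : ell (vadd z v) = ell z + y by rewrite /y; ring.
  pose r := g (ell z + y) - g (ell z) - g1 (ell z) * y - 2^-1 * g2 (ell z) * y ^+ 2.
  have rb : `|r| <= K * `|y| ^+ 3 by apply: taylor2 => t _.
  have mb : `|pmean z v| <= l by apply: gibbs_mean_le => k; exact: norm_le_l1.
  have sb : `|pmean z (fun k => v k ^+ 2) - pmean z v ^+ 2| <= 2 * l ^+ 2.
    apply: le_trans (ler_normB _ _) _; rewrite mulr2n mulrDl mul1r; apply: lerD.
      apply: gibbs_mean_le => k; rewrite normrX; apply: lerXn2r; rewrite ?nnegrE//.
      exact: norm_le_l1.
    by rewrite normrX; apply: lerXn2r; rewrite ?nnegrE.
  rewrite yE.
  have -> : g (ell z + y) - g (ell z) = g1 (ell z) * y + 2^-1 * g2 (ell z) * y ^+ 2 + r.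
    by rewrite /r; ring.
  apply: comp_ell_arith => //; exact: ell_taylor.
have hl : `|lin1 (ellD1 g1 ^~ z) v| <= K * l by exact: lin1_le.
have hq : `|quad (fun k l => ellD2 g1 g2 k l z) v| <= 2 * K * l ^+ 2 by exact: quad_le.
have hq' : `|2^-1 * quad (fun k l => ellD2 g1 g2 k l z) v| <= K * l ^+ 2.
  rewrite normrM ger0_norm ?invr_ge0//; lra.
apply: le_trans (ler_normB _ _) _; apply: le_trans (lerD (ler_normB _ _) hq') _.
apply: le_trans (lerD (lerD (ler_normB _ _) hl) (lexx _)) _.
apply: le_trans (lerD (lerD (lerD (b0 _) (b0 _)) (lexx _)) (lexx _)) _.
have -> : K + K + K * l + K * l ^+ 2 = K * (2 + l + l ^+ 2) by ring.
have -> : 60 ^+ 3 * K * l ^+ 3 = K * (60 ^+ 3 * l ^+ 3) by ring.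
rewrite ler_wpM2l//.
have a1 : 1 <= 2 * l by lra.
have a2 : l <= 2 * l ^+ 2 by rewrite expr2 mulrA ler_peMl.
have a3 : l ^+ 2 <= 2 * l ^+ 3 by rewrite [l ^+ 3]exprS mulrA ler_peMl// exprn_ge0.
by lra.
Qed.

End softmax.

Section gumbel.
Context {R : realType}.
Implicit Types a x : R.

(* gum a \o ell = exp (- e ^- a \sum_k e ^ z_k), a smooth version of the indicator of
   max z <= a whose mixed second derivatives are nonnegative *)
Definition gum a x : R := expR (- expR (x - a)).
Definition gum1 a x : R := - expR (x - a) * gum a x.
Definition gum2 a x : R := (expR (x - a) ^+ 2 - expR (x - a)) * gum a x.
Definition gum3 a x : R :=
  (- expR (x - a) ^+ 3 + 3 * expR (x - a) ^+ 2 - expR (x - a)) * gum a x.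

Lemma is_derive_gum a x : is_derive x 1 (gum a) (gum1 a x).
Proof. by rewrite /gum /gum1; apply: is_derive_eq; rewrite /GRing.scale/= /gum; ring. Qed.

Lemma is_derive_gum1 a x : is_derive x 1 (gum1 a) (gum2 a x).
Proof.
have dg := is_derive_gum a x; rewrite /gum1.
by apply: is_derive_eq; rewrite /GRing.scale/= /gum2 /gum1; ring.
Qed.

Lemma is_derive_gum2 a x : is_derive x 1 (gum2 a) (gum3 a x).
Proof.
have dg := is_derive_gum a x.
rewrite (_ : gum2 a = fun x => (expR (x - a) * expR (x - a) - expR (x - a)) * gum a x).
  by apply: is_derive_eq; rewrite /GRing.scale/= /gum3 /gum1; ring.
by apply/funext => y; rewrite /gum2 expr2.
Qed.

Lemma measurable_gum a : measurable_fun setT (gum a).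
Proof.
apply: (measurableT_comp (@measurable_expR R)).
apply: (measurableT_comp (f := fun y : R => - y)); first exact: measurable_funN.
by apply: (measurableT_comp (@measurable_expR R)); exact: measurable_funB.
Qed.

Lemma measurable_expB a : measurable_fun setT (fun x : R => expR (x - a)).
Proof. by apply: (measurableT_comp (@measurable_expR R)); exact: measurable_funB. Qed.

Lemma measurable_gum1 a : measurable_fun setT (gum1 a).
Proof.
apply: measurable_funM; last exact: measurable_gum.
by apply: measurable_funN; exact: measurable_expB.
Qed.

Lemma measurable_gum2 a : measurable_fun setT (gum2 a).
Proof.
apply: measurable_funM; last exact: measurable_gum.
by apply: measurable_funB; [apply: measurable_funX|]; exact: measurable_expB.
Qed.

(** With u = exp (x - a), [gum a x] is exp (- u), and u^j <= j! exp u for j <= 3. *)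
Lemma gum_pow_bound a x : [/\ 0 <= gum a x <= 1, expR (x - a) * gum a x <= 1,
  expR (x - a) ^+ 2 * gum a x <= 2 & expR (x - a) ^+ 3 * gum a x <= 6].
Proof.
set u := expR (x - a); have u0 : 0 <= u by exact: expR_ge0.
have h (c y : R) : 0 <= c -> y <= c * expR u -> y * gum a x <= c.
  move=> c0 hy; rewrite /gum -/u expRN ler_pdivrMr ?expR_gt0//.
split.
- by rewrite /gum expR_ge0 -expR0 ler_expR oppr_le0.
- by apply: h => //; rewrite mul1r; have := expR_ge1Dx u; lra.
- by apply: h => //; have := expR_ge1Dxn 1 u0; rewrite (_ : 2`! = 2)%N//; lra.
- by apply: h => //; exact: cube_le_expR.
Qed.

(** The largest of the four is [gum3]: 6 + 3 * 2 + 1 = 13. *)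
Lemma gum_bounds a x : [/\ `|gum a x| <= 13, `|gum1 a x| <= 13,
  `|gum2 a x| <= 13 & `|gum3 a x| <= 13].
Proof.
have [/andP[h0 h0'] h1 h2 h3] := gum_pow_bound a x.
rewrite /gum1 /gum2 /gum3; set u := expR _ in h1 h2 h3 *; set g := gum a x in h0 h0' h1 h2 h3 *.
have u0 : 0 <= u by exact: expR_ge0.
have g1 : 0 <= u * g by exact: mulr_ge0.
have g2 : 0 <= u ^+ 2 * g by rewrite mulr_ge0// exprn_ge0.
have g3 : 0 <= u ^+ 3 * g by rewrite mulr_ge0// exprn_ge0.
by split; rewrite ler_norml; apply/andP; split; lra.
Qed.

End gumbel.

Section bounded_exp.
Context {R : realType}.
Variables (lam L : R).
Hypothesis L1 : 1 <= L.
Implicit Type x : R.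

(* a bounded function tending to the identity as L tends to infinity *)
Definition bid x : R := L * sin (x * L^-1).
Definition bex x : R := expR (lam * bid x).
Definition bex1 x : R := lam * cos (x * L^-1) * bex x.
Definition bex2 x : R :=
  (lam ^+ 2 * cos (x * L^-1) ^+ 2 - lam * sin (x * L^-1) * L^-1) * bex x.
Definition bex3 x : R :=
  (lam ^+ 3 * cos (x * L^-1) ^+ 3
   - 3 * lam ^+ 2 * cos (x * L^-1) * sin (x * L^-1) * L^-1
   - lam * cos (x * L^-1) * L^-1 ^+ 2) * bex x.

Let L0 : L != 0. Proof. by rewrite gt_eqF// (lt_le_trans _ L1). Qed.

Lemma is_derive_bex x : is_derive x 1 bex (bex1 x).
Proof.
rewrite /bex /bex1 /bid; apply: is_derive_eq; rewrite /GRing.scale/= /bex /bid.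
by field.
Qed.

Lemma is_derive_bex1 x : is_derive x 1 bex1 (bex2 x).
Proof.
have dg := is_derive_bex x; rewrite /bex1.
by apply: is_derive_eq; rewrite /GRing.scale/= /bex2 /bex1; field.
Qed.

Lemma is_derive_bex2 x : is_derive x 1 bex2 (bex3 x).
Proof.
have dg := is_derive_bex x.
rewrite (_ : bex2 = fun x => (lam ^+ 2 * (cos (x * L^-1) * cos (x * L^-1))
   - lam * sin (x * L^-1) * L^-1) * bex x).
  by apply: is_derive_eq; rewrite /GRing.scale/= /bex3 /bex1; field.
by apply/funext => y; rewrite /bex2 expr2.
Qed.

Lemma measurable_sinL : measurable_fun setT (fun x : R => sin (x * L^-1)).
Proof.
apply: (measurableT_comp (f := sin)); last exact: measurable_funM.
by apply: continuous_measurable_fun; exact: continuous_sin.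
Qed.

Lemma measurable_cosL : measurable_fun setT (fun x : R => cos (x * L^-1)).
Proof.
apply: (measurableT_comp (f := cos)); last exact: measurable_funM.
by apply: continuous_measurable_fun; exact: continuous_cos.
Qed.

Lemma measurable_bid : measurable_fun setT bid.
Proof. by apply: measurable_funM => //; exact: measurable_sinL. Qed.

Lemma measurable_bex : measurable_fun setT bex.
Proof.
apply: (measurableT_comp (@measurable_expR R)); apply: measurable_funM => //.
exact: measurable_bid.
Qed.

Lemma measurable_bex1 : measurable_fun setT bex1.
Proof.
apply: measurable_funM; last exact: measurable_bex.
by apply: measurable_funM => //; exact: measurable_cosL.
Qed.

Lemma measurable_bex2 : measurable_fun setT bex2.
Proof.
apply: measurable_funM; last exact: measurable_bex.
apply: measurable_funB; apply: measurable_funM => //.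
  by apply: measurable_funX; exact: measurable_cosL.
by apply: measurable_funM => //; exact: measurable_sinL.
Qed.

(** The logarithmic derivative is bounded by |lam| for every L; the decoupling bound therefore
    survives the limit in L, although the sup norms [bexK] explode. *)
Lemma norm_bex1 x : `|bex1 x| <= `|lam| * bex x.
Proof.
rewrite /bex1 !normrM (ger0_norm (expR_ge0 _)) ler_wpM2r ?expR_ge0//.
by rewrite ler_piMr ?cos_max.
Qed.

Lemma bid_id x : `|bid x| <= `|x| /\ `|bid x - x| <= x ^+ 2 / L.
Proof.
have Lp : 0 < L by exact: lt_le_trans ltr01 L1.
pose y := x * L^-1.
have s1 (z : R) : `|sin z| <= `|z|.
  have [t _] := @mean_value R sin cos 0 z (fun t _ => is_derive_sin _).
  by rewrite add0r sin0 subr0 => ->; rewrite normrM ler_piMl ?cos_max.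
have s2 : `|sin y - y| <= y ^+ 2.
  have [t t01] := @mean_value R sin cos 0 y (fun t _ => is_derive_sin _).
  rewrite add0r sin0 subr0 add0r => ->.
  have [t' t01'] := @mean_value R cos (fun z => - sin z) 0 (t * y) (fun t _ => is_derive_cos _).
  rewrite add0r cos0 add0r => E.
  have -> : cos (t * y) * y - y = (cos (t * y) - 1) * y by ring.
  rewrite E; set u := t' * (t * y).
  have -> : - sin u * (t * y) * y = (- sin u * t) * y ^+ 2 by ring.
  rewrite normrM (ger0_norm (sqr_ge0 y)) ler_piMl ?sqr_ge0// normrM normrN.
  rewrite mulr_ile1 ?sin_max//.
  by have /andP[h1 h2] := t01; rewrite ger0_norm.
have xE : x = L * y by rewrite /y mulrC divfK.
rewrite /bid -/y; split.
  have e : `|x| = `|L| * `|y| by rewrite -normrM -xE.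
  by rewrite e normrM; apply: ler_wpM2l => //; exact: s1.
rewrite (_ : L * sin y - x = L * (sin y - y)); last by rewrite mulrBr -xE.
rewrite normrM gtr0_norm//.
have -> : x ^+ 2 / L = L * y ^+ 2 by rewrite /y; field.
by rewrite ler_wpM2l// ltW.
Qed.

Definition bexK : R := (1 + `|lam|) ^+ 3 * expR (`|lam| * L).

Lemma bex_bounds x : [/\ `|bex x| <= bexK, `|bex1 x| <= bexK,
  `|bex2 x| <= bexK & `|bex3 x| <= bexK].
Proof.
have Lp : 0 < L by exact: lt_le_trans ltr01 L1.
have Li1 : `|L^-1| <= 1 by rewrite ger0_norm ?invr_ge0 ?invf_le1// ltW.
have b0 : `|bex x| <= expR (`|lam| * L).
  rewrite /bex ger0_norm ?expR_ge0// ler_expR; apply: le_trans (ler_norm _) _.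
  rewrite normrM ler_wpM2l// /bid normrM gtr0_norm// ler_piMr ?sin_max//.
  exact: ltW.
have [c1 s1] := (cos_max (x * L^-1), sin_max (x * L^-1)).
rewrite /bex1 /bex2 /bex3 /bexK.
set C := cos _ in c1 *; set S := sin _ in s1 *; set E := bex x in b0 *.
set l := `|lam|; have l0 : 0 <= l by exact: normr_ge0.
have M (y z b c : R) : `|y| <= b -> `|z| <= c -> `|y * z| <= b * c.
  by move=> h1 h2; rewrite normrM; apply: ler_pM.
have ll : `|lam| <= l by [].
have LC := M _ _ _ _ ll c1; have LS := M _ _ _ _ ll s1.
have LSL := M _ _ _ _ LS Li1.
have sq (y b : R) : `|y| <= b -> `|y ^+ 2| <= b ^+ 2.
  by move=> h; rewrite !expr2; exact: M.
have cu (y b : R) : `|y| <= b -> `|y ^+ 3| <= b ^+ 3.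
  by move=> h; rewrite normrX; apply: lerXn2r; rewrite ?nnegrE//; exact: le_trans h.
have l2 := sq _ _ ll; have l3 := cu _ _ ll; have C2 := sq _ _ c1; have C3 := cu _ _ c1.
have l20 : 0 <= l ^+ 2 by exact: exprn_ge0.
have l30 : 0 <= l ^+ 3 by exact: exprn_ge0.
have t2 := le_trans (ler_normB _ _) (lerD (M _ _ _ _ l2 C2) LSL).
have i3 : `|3 : R| <= 3 by rewrite ger0_norm.
have t3 := le_trans (ler_normB _ _) (lerD (le_trans (ler_normB _ _) (lerD
   (M _ _ _ _ l3 C3) (M _ _ _ _ (M _ _ _ _ (M _ _ _ _ (M _ _ _ _ i3 l2) c1) s1) Li1)))
   (M _ _ _ _ LC (sq _ _ Li1))).
rewrite !expr1n !mulr1 in t2 t3 LC.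
have big : (1 + l) ^+ 3 = 1 + 3 * l + 3 * l ^+ 2 + l ^+ 3 by ring.
split.
- apply: le_trans b0 _; rewrite ler_peMl ?expR_ge0// big; lra.
- by apply: (M _ _ _ _) => //; apply: le_trans LC _; rewrite big; lra.
- by apply: (M _ _ _ _) => //; apply: le_trans t2 _; rewrite big; lra.
- by apply: (M _ _ _ _) => //; apply: le_trans t3 _; rewrite big; lra.
Qed.

End bounded_exp.

(** * Exponential moments of log-sum-exp *)

Section concentration.
Context {R : realType} {d : measure_display} {T : measurableType d}.
Variable P : probability T R.
Local Notation Li := (Li P).
Local Notation Ex := (Ex P).
Local Notation pr := (pr P).
Variable F : R -> set (set T).
Hypothesis filtF : is_filtration F.
Local Notation msys := (msys P F).

Lemma jensen_expR (f : T -> R) : Li f -> Li (fun x => expR (f x)) ->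
  expR (Ex f) <= Ex (fun x => expR (f x)).
Proof.
move=> Lf Lef; set m := Ex f.
have -> : expR m = Ex (fun x => expR m * (1 + (f x - m))).
  rewrite ExZl; last first.
    by apply: LiD; [exact: Li_cst|apply: LiB => //; exact: Li_cst].
  rewrite ExD; [|exact: Li_cst|apply: LiB => //; exact: Li_cst].
  by rewrite ExB ?Ex_cst ?subrr ?addr0 ?mulr1//; exact: Li_cst.
apply: le_Ex => //.
  by apply: LiZl; apply: LiD; [exact: Li_cst|apply: LiB => //; exact: Li_cst].
move=> x; rewrite {2}(_ : f x = m + (f x - m)); last by ring.
by rewrite expRD ler_wpM2l ?expR_ge0// expR_ge1Dx.
Qed.

Variables (n : nat) (W : 'I_n -> R -> T -> R) (TI : 'I_n -> 'I_n -> R -> T -> R)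
  (kap : R).
Hypothesis n0 : (0 < n)%N.
Hypothesis WS : msys W TI kap.
Local Notation V t := (fun x => ell (fun k => W k t x)).

Lemma measurable_ell_sys t : 0 <= t -> measurable_fun setT (V t).
Proof. by move=> t0; apply: mfunc_ell => k; exact: (sys_meas WS). Qed.

Lemma norm_ell_le (z : 'I_n -> R) : exists k, `|ell z| <= `|z k| + ln n%:R.
Proof.
pose k0 := [arg max_(i > Ordinal n0) `|z i|]%O.
have k0P i : `|z i| <= `|z k0|.
  by rewrite /k0; case: arg_maxP => //= j _ h; exact: h.
exists k0; rewrite ler_norml; apply/andP; split; last first.
  apply: (ell_le n0) => k; exact: le_trans (ler_norm _) (k0P k).
have l0 : 0 <= ln n%:R :> R by apply: ln_ge0; rewrite ler1n.
apply: le_trans (le_ell n0 z k0); rewrite opprD.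
by have := ler_norm (- z k0); rewrite normrN; lra.
Qed.

Lemma Li_exp_ell t th : 0 < t -> 0 <= th -> Li (fun x => expR (th * `|V t x|)).
Proof.
move=> t0 th0.
have sub k : subgaussian P (W k t) (kap ^+ 2 * (t - 0)).
  have := ms_sub WS k (lexx 0) t0.
  by rewrite (_ : (fun x => _) = W k t)//; apply/funext => x; rewrite (ms_0 WS) subr0.
apply: (@Li_le _ _ _ _ _ (fun x => expR (th * ln n%:R) *
    \sum_(k < n) expR (th * `|W k t x|))).
- apply: (measurableT_comp (@measurable_expR R)); apply: measurable_funM => //.
  by apply: measurableT_comp => //; apply: measurable_ell_sys; exact: ltW.
- move=> x; rewrite ger0_norm ?expR_ge0//.
  have [k hk] := norm_ell_le (fun k => W k t x).
  apply: (@le_trans _ _ (expR (th * ln n%:R) * expR (th * `|W k t x|))).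
    by rewrite -expRD ler_expR -mulrDr ler_wpM2l// addrC.
  rewrite ler_wpM2l ?expR_ge0// (bigD1 k)//= lerDl.
  by apply: sumr_ge0 => l _; exact: expR_ge0.
- by apply: LiZl; apply: Li_sum => k _; exact: subgaussian_Li_exp_norm (sub k).
Qed.

Lemma Li_ell t : 0 < t -> Li (V t).
Proof.
move=> t0; apply: (Li_le _ _ (Li_exp_ell t0 ler01)).
  by apply: measurable_ell_sys; exact: ltW.
by move=> x; rewrite mul1r; have := expR_ge1Dx `|V t x|; lra.
Qed.

Lemma Li_exp_ell' t th : 0 < t -> Li (fun x => expR (th * V t x)).
Proof.
move=> t0; apply: (Li_le _ _ (Li_exp_ell t0 (normr_ge0 th))).
  apply: (measurableT_comp (@measurable_expR R)); apply: measurable_funM => //.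
  by apply: measurable_ell_sys; exact: ltW.
move=> x; rewrite ger0_norm ?expR_ge0// ler_expR -normrM; exact: ler_norm.
Qed.

End concentration.

Lemma compare_up_arith {R : realType} (EU EV pA pB pC e tl er : R) :
  EV - EU <= er -> EU <= 1 - pA + e -> pC - e <= EV -> pB <= tl -> 1 - pB <= pC ->
  pA <= tl + 2 * e + er.
Proof. by lra. Qed.

Lemma compare_dn_arith {R : realType} (EU EV pA pB pC e tl er : R) :
  EU - EV <= er -> EV <= 1 - pC + e -> pA - e <= EU -> pB <= tl -> 1 - pB <= pC ->
  pA <= tl + 2 * e + er.
Proof. by lra. Qed.

Section comparison_tails.
Context {R : realType} {d : measure_display} {T : measurableType d}.
Variable P : probability T R.
Local Notation Li := (Li P).
Local Notation Ex := (Ex P).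
Local Notation pr := (pr P).
Variable F : R -> set (set T).
Hypothesis filtF : is_filtration F.
Local Notation msys := (msys P F).
Variables (n : nat) (W : 'I_n -> R -> T -> R) (q : 'I_n -> 'I_n -> R) (kap : R).
Hypothesis n0 : (0 < n)%N.
Hypothesis WS : msys W (fun k l t _ => q k l * t) kap.
Hypothesis qb : forall k l, `|q k l| <= kap ^+ 2.
Local Notation V t := (fun x => ell (fun k => W k t x)).

(** Decoupling is applied to a = exp (lam bid) and b = exp (- lam bid). Their product is 1, so E a E
    b <= exp (kap^2 lam^2 t), and Jensen's inequality bounds E b below by exp (- lam E bid). *)
Lemma mgf_bid lam L t : 1 <= L -> 0 < t ->
  Ex (fun x => expR (lam * bid L (V t x))) <=
  expR (kap ^+ 2 * lam ^+ 2 * t + lam * Ex (fun x => bid L (V t x))).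
Proof.
move=> L1 t0; have t0' := ltW t0.
have mV := measurable_ell_sys WS t0'.
have bg l := bex_bounds l L1.
have C l := C3_ell n0 (measurable_bex l L) (measurable_bex1 l L) (measurable_bex2 l L)
  (fun x => is_derive_bex l L1 x) (fun x => is_derive_bex1 l L1 x)
  (fun x => is_derive_bex2 l L1 x)
  (fun x => let: And4 h _ _ _ := bg l x in h) (fun x => let: And4 _ h _ _ := bg l x in h)
  (fun x => let: And4 _ _ h _ := bg l x in h) (fun x => let: And4 _ _ _ h := bg l x in h).
have C1 := C lam; have C2 := C (- lam).
rewrite (_ : bexK (- lam) L = bexK lam L) in C2; last by rewrite /bexK normrN.
have D l z : \sum_(k < n) `|ellD1 (bex1 l L) k z| <= `|l| * bex l L (ell z).
  apply: (@le_trans _ _ (\sum_(k < n) `|l| * bex l L (ell z) * gibbs z k)).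
    apply: ler_sum => k _; rewrite /ellD1 normrM [`|gibbs z k|]ger0_norm ?gibbs_ge0//.
    by rewrite ler_wpM2r ?gibbs_ge0// norm_bex1.
  by rewrite -mulr_sumr sum_gibbs// mulr1.
have D2 z : \sum_(k < n) `|ellD1 (bex1 (- lam) L) k z| <= `|lam| * bex (- lam) L (ell z).
  by rewrite -normrN; exact: D.
have := decouple filtF WS qb C1 C2 (normr_ge0 lam) t0 (fun z => expR_ge0 _)
  (fun z => expR_ge0 _) (D lam) D2.
have -> : Ex (fun x => bex lam L (V t x) * bex (- lam) L (V t x)) = 1.
  rewrite -[RHS](@Ex_cst _ _ _ P); apply: eq_Ex => x.
  by rewrite /bex -expRD mulNr subrr expR0.
have Lb : Li (fun x => bid L (V t x)).
  apply: (@Li_le _ _ _ _ _ (fun x => `|V t x|)).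
  - exact: (measurableT_comp (measurable_bid L) mV).
  - by move=> x; have [] := bid_id L1 (V t x).
  - exact: Li_norm (Li_ell n0 WS t0).
have Lbex : Li (fun x => bex (- lam) L (V t x)).
  apply: (@Li_bdd _ _ _ _ _ (bexK (- lam) L)).
    exact: (measurableT_comp (measurable_bex _ L) mV).
  by move=> x; have [] := bg (- lam) (V t x).
have J := jensen_expR (LiZl (- lam) Lb) Lbex.
rewrite ExZl// in J; rewrite mulr1 real_normK ?num_real// => H.
rewrite expRD; set e := expR (lam * _).
have e0 : 0 < e by exact: expR_gt0.
have J' : e^-1 <= Ex (fun x => bex (- lam) L (V t x)) by rewrite /e -expRN -mulNr.
rewrite -ler_pdivrMr//; apply: le_trans H; rewrite ler_wpM2l//.
by apply: Ex_ge0 => x; exact: expR_ge0.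
Qed.

Lemma cvg_bid (x : R) : (fun m : nat => bid m.+1%:R x) @ \oo --> x.
Proof.
apply/cvgrPdist_le => e e0; exists (Num.truncn (x ^+ 2 / e)).+1 => // m /= hm.
have L1 : (1 : R) <= m.+1%:R by rewrite ler1n.
rewrite distrC; have [_ hb] := bid_id L1 x; apply: (le_trans hb).
have /andP[_ h] := truncn_itv (divr_ge0 (sqr_ge0 x) (ltW e0)).
rewrite ler_pdivrMr ?ltr0n// mulrC -ler_pdivrMr//; apply: le_trans (ltW h) _.
by rewrite ler_nat (leq_trans hm).
Qed.

Lemma mgf_ell lam t : 0 < t ->
  Ex (fun x => expR (lam * V t x)) <= expR (kap ^+ 2 * lam ^+ 2 * t + lam * Ex (V t)).
Proof.
move=> t0; have t0' := ltW t0.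
have mV := measurable_ell_sys WS t0'.
have L1 (m : nat) : (1 : R) <= m.+1%:R by rewrite ler1n.
have c1 : (fun m : nat => Ex (fun x => expR (lam * bid m.+1%:R (V t x)))) @ \oo -->
    Ex (fun x => expR (lam * V t x)).
  apply: (@cvg_Ex _ _ _ _ _ _ (fun x => expR (`|lam| * `|V t x|))).
  - by move=> m; exact: (measurableT_comp (measurable_bex lam _) mV).
  - by apply: (measurableT_comp (@measurable_expR R)); exact: measurable_funM.
  - move=> x; apply: (@continuous_cvg _ _ _ _ _ (fun m : nat => lam * bid m.+1%:R (V t x)) expR).
      exact: continuous_expR.
    by apply: cvgMr; exact: cvg_bid.
  - move=> m x; rewrite ger0_norm ?expR_ge0// ler_expR; apply: le_trans (ler_norm _) _.
    by rewrite normrM ler_wpM2l//; have [] := bid_id (L1 m) (V t x).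
  - exact: (Li_exp_ell n0 WS).
have c2 : (fun m : nat => Ex (fun x => bid m.+1%:R (V t x))) @ \oo --> Ex (V t).
  apply: (@cvg_Ex _ _ _ _ _ _ (fun x => `|V t x|)).
  - by move=> m; exact: (measurableT_comp (measurable_bid _) mV).
  - exact: mV.
  - by move=> x; exact: cvg_bid.
  - by move=> m x; have [] := bid_id (L1 m) (V t x).
  - exact: Li_norm (Li_ell n0 WS t0).
have c3 : (fun m : nat => expR (kap ^+ 2 * lam ^+ 2 * t +
    lam * Ex (fun x => bid m.+1%:R (V t x)))) @ \oo -->
    expR (kap ^+ 2 * lam ^+ 2 * t + lam * Ex (V t)).
  apply: (@continuous_cvg _ _ _ _ _ (fun m : nat => kap ^+ 2 * lam ^+ 2 * t +
    lam * Ex (fun x => bid m.+1%:R (V t x))) expR).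
    exact: continuous_expR.
  by apply: cvgD; [exact: cvg_cst|apply: cvgMr; exact: c2].
by apply: (ler_cvg_to c1 c3); apply: nearW => m; exact: mgf_bid.
Qed.

Lemma tail_ell_gen lam s t : 0 < t ->
  pr [set x | s <= lam * (V t x - Ex (V t))] <= expR (kap ^+ 2 * lam ^+ 2 * t - s).
Proof.
move=> t0; have t0' := ltW t0; have mV := measurable_ell_sys WS t0'.
have mA : measurable [set x | s <= lam * (V t x - Ex (V t))].
  by apply: measurable_ge; apply: measurable_funM => //; exact: measurable_funB.
have L := Li_exp_ell' n0 WS lam t0.
have := markov_pr (c := expR (s + lam * Ex (V t))) mA L.
move=> /(_ (fun=> expR_ge0 _)) H.
rewrite -(ler_pM2l (expR_gt0 (s + lam * Ex (V t)))) -expRD.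
apply: le_trans (H _) _.
  by move=> x /=; rewrite mulrBr ler_expR; lra.
by apply: le_trans (mgf_ell lam t0) _; rewrite ler_expR; lra.
Qed.

Lemma tail_ell_up s t : 0 < t -> 0 <= s ->
  pr [set x | Ex (V t) + s <= V t x] <= expR (- (s ^+ 2 / (4 * (kap ^+ 2 * t)))).
Proof.
move=> t0 s0; have [->|sn] := eqVneq s 0.
  rewrite expr0n/= mul0r oppr0 expR0; apply: pr_le1.
  by apply: measurable_ge; apply: (measurable_ell_sys WS); exact: ltW.
have sp : 0 < s by rewrite lt_def sn.
have k0 := ms_kap WS.
have v0 : 0 < kap ^+ 2 * t by rewrite mulr_gt0// exprn_gt0.
(* The minimizer of kap^2 lam^2 t - lam s. *)
pose lam := s / (2 * (kap ^+ 2 * t)).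
have l0 : 0 < lam by rewrite divr_gt0// mulr_gt0.
have := tail_ell_gen lam (lam * s) t0.
rewrite (_ : [set x | _] = [set x | Ex (V t) + s <= V t x]); last first.
  by apply/seteqP; split => x /=; rewrite ler_pM2l// lerBrDl.
move=> /le_trans; apply; rewrite ler_expR /lam; apply: eq_ler; field.
by rewrite !gt_eqF.
Qed.

Lemma tail_ell_dn s t : 0 < t -> 0 <= s ->
  pr [set x | V t x <= Ex (V t) - s] <= expR (- (s ^+ 2 / (4 * (kap ^+ 2 * t)))).
Proof.
move=> t0 s0; have mV := measurable_ell_sys WS (ltW t0).
have [->|sn] := eqVneq s 0.
  rewrite expr0n/= mul0r oppr0 expR0; apply: pr_le1.
  by rewrite -[X in measurable X]setTI; apply: measurable_fun_le.
have sp : 0 < s by rewrite lt_def sn.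
have k0 := ms_kap WS.
have v0 : 0 < kap ^+ 2 * t by rewrite mulr_gt0// exprn_gt0.
pose lam := s / (2 * (kap ^+ 2 * t)).
have l0 : 0 < lam by rewrite divr_gt0// mulr_gt0.
have := tail_ell_gen (- lam) (lam * s) t0.
rewrite (_ : [set x | _] = [set x | V t x <= Ex (V t) - s]); last first.
  by apply/seteqP; split => x /=; rewrite mulNr -mulrN ler_pM2l//; lra.
move=> /le_trans; apply; rewrite ler_expR /lam; apply: eq_ler; field.
by rewrite !gt_eqF.
Qed.

(** The constant that [C3_ell] gives for [gum], whose derivatives up to order three are bounded by
    13. *)
Definition cmpc : R := 60 ^+ 3 * 13.

Variables (Z : 'I_n -> R -> T -> R) (TI : 'I_n -> 'I_n -> R -> T -> R).
Hypothesis ZS : msys Z TI kap.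
Variables (t : R) (G : set T).
Hypothesis t0 : 0 < t.
Hypothesis mG : measurable G.
Hypothesis hd : forall k s s' x, 0 <= s -> s <= s' ->
  TI k k s' x - TI k k s x = q k k * (s' - s).
Local Notation U t := (fun x => ell (fun k => Z k t x)).
Local Notation err := (n%:R ^+ 2 * (cmpc * kap ^+ 2 * t * pr (~` G))).

Lemma slepian_gum a eps : `|eps| <= 1 ->
  (forall x, G x -> forall k l s s', k != l -> 0 <= s -> s <= s' -> s' <= t ->
     0 <= eps * (TI k l s' x - TI k l s x - q k l * (s' - s))) ->
  eps * (Ex (fun x => gum a (V t x)) - Ex (fun x => gum a (U t x))) <= err.
Proof.
move=> e1 hG.
have bg x := gum_bounds a x.
have C := C3_ell n0 (measurable_gum a) (measurable_gum1 a) (measurable_gum2 a)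
  (is_derive_gum a) (is_derive_gum1 a) (is_derive_gum2 a)
  (fun x => let: And4 h _ _ _ := bg x in h) (fun x => let: And4 _ h _ _ := bg x in h)
  (fun x => let: And4 _ _ h _ := bg x in h) (fun x => let: And4 _ _ _ h := bg x in h).
apply: (slepian filtF WS qb ZS C t0 mG e1 _ hG hd) => k l z kl.
(* Off the diagonal the Hessian entry is (gum2 - gum1) p_k p_l, and gum2 - gum1 = exp (x - a)^2 gum
   >= 0. *)
rewrite /ellD2 (negbTE kl) mul0r sub0r mulrN -mulNr -mulrDl.
rewrite mulr_ge0//; last by rewrite mulr_ge0 ?gibbs_ge0.
rewrite /gum2 /gum1 -mulNr -mulrDl mulr_ge0 ?expR_ge0//.
by rewrite opprK subrK sqr_ge0.
Qed.

Lemma gum_hi (a y x : R) : a + y <= x -> gum a x <= expR (- y).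
Proof.
move=> h; rewrite /gum ler_expR lerN2.
apply: (@le_trans _ _ (expR y)); last by rewrite ler_expR lerBrDl.
by have := expR_ge1Dx y; lra.
Qed.

Lemma gum_lo (a y x : R) : x <= a - y -> 1 - expR (- y) <= gum a x.
Proof.
move=> h; rewrite /gum; apply: le_trans (expR_ge1Dx _); rewrite lerD2l lerN2 ler_expR.
by rewrite lerBlDl.
Qed.

Let mV : measurable_fun setT (V t).
Proof. by apply: (measurable_ell_sys WS); exact: ltW. Qed.

Let mU : measurable_fun setT (U t).
Proof. by apply: (measurable_ell_sys ZS); exact: ltW. Qed.

Let Lgum a (f : T -> R) : measurable_fun setT f -> Li (fun x => gum a (f x)).
Proof.
move=> mf; apply: (@Li_bdd _ _ _ _ _ 13).
  exact: (measurableT_comp (measurable_gum a) mf).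
by move=> x; have [] := gum_bounds a (f x).
Qed.

Let measurable_le (f : T -> R) c : measurable_fun setT f -> measurable [set x | f x <= c].
Proof. by move=> mf; rewrite -[X in measurable X]setTI; apply: measurable_fun_le. Qed.

Lemma Ex_gum_hi a y (f : T -> R) : measurable_fun setT f ->
  Ex (fun x => gum a (f x)) <= 1 - pr [set x | a + y <= f x] + expR (- y).
Proof.
move=> mf; set A := [set x | _].
have mA : measurable A by exact: measurable_ge.
have LA := Li_indic P mA.
have -> : 1 - pr A + expR (- y) = Ex (fun x => 1 - \1_A x + expR (- y)).
  by rewrite ExD ?ExB ?Ex_cst ?Ex_indic//; try exact: Li_cst; apply: LiB => //; exact: Li_cst.
apply: le_Ex; first exact: Lgum.
  by apply: LiD; [apply: LiB => //; exact: Li_cst|exact: Li_cst].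
move=> x; rewrite indicE; have [/set_mem h|h] := boolP (x \in A).
  by rewrite subrr add0r gum_hi.
by rewrite subr0; have [/andP[_ h1] _ _ _] := gum_pow_bound a (f x); have := expR_ge0 (- y); lra.
Qed.

Lemma Ex_gum_lo a y (f : T -> R) : measurable_fun setT f -> 0 <= y ->
  pr [set x | f x <= a - y] - expR (- y) <= Ex (fun x => gum a (f x)).
Proof.
move=> mf y0; set A := [set x | _].
have mA : measurable A by exact: measurable_le.
have LA := Li_indic P mA.
have -> : pr A - expR (- y) = Ex (fun x => \1_A x - expR (- y)).
  by rewrite ExB ?Ex_cst ?Ex_indic//; exact: Li_cst.
apply: le_Ex; last 1 first.
- move=> x; rewrite indicE; have [/set_mem h|h] := boolP (x \in A); first exact: gum_lo.
  by rewrite sub0r; have [/andP[h1 _] _ _ _] := gum_pow_bound a (f x); have := expR_ge0 (- y); lra.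
- by apply: LiB => //; exact: Li_cst.
- exact: Lgum.
Qed.

(** The threshold a lies [y] above the concentration level of V and [y] below the level tested for
    U, so [gum a] is within exp (- y) of 1 on the one side and of 0 on the other. On [G] the system
    Z is more correlated than W, so its smoothed maximum is stochastically smaller up to the cost
    [err]. *)
Lemma compare_up s y : 0 <= s -> 0 <= y ->
  (forall x, G x -> forall k l s s', k != l -> 0 <= s -> s <= s' -> s' <= t ->
     0 <= TI k l s' x - TI k l s x - q k l * (s' - s)) ->
  pr [set x | Ex (V t) + s + 2 * y <= U t x] <=
  expR (- (s ^+ 2 / (4 * (kap ^+ 2 * t)))) + 2 * expR (- y) + err.
Proof.
move=> s0 y0 hG; pose a := Ex (V t) + s + y.
have H := @slepian_gum a 1.
rewrite normr1 lexx in H; have {}H := H isT.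
have {}H := H (fun x Gx k l s s' kl a b c => eq_ind_r (fun u => 0 <= u)
  (hG x Gx k l s s' kl a b c) (mul1r _)).
rewrite mul1r in H.
have h1 := @Ex_gum_hi a y _ mU.
have h2 := @Ex_gum_lo a y _ mV y0.
have h3 := tail_ell_up t0 s0.
have aE : Ex (V t) + s + 2 * y = a + y by rewrite /a; ring.
rewrite aE.
have h4 : 1 - pr [set x | Ex (V t) + s <= V t x] <= pr [set x | V t x <= a - y].
  rewrite -pr_setC; last exact: measurable_ge.
  apply: le_pr; [apply: measurableC; exact: measurable_ge|exact: measurable_le|].
  by move=> x /= /negP; rewrite -ltNge => h; rewrite /a addrK ltW.
exact: compare_up_arith H h1 h2 h3 h4.
Qed.

Lemma compare_dn s y : 0 <= s -> 0 <= y ->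
  (forall x, G x -> forall k l s s', k != l -> 0 <= s -> s <= s' -> s' <= t ->
     TI k l s' x - TI k l s x - q k l * (s' - s) <= 0) ->
  pr [set x | U t x <= Ex (V t) - s - 2 * y] <=
  expR (- (s ^+ 2 / (4 * (kap ^+ 2 * t)))) + 2 * expR (- y) + err.
Proof.
move=> s0 y0 hG; pose a := Ex (V t) - s - y.
have H := @slepian_gum a (- 1).
rewrite normrN normr1 lexx in H; have {}H := H isT.
have {H} : -1 * (Ex (fun x => gum a (V t x)) - Ex (fun x => gum a (U t x))) <= err.
  apply: H => x Gx k l s1 s2 kl a1 a2 a3.
  by rewrite mulN1r oppr_ge0; exact: hG.
rewrite mulN1r opprB => H.
have h1 := @Ex_gum_hi a y _ mV.
have h2 := @Ex_gum_lo a y _ mU y0.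
have h3 := tail_ell_dn t0 s0.
have aE : Ex (V t) - s - 2 * y = a - y by rewrite /a; ring.
rewrite aE.
have h4 : 1 - pr [set x | V t x <= Ex (V t) - s] <= pr [set x | a + y <= V t x].
  rewrite -pr_setC; last exact: measurable_le.
  apply: le_pr; [apply: measurableC; exact: measurable_le|exact: measurable_ge|].
  by move=> x /= /negP; rewrite -ltNge => h; rewrite /a subrK ltW.
exact: compare_dn_arith H h1 h2 h3 h4.
Qed.

End comparison_tails.

(** * Time integrals *)

(* phi need not be measurable, hence neither are the integrands of the brackets; the
   integral of a nonnegative function is then the supremum over simple functions below it *)
Section lower_integral.
Local Open Scope ereal_scope.
Context d (T : measurableType d) (R : realType).
Variable mu : {measure set T -> \bar R}.
Import HBNNSimple.

Lemma nnsfun_le_integral (D : set T) (f : T -> \bar R) (h : {nnsfun T >-> R}) :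
  measurable D -> (forall x, D x -> 0 <= f x) -> (forall x, D x -> (h x)%:E <= f x) ->
  \int[mu]_(x in D) (h x)%:E <= \int[mu]_(x in D) f x.
Proof.
move=> mD f0 hf; rewrite (integral_nnsfun mu mD) (ge0_integralE mu f0) (mrestrict h mD).
apply: ereal_sup_ubound => /=; exists (proj_nnsfun h mD) => // x.
rewrite -(mrestrict h mD) !patchE; case: ifPn => // /set_mem xD; exact: hf.
Qed.

Lemma integral_le_nnsfun (D : set T) (f : T -> \bar R) (c : \bar R) :
  measurable D -> (forall x, D x -> 0 <= f x) ->
  (forall h : {nnsfun T >-> R}, (forall x, D x -> (h x)%:E <= f x) ->
    \int[mu]_(x in D) (h x)%:E <= c) ->
  \int[mu]_(x in D) f x <= c.
Proof.
move=> mD f0 H; rewrite (ge0_integralE mu f0); apply: ge_ereal_sup => /= _ [h hf <-].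
have hE : h \_ D = h.
  apply/funext => x; rewrite patchE; case: ifPn => // xD.
  have := hf x; rewrite patchE (negbTE xD) lee_fin => hx.
  by apply: le_anti; rewrite hx andbT; apply: (@fun_ge0 _ _ h).
rewrite -[X in sintegral mu X <= _]hE -(integral_nnsfun mu mD); apply: H => x xD.
by have := hf x; rewrite patchE mem_set.
Qed.

Lemma integral_setU_bounds (D1 D2 : set T) (f : T -> R) (a b m : R) :
  measurable D1 -> measurable D2 -> [disjoint D1 & D2] -> mu D2 = m%:E ->
  (forall x, 0 <= f x)%R -> (0 <= a)%R -> (forall x, D2 x -> a <= f x <= b)%R ->
  \int[mu]_(x in D1) (f x)%:E + (a * m)%:E <= \int[mu]_(x in D1 `|` D2) (f x)%:E /\
  \int[mu]_(x in D1 `|` D2) (f x)%:E <= \int[mu]_(x in D1) (f x)%:E + (b * m)%:E.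
Proof.
move=> m1 m2 dis muD f0 a0 fab.
have mU := measurableU _ _ m1 m2.
have intU (h : {nnsfun T >-> R}) : \int[mu]_(x in D1 `|` D2) (h x)%:E =
    \int[mu]_(x in D1) (h x)%:E + \int[mu]_(x in D2) (h x)%:E.
  apply: ge0_integral_setU => //.
  - by apply/measurable_EFinP; apply: measurable_funTS.
  - by move=> x _; rewrite lee_fin; apply: (@fun_ge0 _ _ h).
have cstm (c : R) : \int[mu]_(x in D2) (cst c%:E) x = (c * m)%:E.
  by rewrite integral_cst// muD.
split.
- rewrite -leeBrDr//; apply: integral_le_nnsfun => // [x _|h hf]; first by rewrite lee_fin.
  rewrite leeBrDr//.
  pose h' : {nnsfun T >-> R} := add_nnsfun (proj_nnsfun h m1)
    (scale_nnsfun (indic_nnsfun R m2) a0).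
  have h'E x : h' x = (h x * \1_D1 x + a * \1_D2 x)%R by [].
  have n12 x : D1 x -> D2 x -> False.
    by move=> x1 x2; move/disj_setPS : dis => /(_ x); apply; split.
  have -> : \int[mu]_(x in D1) (h x)%:E + (a * m)%:E =
      \int[mu]_(x in D1 `|` D2) (h' x)%:E.
    rewrite intU; congr (_ + _).
      apply: eq_integral => x /set_mem x1; rewrite h'E !indicE mem_set// mulr1.
      by rewrite memNset ?mulr0 ?addr0// => /(n12 _ x1).
    rewrite -cstm; apply: eq_integral => x /set_mem x2.
    rewrite h'E !indicE (mem_set x2) mulr1 memNset ?mulr0 ?add0r// => x1.
    exact: n12 x1 x2.
  apply: nnsfun_le_integral => // x; rewrite ?lee_fin// h'E !indicE => -[x1|x2].
    rewrite (mem_set x1) mulr1 memNset ?mulr0 ?addr0; last by move=> /(n12 _ x1).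
    by have := hf x x1; rewrite lee_fin.
  rewrite (mem_set x2) mulr1 memNset ?mulr0 ?add0r; last by move=> x1; exact: n12 x1 x2.
  by have /andP[] := fab x x2.
- apply: integral_le_nnsfun => // [x _|h hf]; first by rewrite lee_fin.
  rewrite intU; apply: leeD.
    apply: nnsfun_le_integral => // x x1; rewrite ?lee_fin//.
    by have := hf x (or_introl x1).
  rewrite -cstm; apply: ge0_le_integral => //.
  + by move=> x _; rewrite lee_fin; apply: (@fun_ge0 _ _ h).
  + by apply/measurable_EFinP; apply: measurable_funTS.
  + move=> x x2; have := hf x (or_intror x2) => /le_trans; apply.
    by rewrite lee_fin; have /andP[] := fab x x2.
Qed.

End lower_integral.

Section time_integral_bounds.
Context {R : realType}.
Implicit Types (g : R -> R) (s t a b : R).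

Let J g t : R := fine (\int[lebesgue_measure]_(s in `[0%R, t]) (g s)%:E)%E.

Lemma ge0_time_integral g a b s t : 0 <= s -> s <= t ->
  (forall r, 0 <= g r <= 1) -> 0 <= a ->
  (forall r, s < r -> r <= t -> a <= g r <= b) ->
  [/\ (0 <= \int[lebesgue_measure]_(r in `[0%R, s]) (g r)%:E < +oo)%E,
    J g s + a * (t - s) <= J g t & J g t <= J g s + b * (t - s)].
Proof.
move=> s0 st g01 a0 gab.
have g0 r : 0 <= g r by have /andP[] := g01 r.
have fin u : 0 <= u -> (0 <= \int[lebesgue_measure]_(r in `[0%R, u]) (g r)%:E < +oo)%E.
  move=> u0; apply/andP; split; first by apply: integral_ge0 => r _; rewrite lee_fin.
  have mu : lebesgue_measure (`[0%R, u]%classic : set R) = u%:E.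
    rewrite lebesgue_measure_itv/= lte_fin; case: ltgtP u0 => // [_ _|<- _//].
    by rewrite oppr0 adde0.
  have dis : [disjoint (set0 : set R) & `[0%R, u]%classic] by apply/disj_setPS => x [].
  have [_] := @integral_setU_bounds _ _ R (@lebesgue_measure R) set0 `[0%R, u]%classic
    g 0 1 u measurable0 (measurable_itv _) dis mu g0 (lexx 0) (fun x _ => g01 x).
  by rewrite set0U => /le_lt_trans; apply; rewrite integral_set0 add0e ltry.
have fs := fin s s0; have ft := fin t (le_trans s0 st).
have fsn : (\int[lebesgue_measure]_(r in `[0%R, s]) (g r)%:E)%E \is a fin_num.
  by rewrite ge0_fin_numE; case/andP: fs.
have ftn : (\int[lebesgue_measure]_(r in `[0%R, t]) (g r)%:E)%E \is a fin_num.
  by rewrite ge0_fin_numE; case/andP: ft.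
have U : `[0%R, t]%classic = (`[0%R, s] `|` `]s, t])%classic.
  apply/seteqP; split => x /=; rewrite !in_itv/=.
    by move=> /andP[-> ->]; case: (leP x s); [left|right].
  by move=> [/andP[-> /le_trans->]//|/andP[/ltW/(le_trans s0)-> ->]].
have dis : [disjoint `[0%R, s]%classic & (`]s, t]%classic : set R)].
  apply/disj_setPS => x [/=]; rewrite !in_itv/= => /andP[_ h1] /andP[h2 _].
  by move: (lt_le_trans h2 h1); rewrite ltxx.
have mu : lebesgue_measure (`]s, t]%classic : set R) = (t - s)%:E.
  rewrite lebesgue_measure_itv/= lte_fin; move: (st); rewrite le_eqVlt.
  by case/orP=> [/eqP<-|->]; rewrite ?ltxx ?subrr// EFinB.
have gab' x : (`]s, t]%classic : set R) x -> a <= g x <= b.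
  by rewrite /= in_itv/= => /andP[]; exact: gab.
have [] := @integral_setU_bounds _ _ R (@lebesgue_measure R) `[0%R, s]%classic
  `]s, t]%classic g a b (t - s) (measurable_itv _) (measurable_itv _) dis mu g0 a0 gab'.
rewrite -U => h1 h2; split=> //; rewrite /J -lee_fin EFinD !fineK//.
Qed.

(** The integral is that of the positive part minus that of the negative part, each treated by
    [ge0_time_integral]; c = max (c, 0) - max (- c, 0) recombines the bounds. With g = phi (X_u -
    X_v) along one path it controls bracket increments. *)
Lemma time_integral_bounds g c1 c2 s t : 0 <= s -> s <= t ->
  (forall r, `|g r| <= 1) ->
  (forall r, s < r -> r <= t -> c1 <= g r <= c2) ->
  c1 * (t - s) <= J g t - J g s <= c2 * (t - s).
Proof.
move=> s0 st g1 gc.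
pose gp r := Num.max (g r) 0; pose gn r := Num.max (- g r) 0.
have gp01 r : 0 <= gp r <= 1.
  by rewrite /gp le_max lexx orbT ge_max ler01 andbT; have := g1 r; rewrite ler_norml => /andP[].
have gn01 r : 0 <= gn r <= 1.
  by rewrite /gn le_max lexx orbT ge_max ler01 andbT lerNl; have := g1 r; rewrite ler_norml => /andP[].
have JE u : 0 <= u -> J g u = J gp u - J gn u.
  move=> u0; rewrite /J integralE.
  under eq_integral do rewrite funeposE -EFin_max.
  under [X in (_ - X)%E]eq_integral do rewrite funenegE -EFinN -EFin_max.
  have [/andP[a1 a2] _ _] := @ge0_time_integral gp 0 1 u u u0 (lexx _) gp01 (lexx _)
    (fun r _ _ => gp01 r).
  have [/andP[b1 b2] _ _] := @ge0_time_integral gn 0 1 u u u0 (lexx _) gn01 (lexx _)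
    (fun r _ _ => gn01 r).
  by rewrite fineB// ge0_fin_numE.
have t0 := le_trans s0 st.
have [_ p1 p2] := @ge0_time_integral gp (Num.max c1 0) (Num.max c2 0) s t s0 st gp01
  (ltac:(by rewrite le_max lexx orbT)) (ltac:(by move=> r h1 h2; have /andP[h3 h4] := gc r h1 h2;
    rewrite /gp; apply/andP; split; apply: le_max2 => //)).
have [_ n1 n2] := @ge0_time_integral gn (Num.max (- c2) 0) (Num.max (- c1) 0) s t s0 st gn01
  (ltac:(by rewrite le_max lexx orbT)) (ltac:(by move=> r h1 h2; have /andP[h3 h4] := gc r h1 h2;
    rewrite /gn; apply/andP; split; apply: le_max2 => //; rewrite lerN2)).
have m1 (c : R) : Num.max c 0 - Num.max (- c) 0 = c.
  by rewrite /Num.max oppr_lt0; case: ltgtP; lra.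
rewrite !JE//; rewrite -[X in X * _ <= _](m1 c1) -[X in _ && (_ <= X * _)](m1 c2) !mulrBl.
apply/andP; split; lra.
Qed.

End time_integral_bounds.

Section martingale_algebra.
Context {R : realType} {d : measure_display} {T : measurableType d}.
Variable P : probability T R.
Local Notation Li := (Li P).
Local Notation Ex := (Ex P).
Variable F : R -> set (set T).
Hypothesis filtF : is_filtration F.

Lemma Li_indicM A f : measurable A -> Li f -> Li (fun x => \1_A x * f x).
Proof.
move=> mA Lf; apply: (@Li_le _ _ _ _ _ (fun x => `|f x|)).
- by apply: measurable_funM; [exact: measurable_indic|exact: Li_meas Lf].
- move=> x; rewrite normrM indicE; case: (x \in A); rewrite ?normr1 ?mul1r//.
  by rewrite normr0 mul0r.
- exact: Li_norm.
Qed.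

Lemma martingaleP M : martingale P F M <->
  [/\ forall t, 0 <= t -> Gmeas (F t) (M t), forall t, 0 <= t -> Li (M t) &
      forall s t A, 0 <= s -> s <= t -> F s A ->
        Ex (fun x => \1_A x * M t x) = Ex (fun x => \1_A x * M s x)].
Proof.
split=> -[aM LM eM]; split=> //.
- move=> s t A s0 st FA; have mA := filt_meas filtF s0 FA.
  by rewrite !Rintegral_indicM// (eM s t).
- move=> s t s0 st A FA; have mA := filt_meas filtF s0 FA.
  have := eM s t A s0 st FA; rewrite !Rintegral_indicM// => E.
  have fn u : 0 <= u -> (\int[P]_(x in A) (M u x)%:E)%E \is a fin_num.
    move=> u0; apply: integrable_fin_num => //.
    exact: integrableS measurableT mA (@subsetT _ A) (LM u u0).
  by rewrite -[LHS]fineK ?fn ?(le_trans s0)// E fineK// fn.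
Qed.

Lemma martingale_lin a b c M N : martingale P F M -> martingale P F N ->
  martingale P F (fun t x => a * M t x + b * N t x + c).
Proof.
move=> /martingaleP[aM LM eM] /martingaleP[aN LN eN]; apply/martingaleP; split.
- move=> t t0; have sF := filt_sa filtF t0; apply/(GmeasE _ sF).
  have hM := (GmeasE _ sF).1 (aM t t0); have hN := (GmeasE _ sF).1 (aN t t0).
  apply: measurable_funD => //; apply: measurable_funD; exact: measurable_funM.
- move=> t t0; apply: LiD; last exact: Li_cst.
  by apply: LiD; apply: LiZl; [exact: LM|exact: LN].
- move=> s t A s0 st FA; have mA := filt_meas filtF s0 FA.
  have E u : 0 <= u -> Ex (fun x => \1_A x * (a * M u x + b * N u x + c)) =
      a * Ex (fun x => \1_A x * M u x) + b * Ex (fun x => \1_A x * N u x) +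
      c * Ex (\1_A).
    move=> u0; have L1 := Li_indicM mA (LM u u0); have L2 := Li_indicM mA (LN u u0).
    have L3 := Li_indic P mA.
    rewrite -!ExZl// -ExD; [|exact: LiZl|exact: LiZl].
    rewrite -ExD; [|by apply: LiD; exact: LiZl|exact: LiZl].
    by apply: eq_Ex => x; ring.
  by rewrite !E// ?(eM s t)// ?(eN s t)// (le_trans s0).
Qed.

Lemma martingale_ext M N : (forall t x, 0 <= t -> M t x = N t x) ->
  martingale P F M -> martingale P F N.
Proof.
move=> MN /martingaleP[aM LM eM]; apply/martingaleP.
have E t : 0 <= t -> M t = N t by move=> t0; apply/funext => x; exact: MN.
split=> [t t0|t t0|s t A s0 st FA].
- by rewrite -E//; exact: aM.
- by rewrite -E//; exact: LM.
- by rewrite -!E// ?(le_trans s0)//; exact: eM.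
Qed.

Lemma martingale_Ex M t : martingale P F M -> 0 <= t -> Ex (M t) = Ex (M 0).
Proof.
move=> /martingaleP[_ _ eM] t0; have := eM 0 t setT (lexx _) t0.
have FT : F 0 setT by have [h0 hC _] := filt_sa filtF (lexx 0); have := hC _ h0; rewrite setD0.
move=> /(_ FT); under eq_Ex do rewrite indicT mul1r.
by move=> ->; under eq_Ex do rewrite indicT mul1r.
Qed.

(** Centering changes M_k M_l by an affine combination of M_k and M_l, again a martingale, so the
    bracket only acquires the factor c^2. Negative c is allowed: both signs together give the
    absolute value of a deviation. *)
Lemma msys_affine n (M : 'I_n -> R -> T -> R) (u : 'I_n -> R)
    (g : 'I_n -> 'I_n -> R -> T -> R) (c : R) : c != 0 ->
  (forall k, martingale P F (M k)) -> (forall k x, M k 0 x = u k) ->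
  (forall k l, covariation_density P F (M k) (M l) (g k l)) ->
  (forall k l s x, `|g k l s x| <= 1) ->
  (forall k s t, 0 <= s -> s < t -> subgaussian P (fun x => M k t x - M k s x) (t - s)) ->
  msys P F (fun k t x => c * (M k t x - u k))
    (fun k l t x => c ^+ 2 * time_integral (g k l) t x) `|c|.
Proof.
move=> c0 mM M0 cM g1 sM.
have c2 : `|c| ^+ 2 = c ^+ 2 by rewrite real_normK// num_real.
split.
- by rewrite normr_gt0.
- move=> k; apply: (martingale_ext _ (martingale_lin c 0 (- (c * u k)) (mM k) (mM k))) => t x _.
  by ring.
- move=> k l; have h1 := martingale_lin (- (u l)) (- (u k)) (u k * u l) (mM k) (mM l).
  apply: (martingale_ext _ (martingale_lin (c ^+ 2) (c ^+ 2) 0 (cM k l) h1)) => t x _.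
  by ring.
- move=> k s t s0 st; rewrite c2.
  have := subgaussian_scale c (sM k s t s0 st).
  by congr (subgaussian P _ _); apply/funext => x; ring.
- move=> k l s t x s0 st; rewrite c2 -mulrBr normrM (ger0_norm (sqr_ge0 c)).
  apply: ler_wpM2l; first exact: sqr_ge0.
  have /andP[] := @time_integral_bounds R (fun r => g k l r x) (-1) 1 s t s0 st
    (fun r => g1 k l r x) (fun r _ _ => ltac:(by rewrite -ler_norml)).
  by rewrite mulN1r mul1r ler_norml => -> ->.
- by move=> k x; rewrite M0 subrr mulr0.
Qed.

End martingale_algebra.

(** * The flow and its tangent process *)

Section flow.
Context {R : realType} {d : measure_display} {T : measurableType d}.
Variable P : probability T R.
Local Notation Li := (Li P).
Local Notation Ex := (Ex P).
Local Notation pr := (pr P).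
Variables (phi : R -> R) (F : R -> set (set T)) (X Y : R -> R -> T -> R).
Hypothesis phiN : forall x, phi (- x) = phi x.
Hypothesis phi0 : phi 0 = 1.
Hypothesis phi1 : forall x, x != 0 -> `|phi x| < 1.
Hypothesis filtF : is_filtration F.
Hypothesis XH : harris_point_motion P F phi X.
Hypothesis YH : tangent_process P F phi X Y.

Lemma phi_le1 x : `|phi x| <= 1.
Proof. by have [->|/phi1/ltW//] := eqVneq x 0; rewrite phi0 normr1. Qed.

(** Nondecreasing values would give phi b >= phi 0 = 1 for b > 0, against [phi1]. *)
Lemma monotone_phi_decr delta : monotone_on_0_delta phi delta ->
  forall a b, 0 <= a -> a <= b -> b <= delta -> phi b <= phi a.
Proof.
move=> [h|//] a b a0 ab bd; have b0 := le_trans a0 ab.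
have [bz|bz] := eqVneq b 0.
  by have -> : a = b by apply: le_anti; rewrite ab bz a0.
have := h 0 b (lexx _) b0 bd; rewrite phi0 => h1.
by have := phi1 bz; rewrite ltNge (le_trans h1 (ler_norm _)).
Qed.

Lemma X_mart u : martingale P F (X u). Proof. by case: XH => /(_ u)[]. Qed.
Lemma Y_mart u : martingale P F (Y u). Proof. by case: YH => _ /(_ u)[]. Qed.
Lemma X_0 u x : X u 0 x = u. Proof. by case: XH => _ /(_ u)[]. Qed.
Lemma Y_0 u x : Y u 0 x = u. Proof. by case: YH => _ _ ->. Qed.

Lemma Y_cov u v : martingale P F (fun t x => Y u t x * Y v t x -
  time_integral (fun _ _ => phi (u - v)) t x).
Proof. by case: YH => _ _ _ h _; exact: h. Qed.

Lemma Li_ext f g : (forall x, f x = g x) -> Li f -> Li g.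
Proof. by move=> /funext ->. Qed.

Lemma X_Li u t : 0 <= t -> Li (X u t).
Proof. by case: (X_mart u) => _ h _; exact: h. Qed.
Lemma Y_Li u t : 0 <= t -> Li (Y u t).
Proof. by case: (Y_mart u) => _ h _; exact: h. Qed.

Lemma X_sub u s t : 0 <= s -> s < t -> subgaussian P (fun x => X u t x - X u s x) (t - s).
Proof.
move=> s0 st; have t0 := le_trans s0 (ltW st).
have mX : measurable_fun setT (fun x => X u t x - X u s x).
  by apply: measurable_funB; exact/Li_meas/X_Li.
split=> // th.
have FT : F s setT.
  by have [h0 hC _] := filt_sa filtF s0; have := hC _ h0; rewrite setD0.
have ts0 : 0 < t - s by rewrite subr_gt0.
have [||L ->] := @normal_mgf _ _ _ P _ 0 (Num.sqrt (t - s)) th mX.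
- by rewrite gt_eqF// sqrtr_gt0.
- move=> C mC; case: XH => _ /(_ u)[_ _ _ h] _ _ _.
  by have := h s t s0 st setT C FT mC; rewrite setTI probability_setT mul1e.
by rewrite mulr0 add0r sqr_sqrtr ?(ltW ts0).
Qed.

Lemma time_integral_cst (a : R) (t : R) (x : T) : 0 <= t -> time_integral (fun _ _ => a) t x = a * t.
Proof.
move=> t0; rewrite /time_integral.
have mu : lebesgue_measure (`[0%R, t]%classic : set R) = t%:E.
  rewrite lebesgue_measure_itv/= lte_fin; case: ltgtP t0 => // [_ _|<- _//].
  by rewrite oppr0 adde0.
have := @integral_cst _ _ R (@lebesgue_measure R) _ (measurable_itv `[0%R, t]) a%:E.
by rewrite /cst/= mu => ->.
Qed.

(** Since phi 0 = 1, the process Y_u^2 - t is a martingale, and the increment is orthogonal to the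
    value at time s. *)
Lemma Y_var u s t : 0 <= s -> s <= t ->
  [/\ Li (fun x => (Y u t x - Y u s x) ^+ 2), Ex (fun x => Y u t x - Y u s x) = 0 &
      Ex (fun x => (Y u t x - Y u s x) ^+ 2) = t - s].
Proof.
move=> s0 st; have t0 := le_trans s0 st.
have mN : martingale P F (fun r x => Y u r x ^+ 2 - r).
  apply: (martingale_ext filtF _ (martingale_lin filtF 1 0 0 (Y_cov u u) (Y_mart u))) => r x r0.
  by rewrite time_integral_cst// subrr phi0; ring.
have L2 r : 0 <= r -> Li (fun x => Y u r x ^+ 2).
  move=> r0; have [_ /(_ r r0) h _] := mN.
  by apply: (Li_ext _ (LiD h (Li_cst P r))) => x; ring.
have mY r : 0 <= r -> measurable_fun setT (Y u r) by move=> r0; exact/Li_meas/Y_Li.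
have Lst : Li (fun x => Y u s x * Y u t x).
  by apply: Li_mul_sq; [exact: mY|exact: mY|exact: L2|exact: L2].
have LD : Li (fun x => Y u s x * (Y u t x - Y u s x)).
  by apply: (Li_ext _ (LiB Lst (L2 s s0))) => x; ring.
have E2 : Ex (fun x => Y u t x ^+ 2) - Ex (fun x => Y u s x ^+ 2) = t - s.
  have h r : 0 <= r -> Ex (fun x => Y u r x ^+ 2) = r + Ex (fun x => Y u 0 x ^+ 2).
    move=> r0; have := martingale_Ex filtF mN r0.
    rewrite (ExB (L2 r r0) (Li_cst P r)) (ExB (L2 0 (lexx 0)) (Li_cst P 0)) !Ex_cst.
    by rewrite subr0 => <-; ring.
  by rewrite (h t t0) (h s s0); ring.
split.
- have LL : Li (fun x => Y u t x ^+ 2 + Y u s x ^+ 2 - 2 * (Y u s x * Y u t x)).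
    by apply: LiB; [apply: LiD; exact: L2|exact: LiZl].
  by apply: Li_ext LL => x; ring.
- rewrite (ExB (Y_Li u t0) (Y_Li u s0)) (martingale_Ex filtF (Y_mart u) t0).
  by rewrite (martingale_Ex filtF (Y_mart u) s0) subrr.
- have E0 : Ex (fun x => Y u s x * (Y u t x - Y u s x)) = 0.
    apply: (martingale_increment filtF (Y_mart u)) => //.
    by have [aY _ _] := Y_mart u; exact: adapted_Gmeas.
  have -> : Ex (fun x => (Y u t x - Y u s x) ^+ 2) =
      Ex (fun x => Y u t x ^+ 2 - Y u s x ^+ 2 - 2 * (Y u s x * (Y u t x - Y u s x))).
    by apply: eq_Ex => x; ring.
  rewrite ExB; [|by apply: LiB; exact: L2|exact: LiZl].
  by rewrite ExZl// E0 mulr0 subr0 ExB//; exact: L2.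
Qed.

Lemma Y_sub u s t : 0 <= s -> s < t -> subgaussian P (fun x => Y u t x - Y u s x) (t - s).
Proof.
move=> s0 st; have t0 := le_trans s0 (ltW st).
have [L2 E1 E2] := Y_var u s0 (ltW st).
have LB := LiB (Y_Li u t0) (Y_Li u s0).
apply: gaussian_rv_subgaussian => //; [exact: Li_meas LB|by rewrite subr_gt0|].
case: YH => gY _ _ _ _.
have := gY 2%N (fun=> u) (fun i => if i == ord0 then t else s) (fun i => if i == ord0 then 1 else -1).
have h i : 0 <= (if i == ord0 :> 'I_2 then t else s) by case: ifP.
move=> /(_ h); congr (gaussian_rv P _); apply/funext => x.
by rewrite !big_ord_recl big_ord0 /= mul1r mulN1r addr0.
Qed.

Lemma X_sys n (u : 'I_n -> R) c : c != 0 -> msys P F (fun k t x => c * (X (u k) t x - u k))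
  (fun k l t x => c ^+ 2 * time_integral (fun s x => phi (X (u k) s x - X (u l) s x)) t x) `|c|.
Proof.
move=> c0; apply: (msys_affine filtF c0 (M := fun k => X (u k))
  (g := fun k l s x => phi (X (u k) s x - X (u l) s x))).
- by move=> k; exact: X_mart.
- by move=> k x; exact: X_0.
- by move=> k l; case: XH.
- by move=> *; exact: phi_le1.
- by move=> *; exact: X_sub.
Qed.

Lemma Y_sys n (v : 'I_n -> R) c : c != 0 -> msys P F (fun k t x => c * (Y (v k) t x - v k))
  (fun k l t _ => c ^+ 2 * phi (v k - v l) * t) `|c|.
Proof.
move=> c0.
have S := @msys_affine _ _ _ P F filtF n (fun k => Y (v k)) v (fun k l _ _ => phi (v k - v l)) c c0
  (fun k => Y_mart (v k)) (fun k => Y_0 (v k)) (fun k l => Y_cov (v k) (v l))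
  (fun k l _ _ => phi_le1 _) (fun k => @Y_sub (v k)).
split.
- exact: ms_kap S.
- exact: ms_mart S.
- move=> k l; apply: (martingale_ext filtF _ (ms_cov S k l)) => t x t0.
  by rewrite time_integral_cst// [c ^+ 2 * (_ * _)]mulrA.
- exact: ms_sub S.
- move=> k l s t x s0 st; have := ms_TI S k l x s0 st.
  by rewrite !time_integral_cst ?(le_trans s0 st)// !mulrA.
- exact: ms_0 S.
Qed.

Lemma Y_qb n (v : 'I_n -> R) (c : R) k l : `|c ^+ 2 * phi (v k - v l)| <= `|c| ^+ 2.
Proof.
by rewrite normrM -normrX ler_piMr// phi_le1.
Qed.

Lemma X_TI u v c c1 c2 s t x : 0 <= s -> s <= t ->
  (forall r, s < r -> r <= t -> c1 <= phi (X u r x - X v r x) <= c2) ->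
  c ^+ 2 * (c1 * (t - s)) <=
  c ^+ 2 * time_integral (fun s x => phi (X u s x - X v s x)) t x -
  c ^+ 2 * time_integral (fun s x => phi (X u s x - X v s x)) s x <=
  c ^+ 2 * (c2 * (t - s)).
Proof.
move=> s0 st h; rewrite -mulrBr.
have /andP[h1 h2] := @time_integral_bounds R (fun r => phi (X u r x - X v r x)) c1 c2 s t s0 st
  (fun r => phi_le1 _) h.
by apply/andP; split; apply: ler_wpM2l => //; exact: sqr_ge0.
Qed.

Section classes.
Variables (n : nat) (tau c : R).
Hypotheses (n0 : (0 < n)%N) (tau0 : 0 < tau) (c0 : c != 0).
Implicit Types (u v : 'I_n -> R).

(** The smoothed maximum at time tau. The scale [c] is later plus or minus L / sqrt tau, so that
    dividing by |c| reduces the smoothing error to ln n / |c|. *)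
Definition Xell u x := ell (fun k => c * (X (u k) tau x - u k)).
Definition Yell v x := ell (fun k => c * (Y (v k) tau x - v k)).

Lemma measurable_Xell u : measurable_fun setT (Xell u).
Proof. exact: (measurable_ell_sys (X_sys u c0) (ltW tau0)). Qed.

Lemma measurable_Yell v : measurable_fun setT (Yell v).
Proof. exact: (measurable_ell_sys (Y_sys v c0) (ltW tau0)). Qed.

Lemma Li_Yell v : Li (Yell v).
Proof. exact: (Li_ell n0 (Y_sys v c0) tau0). Qed.

Lemma normc2 : `|c| ^+ 2 = c ^+ 2.
Proof. by rewrite real_normK// num_real. Qed.

Lemma X_diag u k s s' (x : T) : 0 <= s -> s <= s' ->
  c ^+ 2 * time_integral (fun s x => phi (X (u k) s x - X (u k) s x)) s' x -
  c ^+ 2 * time_integral (fun s x => phi (X (u k) s x - X (u k) s x)) s x =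
  c ^+ 2 * phi (u k - u k) * (s' - s).
Proof.
move=> s0 ss; have h r : s < r -> r <= s' -> 1 <= phi (X (u k) r x - X (u k) r x) <= 1.
  by rewrite subrr phi0 lexx.
have /andP[h1 h2] := X_TI c s0 ss h.
by apply: le_anti; rewrite subrr phi0 mulr1 -(mul1r (s' - s)) h1 h2.
Qed.

(** The flow starts at [u] and the Gaussian family sits at other points [v]: only the brackets are
    compared, and the more correlated system has the smaller maximum. *)
Lemma Xell_up u v s y G : measurable G -> 0 <= s -> 0 <= y ->
  (forall x, G x -> forall k l r, k != l -> 0 <= r -> r <= tau ->
     phi (v k - v l) <= phi (X (u k) r x - X (u l) r x)) ->
  pr [set x | Ex (Yell v) + s + 2 * y <= Xell u x] <=
  expR (- (s ^+ 2 / (4 * (c ^+ 2 * tau)))) + 2 * expR (- y) +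
  n%:R ^+ 2 * (cmpc * c ^+ 2 * tau * pr (~` G)).
Proof.
move=> mG s0 y0 hG.
(* On the diagonal both brackets grow at rate c^2 phi 0, although [u] and [v] differ. *)
have hd k s s' (x : T) (h : 0 <= s) (h' : s <= s') : _ = c ^+ 2 * phi (v k - v k) * (s' - s) :=
  etrans (X_diag u k x h h') (congr1 (fun z => c ^+ 2 * phi z * (s' - s))
   (etrans (subrr (u k)) (esym (subrr (v k))))).
have := @compare_up R d T P F filtF n _ (fun k l => c ^+ 2 * phi (v k - v l)) _ n0
  (Y_sys v c0) (Y_qb v c) _ _ (X_sys u c0) tau G tau0 mG hd s y s0 y0.
rewrite normc2; apply.
move=> x Gx k l r1 r2 kl r10 r12 r2t; rewrite subr_ge0 -mulrA.
have h r : r1 < r -> r <= r2 -> phi (v k - v l) <= phi (X (u k) r x - X (u l) r x) <= 1.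
  move=> r1r rr2; rewrite hG//=; [|exact: le_trans r10 (ltW r1r)|exact: le_trans rr2 r2t].
  exact: le_trans (ler_norm _) (phi_le1 _).
by have /andP[] := X_TI c r10 r12 h.
Qed.

Lemma Xell_dn u v s y G : measurable G -> 0 <= s -> 0 <= y ->
  (forall x, G x -> forall k l r, k != l -> 0 <= r -> r <= tau ->
     phi (X (u k) r x - X (u l) r x) <= phi (v k - v l)) ->
  pr [set x | Xell u x <= Ex (Yell v) - s - 2 * y] <=
  expR (- (s ^+ 2 / (4 * (c ^+ 2 * tau)))) + 2 * expR (- y) +
  n%:R ^+ 2 * (cmpc * c ^+ 2 * tau * pr (~` G)).
Proof.
move=> mG s0 y0 hG.
have hd k s s' (x : T) (h : 0 <= s) (h' : s <= s') : _ = c ^+ 2 * phi (v k - v k) * (s' - s) :=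
  etrans (X_diag u k x h h') (congr1 (fun z => c ^+ 2 * phi z * (s' - s))
   (etrans (subrr (u k)) (esym (subrr (v k))))).
have := @compare_dn R d T P F filtF n _ (fun k l => c ^+ 2 * phi (v k - v l)) _ n0
  (Y_sys v c0) (Y_qb v c) _ _ (X_sys u c0) tau G tau0 mG hd s y s0 y0.
rewrite normc2; apply.
move=> x Gx k l r1 r2 kl r10 r12 r2t; rewrite subr_le0 -mulrA.
have h r : r1 < r -> r <= r2 -> -1 <= phi (X (u k) r x - X (u l) r x) <= phi (v k - v l).
  move=> r1r rr2; rewrite hG//=; [|exact: le_trans r10 (ltW r1r)|exact: le_trans rr2 r2t].
  by rewrite andbT; have := phi_le1 (X (u k) r x - X (u l) r x); rewrite ler_norml => /andP[].
by have /andP[] := X_TI c r10 r12 h.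
Qed.

Lemma Yell_centered v : subgaussian P (fun x => Yell v x - Ex (Yell v)) (2 * (c ^+ 2 * tau)).
Proof.
have mV := measurable_Yell v.
split; first exact: measurable_funB.
move=> th; have L := Li_exp_ell' n0 (Y_sys v c0) th tau0.
have E x : expR (th * (Yell v x - Ex (Yell v))) = expR (- (th * Ex (Yell v))) * expR (th * Yell v x).
  by rewrite -expRD; congr expR; ring.
split; first by apply: (Li_ext _ (LiZl (expR (- (th * Ex (Yell v)))) L)) => x; rewrite E.
under eq_Ex do rewrite E.
rewrite ExZl//.
have := mgf_ell filtF n0 (Y_sys v c0) (Y_qb v c) th tau0.
rewrite normc2 => h; apply: (le_trans (ler_wpM2l (expR_ge0 _) h)).
by rewrite -expRD ler_expR; apply: eq_ler; field.
Qed.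

End classes.

Lemma tails_overlap (u E E' s y : R) : u < E + s + 2 * y -> E + 2 * s + 2 * y < E' -> u <= E' - s.
Proof. lra. Qed.

Lemma tails_small (p q : R) : 1 <= p + 2 * q + p -> 2 * p + 2 * q < 1 -> False.
Proof. lra. Qed.

(* equal covariances force equal laws; the two means are compared through the tails *)
Lemma Ex_Yell_le n (tau c c' s y : R) (v v' : 'I_n -> R) : (0 < n)%N -> 0 < tau ->
  c != 0 -> `|c| = `|c'| -> 0 <= s -> 0 <= y ->
  (forall k l, phi (v k - v l) = phi (v' k - v' l)) ->
  2 * expR (- (s ^+ 2 / (4 * (c ^+ 2 * tau)))) + 2 * expR (- y) < 1 ->
  Ex (Yell tau c' v') <= Ex (Yell tau c v) + 2 * s + 2 * y.
Proof.
move=> n0 tau0 c0 cc s0 y0 vv small.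
have c0' : c' != 0 by rewrite -normr_gt0 -cc normr_gt0.
have c2 : c' ^+ 2 = c ^+ 2 by rewrite -(normc2 c') -cc normc2.
have S' := Y_sys v' c0'; rewrite -cc c2 in S'.
have h := @compare_up R d T P F filtF n _ (fun k l => c ^+ 2 * phi (v k - v l)) _ n0
  (Y_sys v c0) (Y_qb v c) _ _ S' tau setT tau0 measurableT.
have hd k r r' (x : T) : 0 <= r -> r <= r' ->
    c ^+ 2 * phi (v' k - v' k) * r' - c ^+ 2 * phi (v' k - v' k) * r =
    c ^+ 2 * phi (v k - v k) * (r' - r) by move=> _ _; rewrite -mulrBr vv.
have {h} := h hd s y s0 y0 _.
(* By [vv] the two covariances coincide, so the hypothesis of the comparison holds with equality and
   on the whole space. *)
move=> /(_ (fun x _ k l r r' _ _ _ _ => eq_ler (esym (etrans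
  (congr1 (fun z => z - c ^+ 2 * phi (v k - v l) * (r' - r)) (esym (mulrBr _ _ _)))
  (etrans (congr1 (fun z => c ^+ 2 * z * (r' - r) - _) (esym (vv k l))) (subrr _)))))).
rewrite setCT /pr measure0 mulr0 mulr0 addr0 normc2 => h1.
have := @tail_ell_dn R d T P F filtF n _ (fun k l => c ^+ 2 * phi (v k - v l)) _ n0.
have qb k l : `|c ^+ 2 * phi (v k - v l)| <= `|c| ^+ 2 by exact: Y_qb.
have S2 : msys P F (fun k t x => c' * (Y (v' k) t x - v' k))
    (fun k l t _ => c ^+ 2 * phi (v k - v l) * t) `|c|.
  by move: S'; congr (msys P F _ _ _); apply/funext => k; apply/funext => l; rewrite vv.
move=> /(_ _ _ S2 qb s tau tau0 s0); rewrite normc2 => h2.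
rewrite leNgt; apply/negP => hlt.
have mY := measurable_Yell tau0 c0' v'.
have mA : measurable [set x | Ex (Yell tau c v) + s + 2 * y <= Yell tau c' v' x].
  exact: measurable_ge.
have mB : measurable [set x | Yell tau c' v' x <= Ex (Yell tau c' v') - s].
  by rewrite -[X in measurable X]setTI; apply: measurable_fun_le.
(* If the means were further apart, each sample would lie in the upper tail about one mean or in the
   lower tail about the other, and two small events would cover the space. *)
have := pr_setU P mA mB.
rewrite (_ : _ `|` _ = setT); last first.
  apply/seteqP; split => x //= _.
  have [h|h] := leP (Ex (Yell tau c v) + s + 2 * y) (Yell tau c' v' x); first by left.
  by right; exact: tails_overlap h hlt.
rewrite {1}/pr probability_setT /= => h3.
exact: tails_small (le_trans h3 (lerD h1 h2)) small.
Qed.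

End flow.

(** * Maximal inequality *)

Section doob.
Context {R : realType} {d : measure_display} {T : measurableType d}.
Variable P : probability T R.
Local Notation Li := (Li P).
Local Notation Ex := (Ex P).
Local Notation pr := (pr P).
Variable F : R -> set (set T).
Hypothesis filtF : is_filtration F.
Variables (M : R -> T -> R).
Hypothesis mM : martingale P F M.
Hypothesis sM : forall s t, 0 <= s -> s < t -> subgaussian P (fun x => M t x - M s x) (t - s).

Lemma filt_setU t A B : 0 <= t -> F t A -> F t B -> F t (A `|` B).
Proof.
move=> t0 FA FB; have sF := filt_sa filtF t0.
rewrite -(measurable_g_measurableTypeE sF) in FA FB *.
exact: measurableU.
Qed.

Section discrete.
Variables (sq : nat -> R) (th x : R).
Hypothesis sq0 : 0 <= sq 0.
Hypothesis sqS : forall i, sq i < sq i.+1.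
Hypothesis th0 : 0 <= th.

Definition incr_from i w : R := M (sq i) w - M (sq 0) w.

(** Recursive, so that adaptedness and the exponential inequality both follow by induction on the
    number of grid times. *)
Fixpoint passed k : set T := if k is k'.+1 then passed k' `|` [set w | x <= incr_from k'.+1 w]
  else [set w | x <= incr_from 0 w].

Lemma passedP k w : passed k w <-> exists2 i, (i <= k)%N & x <= incr_from i w.
Proof.
elim: k => [|k IH] /=.
  by split=> [h|[i]]; [exists 0%N|rewrite leqn0 => /eqP->].
split=> [[/IH[i ik h]|h]|[i]].
- by exists i => //; exact: leqW.
- by exists k.+1.
- by rewrite leq_eqVlt => /orP[/eqP->|]; [right|rewrite ltnS => ik h; left; apply/IH; exists i].
Qed.

Lemma sq_le i j : (i <= j)%N -> sq i <= sq j.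
Proof.
elim: j => [|j IH]; first by rewrite leqn0 => /eqP->.
by rewrite leq_eqVlt => /orP[/eqP->//|/IH/le_trans]; apply; exact: ltW.
Qed.

Lemma sq_ge0 i : 0 <= sq i.
Proof. exact: le_trans sq0 (sq_le (leq0n i)). Qed.

Lemma incr_sub i : subgaussian P (incr_from i) (sq i - sq 0).
Proof.
case: i => [|i].
  rewrite subrr (_ : incr_from 0 = fun=> 0); last by apply/funext => w; rewrite /incr_from subrr.
  split => // t; rewrite mulr0 mulr0 expR0; split; first exact: Li_cst.
  by rewrite Ex_cst.
by apply: sM => //; apply: le_lt_trans (sq_le (leq0n i)) _.
Qed.

Lemma incr_Gmeas i j : (i <= j)%N -> Gmeas (F (sq j)) (incr_from i).
Proof.
move=> ij; have [aM _ _] := mM; have sF := filt_sa filtF (sq_ge0 j).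
have h k : (k <= j)%N -> measurable_fun setT (M (sq k) : g_sigma_algebraType (F (sq j)) -> R).
  move=> kj; apply/(GmeasE _ sF); apply: (Gmeas_filt filtF (sq_ge0 k) (sq_le kj)).
  by apply: adapted_Gmeas aM _; exact: sq_ge0.
by apply/(GmeasE _ sF); apply: measurable_funB; exact: h.
Qed.

Lemma filt_level i : F (sq i) [set w | x <= incr_from i w].
Proof.
rewrite (_ : [set w | _] = incr_from i @^-1` `[x, +oo[%classic).
  by apply: (incr_Gmeas (leqnn i)); exact: measurable_itv.
by apply/seteqP; split => w /=; rewrite in_itv/= andbT.
Qed.

Lemma filt_passed k : F (sq k) (passed k).
Proof.
elim: k => [|k IH] /=; first exact: filt_level.
apply: filt_setU; [exact: sq_ge0|apply: filtF.2 IH; [exact: sq_ge0|exact: ltW]|exact: filt_level].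
Qed.

Lemma measurable_passed k : measurable (passed k).
Proof. exact: (filt_meas filtF (sq_ge0 k) (filt_passed k)). Qed.

(* convexity, in the form exp y >= 1 + y, plays the role of the submartingale property *)
Lemma passed_exp k : expR (th * x) * pr (passed k) <=
  Ex (fun w => \1_(passed k) w * expR (th * incr_from k w)).
Proof.
have Lexp j t : Li (fun w => expR (t * incr_from j w)) by case: (incr_sub j) => _ /(_ t)[].
have LU j k' : Li (fun w => \1_(passed j) w * expR (th * incr_from k' w)).
  by apply: Li_indicM; [exact: measurable_passed|exact: Lexp].
have L1 j : Li (\1_(passed j)) by apply: Li_indic; exact: measurable_passed.
elim: k => [|k IH].
  rewrite -(Ex_indic P (measurable_passed 0)) -ExZl//; apply: le_Ex; [exact: LiZl|exact: LU|].
  move=> w; rewrite indicE; have [/set_mem/= h|_] := boolP (w \in _); last by rewrite mulr0 mul0r.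
  by rewrite mulr1 mul1r ler_expR ler_wpM2l.
pose xi w := \1_(passed k) w * expR (th * incr_from k w).
pose D w := M (sq k.+1) w - M (sq k) w.
have mxi : Gmeas (F (sq k)) xi.
  have sF := filt_sa filtF (sq_ge0 k); apply/(GmeasE _ sF); apply: measurable_funM.
    by apply: measurable_indic; rewrite measurable_g_measurableTypeE//; exact: filt_passed.
  apply: measurableT_comp => //; apply: measurable_funM => //.
  by apply/(GmeasE _ sF); exact: incr_Gmeas.
have Lxi : Li (fun w => xi w * D w).
  apply: Li_mul_sq.
  - exact: Li_meas (LU k k).
  - by case: (sM (sq_ge0 k) (sqS k)).
  - apply: (@Li_le _ _ _ _ _ (fun w => expR (th * 2 * incr_from k w))).
    + by apply: measurable_funX; exact: Li_meas (LU k k).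
    + move=> w; rewrite /xi indicE; case: (w \in _); rewrite ?mul1r ?mul0r.
        rewrite ger0_norm ?sqr_ge0// expr2 -expRD ler_expR; apply: eq_ler; ring.
      by rewrite expr0n/= normr0 expR_ge0.
    + exact: Lexp.
  - exact: subgaussian_Li_sq (sM (sq_ge0 k) (sqS k)).
have E0 : Ex (fun w => xi w * D w) = 0.
  by apply: (martingale_increment filtF mM (sq_ge0 k) (ltW (sqS k)) mxi).
have -> : expR (th * x) * pr (passed k.+1) = expR (th * x) * pr (passed k) +
    expR (th * x) * (pr (passed k.+1) - pr (passed k)) by ring.
apply: (le_trans (lerD IH (lexx _))).
rewrite -(Ex_indic P (measurable_passed k)) -(Ex_indic P (measurable_passed k.+1)).
rewrite -ExB// -ExZl; last exact: LiB.
(* The vanishing term th E (xi D) is inserted: it supplies the factor 1 + th D <= exp (th D) on the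
   event already passed, while on the newly passed event the current increment exceeds x itself. *)
rewrite -[X in X + _]addr0 -(mulr0 th) -{1}E0 -ExZl// -ExD; [|exact: LU|exact: LiZl].
rewrite -ExD; [|by apply: LiD; [exact: LU|exact: LiZl]|by apply: LiZl; exact: LiB].
apply: le_Ex.
- by apply: LiD; [apply: LiD; [exact: LU|exact: LiZl]|apply: LiZl; exact: LiB].
- exact: LU.
move=> w; rewrite /xi !indicE.
have [h|h] := boolP (w \in passed k).
  have h' : w \in passed k.+1 by apply/mem_set; left; exact/set_mem.
  rewrite h' subrr mulr0 addr0 !mul1r.
  have -> : th * incr_from k.+1 w = th * incr_from k w + th * D w.
    by rewrite /incr_from /D; ring.
  rewrite expRD mulrCA -{1}(mulr1 (expR _)) -mulrDr ler_wpM2l ?expR_ge0//.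
  exact: expR_ge1Dx.
rewrite !mul0r mulr0 addr0 add0r subr0.
have [/set_mem/= [|h']|_] := boolP (w \in passed k.+1); last by rewrite mulr0 mul0r.
  by move=> /mem_set; rewrite (negbTE h).
by rewrite mulr1 mul1r ler_expR ler_wpM2l.
Qed.

End discrete.

Lemma pr_passed sq x n : 0 <= sq 0%N -> (forall i, sq i < sq i.+1) -> 0 < x -> (0 < n)%N ->
  pr (passed sq x n) <= expR (- (x ^+ 2 / (2 * (sq n - sq 0%N)))).
Proof.
move=> sq0 sqS x0 n0; have D0 : 0 < sq n - sq 0%N.
  rewrite subr_gt0; case: n n0 => // n _.
  exact: le_lt_trans (sq_le sqS (leq0n n)) (sqS n).
pose th := x / (sq n - sq 0%N).
have th0 : 0 <= th by rewrite divr_ge0 ?ltW.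
have := passed_exp x sq0 sqS th0 n.
have [mI sI] := incr_sub sq0 sqS n; have [L E] := sI th.
have mU := measurable_passed x sq0 sqS n.
move=> h; have {}h : expR (th * x) * pr (passed sq x n) <= expR (2^-1 * th ^+ 2 * (sq n - sq 0%N)).
  apply: le_trans h _; apply: le_trans E; apply: le_Ex => //; first exact: Li_indicM.
  by move=> w; rewrite indicE; case: (w \in _); rewrite ?mul1r// mul0r expR_ge0.
rewrite -(ler_pM2l (expR_gt0 (th * x))); apply: (le_trans h).
rewrite -expRD ler_expR /th; apply: eq_ler; field.
by rewrite gt_eqF.
Qed.

Lemma cvg_pr_bigcup (A : nat -> set T) c : (forall n, measurable (A n)) ->
  {homo A : m n / (m <= n)%N >-> m `<=` n} -> (forall n, pr (A n) <= c) ->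
  pr (\bigcup_n A n) <= c.
Proof.
move=> mA nA Ac; have mU : measurable (\bigcup_n A n) by exact: bigcup_measurable.
have c1 : P \o A @ \oo --> P (\bigcup_n A n).
  by apply: nondecreasing_cvg_mu => // m n mn; apply/subsetPset; exact: nA.
have h : \forall n \near \oo, (c%:E >= (P \o A) n)%E.
  by apply: nearW => n /=; rewrite -EFin_pr// lee_fin.
by rewrite -lee_fin EFin_pr//; exact: (cvge_le h c1).
Qed.

(** The dyadic grids of [a, b] are nested, so the passage events increase and the bound passes to
    their union; outside the union, path continuity carries the bound from dyadic times to all
    times. *)
Lemma subgaussian_maximal_one a b x : continuous_paths M -> 0 <= a -> a < b -> 0 < x ->
  exists A, [/\ measurable A, pr A <= expR (- (x ^+ 2 / (2 * (b - a)))) &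
    forall w, ~ A w -> forall s, a <= s -> s <= b -> M s w - M a w <= x].
Proof.
move=> cM a0 ab x0; have ba : 0 < b - a by rewrite subr_gt0.
have e0 m : 0 < (2 ^+ m)^-1 :> R by rewrite invr_gt0 exprn_gt0.
pose sq m (i : nat) := a + (b - a) * (i%:R / 2 ^+ m).
have sqz m : sq m 0%N = a by rewrite /sq mul0r mulr0 addr0.
have sqS m i : sq m i < sq m i.+1.
  by rewrite /sq ltrD2l ltr_pM2l// ltr_pM2r// ltr_nat.
have sq0 m : 0 <= sq m 0%N by rewrite sqz.
have sqE m : sq m (2 ^ m)%N = b.
  have e : (2 ^ m)%N%:R = 2 ^+ m :> R by rewrite natrX.
  rewrite /sq e divff; last by rewrite expf_neq0.
  by rewrite mulr1 addrC subrK.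
pose A m := passed (sq m) x (2 ^ m).
have mA m : measurable (A m) by exact: measurable_passed.
exists (\bigcup_m A m); split.
- exact: bigcup_measurable.
- apply: cvg_pr_bigcup => // [|m].
    suff h m : A m `<=` A m.+1.
      move=> m n; elim: n => [|n IH]; first by rewrite leqn0 => /eqP->.
      by rewrite leq_eqVlt => /orP[/eqP->//|/IH hn]; exact: subset_trans hn (h n).
    move=> w /passedP[i im h]; apply/passedP; exists (2 * i)%N.
      by rewrite expnS leq_mul2l im.
    suff <- : incr_from (sq m) i w = incr_from (sq m.+1) (2 * i) w by [].
    rewrite /incr_from !sqz; congr (M _ w - _); rewrite /sq natrM exprS; congr (_ + _ * _).
    by field; rewrite expf_neq0.
  have := pr_passed (sq0 m) (sqS m) x0 (expn_gt0 2 m).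
  by rewrite sqE sqz.
move=> w Aw s as_ sb; apply/ler_addgt0Pr => e e_gt0.
have s0 : 0 <= s := le_trans a0 as_.
have /subspace_continuousP/(_ s) := cM w.
rewrite /= in_itv/= s0 => /(_ isT)/cvgrPdist_le/(_ e e_gt0).
rewrite /within/= => -[del /= del0 hdel].
pose m := (Num.truncn ((b - a) / del)).+1.
have hm : (b - a) / 2 ^+ m < del.
  rewrite ltr_pdivrMr ?exprn_gt0// mulrC -ltr_pdivrMr//.
  have /andP[_ h] := truncn_itv (divr_ge0 (ltW ba) (ltW del0)).
  by apply: lt_trans h _; rewrite -natrX ltr_nat ltn_expl.
pose y := (s - a) / (b - a) * 2 ^+ m.
have y0 : 0 <= y by rewrite mulr_ge0 ?divr_ge0 ?subr_ge0// ltW.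
pose i := Num.truncn y.
have /andP[i1 i2] := truncn_itv y0; rewrite -/i in i1 i2.
have iE : sq m i = a + (b - a) / 2 ^+ m * i%:R by rewrite /sq; ring.
have sE : s = a + (b - a) / 2 ^+ m * y.
  by rewrite /y; field; rewrite expf_neq0// gt_eqF.
have g0 : 0 < (b - a) / 2 ^+ m by rewrite mulr_gt0.
have q1 : sq m i <= s by rewrite iE [leRHS]sE lerD2l ler_pM2l.
have q2 : s - sq m i < del.
  apply: lt_trans hm; rewrite iE {1}sE opprD addrACA subrr add0r -mulrBr.
  by rewrite gtr_pMr// -natr1 in i2 *; rewrite ltrBlDl.
have q3 : a <= sq m i by rewrite iE lerDl mulr_ge0// ltW.
have := hdel (sq m i).
rewrite /ball/= ger0_norm ?subr_ge0// q2 in_itv/= (le_trans a0 q3) => /(_ isT isT).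
have im : (i <= 2 ^ m)%N.
  rewrite -(ler_nat R) natrX (le_trans i1)// /y ler_piMl ?exprn_ge0// ler_pdivrMr// mul1r.
  by rewrite lerD2r.
have h : M (sq m i) w - M a w < x.
  rewrite ltNge; apply/negP => h; apply: Aw; exists m => //; apply/passedP; exists i => //.
  by rewrite /incr_from sqz.
rewrite ler_norml => /andP[_ h2].
have {}h2 : M s w - M (sq m i) w <= e := h2.
lra.
Qed.

End doob.

Section maximal.
Context {R : realType} {d : measure_display} {T : measurableType d}.
Variable P : probability T R.
Local Notation pr := (pr P).
Variable F : R -> set (set T).
Hypothesis filtF : is_filtration F.
Variables (M : R -> T -> R).

Lemma subgaussian_maximal a b x : martingale P F M ->
  (forall s t, 0 <= s -> s < t -> subgaussian P (fun x => M t x - M s x) (t - s)) ->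
  continuous_paths M -> 0 <= a -> a < b -> 0 < x ->
  exists A, [/\ measurable A, pr A <= 2 * expR (- (x ^+ 2 / (2 * (b - a)))) &
    forall w, ~ A w -> forall s, a <= s -> s <= b -> `|M s w - M a w| <= x].
Proof.
move=> mM sM cM a0 ab x0.
have [A [mA pA hA]] := subgaussian_maximal_one filtF mM sM cM a0 ab x0.
pose N t w := - M t w.
have mN : martingale P F N.
  by apply: (martingale_ext filtF _ (martingale_lin filtF (-1) 0 0 mM mM)) => t w _; rewrite /N; ring.
have sN s t : 0 <= s -> s < t -> subgaussian P (fun x => N t x - N s x) (t - s).
  move=> s0 st; have := subgaussian_scale (-1) (sM s t s0 st).
  rewrite sqrrN expr1n mul1r; congr (subgaussian P _ _); apply/funext => w; rewrite /N; ring.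
have cN : continuous_paths N.
  by move=> w z; apply: continuousN; exact: cM.
have [B [mB pB hB]] := subgaussian_maximal_one filtF mN sN cN a0 ab x0.
exists (A `|` B); split.
- exact: measurableU.
- by apply: le_trans (pr_setU _ mA mB) _; rewrite mulr_natl mulr2n lerD.
- move=> w /not_orP[Aw Bw] s s1 s2; have := hA w Aw s s1 s2; have := hB w Bw s s1 s2.
  by rewrite /N ler_norml => h1 h2; apply/andP; split; lra.
Qed.

End maximal.

(** * Blocks of mesh points *)

Section subgaussian_maximum.
Context {R : realType} {d : measure_display} {T : measurableType d}.
Variable P : probability T R.
Local Notation Li := (Li P).
Local Notation Ex := (Ex P).

Lemma measurable_bigmax (I : finType) (f : I -> T -> R) :
  (forall i, measurable_fun setT (f i)) ->
  measurable_fun setT (fun x => \big[Num.max/0]_i f i x).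
Proof.
move=> mf; elim: (index_enum I) => [|i s IH].
  by under eq_fun do rewrite big_nil; exact: measurable_cst.
by under eq_fun do rewrite big_cons; exact: measurable_maxr.
Qed.

(* pointwise, [th * max |W_i| <= a - 1 + exp (th * max |W_i| - a)], and the exponential
   of the maximum is at most the sum of the exponentials *)
Lemma subgaussian_max (I : finType) (i0 : I) (W : I -> T -> R) v th :
  (forall i, subgaussian P (W i) v) -> 0 < th ->
  Li (fun x => \big[Num.max/0]_i `|W i x|) /\
  Ex (fun x => \big[Num.max/0]_i `|W i x|) <= (ln (2 * #|I|%:R) + 2^-1 * th ^+ 2 * v) / th.
Proof.
move=> sW th0; set mx := (fun x => \big[Num.max/0]_i `|W i x|).
have I0 : 0 < #|I|%:R :> R by rewrite ltr0n; apply/card_gt0P; exists i0.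
pose b := 2^-1 * th ^+ 2 * v; pose a := ln (2 * #|I|%:R) + b.
pose S x := \sum_i (expR (th * W i x) + expR (- th * W i x)).
have mW i : measurable_fun setT (W i) by case: (sW i).
have LS : Li S.
  by apply: Li_sum => i _; apply: LiD; case: (sW i) => _ h; [case: (h th)|case: (h (- th))].
have ES : Ex S <= 2 * #|I|%:R * expR b.
  rewrite Ex_sum => [|i _]; last first.
    by apply: LiD; case: (sW i) => _ h; [case: (h th)|case: (h (- th))].
  apply: (@le_trans _ _ (\sum_(i : I) (2 * expR b))); last first.
    by rewrite sumr_const -mulr_natl; apply: eq_ler; rewrite -[#|_|]/(#|I|); ring.
  apply: ler_sum => i _; have [_ h] := sW i; have [L1 E1] := h th; have [L2 E2] := h (- th).
  by rewrite ExD// mulr_natl mulr2n lerD// -/b; rewrite sqrrN in E2.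
have S1 i x : expR (th * `|W i x|) <= S x.
  rewrite /S (bigD1 i)//=; apply: (@le_trans _ _ (expR (th * W i x) + expR (- th * W i x))).
    have [w|w] := ger0P (W i x); first by rewrite lerDl expR_ge0.
    by rewrite mulrN -mulNr lerDr expR_ge0.
  by rewrite lerDl; apply: sumr_ge0 => j _; rewrite addr_ge0 ?expR_ge0.
have key x : th * mx x <= a - 1 + expR (- a) * S x.
  have bnd z : expR (th * z) <= S x -> th * z <= a - 1 + expR (- a) * S x.
    move=> h; have := ler_wpM2l (expR_ge0 (- a)) h.
    by rewrite -expRD; have := expR_ge1Dx (- a + th * z); lra.
  rewrite -ler_pdivlMl//; apply: bigmax_le => [|i _].
    rewrite ler_pdivlMl// bnd// mulr0 expR0; apply: le_trans (S1 i0 x).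
    by rewrite -expR0 ler_expR mulr_ge0// ltW.
  by rewrite ler_pdivlMl//; exact: bnd.
have mmx : measurable_fun setT mx by apply: measurable_bigmax => i; exact: measurableT_comp.
have mx0 x : 0 <= mx x by exact: bigmax_ge_id.
have LR : Li (fun x => th^-1 * (a - 1 + expR (- a) * S x)).
  by apply: LiZl; apply: LiD; [exact: Li_cst|exact: LiZl].
have Lmx : Li mx.
  apply: (@Li_le _ _ _ _ _ _ mmx _ LR) => x.
  by rewrite ger0_norm// ler_pdivlMl.
split=> //; apply: (@le_trans _ _ (Ex (fun x => th^-1 * (a - 1 + expR (- a) * S x)))).
  by apply: le_Ex => // x; rewrite ler_pdivlMl.
have LS' : Li (fun x => expR (- a) * S x) by exact: LiZl.
rewrite ExZl; last by apply: LiD => //; exact: Li_cst.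
rewrite (ExD (Li_cst P _) LS') Ex_cst ExZl//.
rewrite mulrC ler_wpM2r ?invr_ge0 ?(ltW th0)// -/b -/a.
have : expR (- a) * Ex S <= 1.
  apply: le_trans (ler_wpM2l (expR_ge0 _) ES) _.
  rewrite -{1}(@lnK _ (2 * #|I|%:R)); last by rewrite posrE mulr_gt0.
  by rewrite -!expRD /a addNr expR0.
lra.
Qed.

End subgaussian_maximum.

Lemma bigsetU_in {T : Type} (I : finType) (A : I -> set T) i w : A i w -> (\big[setU/set0]_j A j) w.
Proof. by move=> h; rewrite (bigD1 i)//=; left. Qed.

Section block.
Context {R : realType} {d : measure_display} {T : measurableType d}.
Variable P : probability T R.
Local Notation Li := (Li P).
Local Notation Ex := (Ex P).
Local Notation pr := (pr P).
Variables (phi : R -> R) (F : R -> set (set T)) (X Y : R -> R -> T -> R).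
Hypothesis phiN : forall x, phi (- x) = phi x.
Hypothesis phi0 : phi 0 = 1.
Hypothesis phi1 : forall x, x != 0 -> `|phi x| < 1.
Hypothesis filtF : is_filtration F.
Hypothesis XH : harris_point_motion P F phi X.
Hypothesis YH : tangent_process P F phi X Y.
Variable delta : R.
Hypothesis phi_decr : forall a b, 0 <= a -> a <= b -> b <= delta -> phi b <= phi a.

Lemma phi_norm x : phi `|x| = phi x.
Proof. by have [//|_] := ger0P x; rewrite phiN. Qed.

Lemma phi_le_norm a b : `|a| <= `|b| -> `|b| <= delta -> phi b <= phi a.
Proof. by move=> ab bd; rewrite -(phi_norm a) -(phi_norm b); exact: phi_decr. Qed.

Lemma X_maximal u a b x : 0 <= a -> a < b -> 0 < x ->
  exists A, [/\ measurable A, pr A <= 2 * expR (- (x ^+ 2 / (2 * (b - a)))) &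
    forall w, ~ A w -> forall s, a <= s -> s <= b -> `|X u s w - X u a w| <= x].
Proof.
have cX : continuous_paths (X u) by case: XH => /(_ u)[].
move=> a0 ab x0.
exact: (subgaussian_maximal filtF (X_mart XH u) (@X_sub _ _ _ _ _ _ _ filtF XH u) cX a0 ab x0).
Qed.

Lemma X_maximal_family n (u : 'I_n -> R) a b x : 0 <= a -> a < b -> 0 < x ->
  exists A, [/\ measurable A, pr A <= n%:R * (2 * expR (- (x ^+ 2 / (2 * (b - a))))) &
    forall w, ~ A w -> forall k s, a <= s -> s <= b -> `|X (u k) s w - X (u k) a w| <= x].
Proof.
move=> a0 ab x0.
have /choice[A hA] : forall k, exists A, [/\ measurable A,
    pr A <= 2 * expR (- (x ^+ 2 / (2 * (b - a)))) &
    forall w, ~ A w -> forall s, a <= s -> s <= b -> `|X (u k) s w - X (u k) a w| <= x].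
  by move=> k; exact: X_maximal.
exists (\big[setU/set0]_(k < n) A k); split.
- by apply: bigsetU_measurable => k _; case: (hA k).
- apply: (@le_trans _ _ (\sum_(k < n) pr (A k))); first by apply: pr_bigsetU => k; case: (hA k).
  apply: (@le_trans _ _ (\sum_(k < n) (2 * expR (- (x ^+ 2 / (2 * (b - a))))))).
    by apply: ler_sum => k _; case: (hA k).
  by rewrite sumr_const card_ord -[X in X <= _]mulr_natl.
- move=> w Aw k s s1 s2; have [_ _ h] := hA k; apply: h => // Ak; apply: Aw.
  exact: bigsetU_in Ak.
Qed.

Lemma ord_dist n (k l : 'I_n) : k != l -> 1 <= `|k%:R - l%:R : R|.
Proof.
move=> kl; have : (k : nat) != l by [].
rewrite neq_ltn => /orP[h|h].
  have : (k.+1%:R : R) <= l%:R by rewrite ler_nat.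
  by rewrite -natr1 => h1; rewrite ler_normr; apply/orP; right; lra.
have : (l.+1%:R : R) <= k%:R by rewrite ler_nat.
by rewrite -natr1 => h1; rewrite ler_normr; apply/orP; left; lra.
Qed.

Lemma ord_dist_lt n (k l : 'I_n) : `|k%:R - l%:R : R| <= n%:R - 1.
Proof.
have hk : (k%:R : R) <= n%:R - 1 by rewrite lerBrDr natr1 ler_nat.
have hl : (l%:R : R) <= n%:R - 1 by rewrite lerBrDr natr1 ler_nat.
have k0 : (0 : R) <= k%:R by [].
have l0 : (0 : R) <= l%:R by [].
by rewrite ler_norml; apply/andP; split; lra.
Qed.

Variables (tau h c : R) (K m : nat).
Hypotheses (tau0 : 0 < tau) (h0 : 0 < h) (c0 : c != 0) (K0 : (0 < K)%N) (m0 : (0 < m)%N).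
Hypothesis delta_m : 3 * (m%:R * (K%:R * h)) <= delta.

(** Any two points are at distance at least K h. When each particle moves by at most K h / 2, a
    distance changes by at most its original value in the fine block, which the doubled spacing of
    [coarse_block] absorbs. *)
Definition fine_block (o : nat) (k : 'I_m) : R := (o + k * K)%:R * h.
Definition coarse_block (k : 'I_m) : R := (k * K).*2%:R * h.

Let Kh0 : 0 < K%:R * h.
Proof. by rewrite mulr_gt0// ltr0n. Qed.

Lemma fine_blockB o k l : fine_block o k - fine_block o l = (k%:R - l%:R) * (K%:R * h).
Proof. by rewrite /fine_block !natrD !natrM; ring. Qed.

Lemma coarse_blockB k l : coarse_block k - coarse_block l = 2 * ((k%:R - l%:R) * (K%:R * h)).
Proof. by rewrite /coarse_block -!muln2 !natrM; ring. Qed.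

(** Three sources of failure: Gaussian concentration, the width of the smoothed indicator, and the
    exit of one of the m particles, the last weighted by the m^2 pairs in Slepian's inequality. *)
Definition cmp_err s y := expR (- (s ^+ 2 / (4 * (c ^+ 2 * tau)))) + 2 * expR (- y) +
  m%:R ^+ 2 * (cmpc * c ^+ 2 * tau *
    (m%:R * (2 * expR (- ((K%:R * h / 2) ^+ 2 / (2 * tau)))))).

Lemma X_near n (u : 'I_n -> R) : exists A, [/\ measurable A,
   pr A <= n%:R * (2 * expR (- ((K%:R * h / 2) ^+ 2 / (2 * tau)))) &
   forall w, ~ A w -> forall k r, 0 <= r -> r <= tau -> `|X (u k) r w - u k| <= K%:R * h / 2].
Proof.
have [A [mA pA hA]] := @X_maximal_family n u 0 tau (K%:R * h / 2) (lexx _) tau0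
  (divr_gt0 Kh0 (ltr0Sn _ 1)).
exists A; split => //; first by rewrite subr0 in pA.
move=> w Aw k r r0 rt; have := hA w Aw k r r0 rt.
by rewrite (X_0 XH).
Qed.

Lemma dist_triangle (a b a' b' e : R) : `|a - a'| <= e -> `|b - b'| <= e ->
  `|a' - b'| - 2 * e <= `|a - b| <= `|a' - b'| + 2 * e.
Proof.
move=> h1 h2; have e1 : a - b = (a' - b') + ((a - a') - (b - b')) by ring.
have e2 : a' - b' = (a - b) - ((a - a') - (b - b')) by ring.
have h3 : `|(a - a') - (b - b')| <= 2 * e by apply: le_trans (ler_normB _ _) _; lra.
apply/andP; split; first by rewrite lerBlDr {1}e2; apply: le_trans (ler_normB _ _) _; rewrite lerD2l.
by rewrite e1; apply: le_trans (ler_normD _ _) _; rewrite lerD2l.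
Qed.

Lemma block_arith (D z M del : R) : 1 <= D -> D <= M - 1 -> 0 < z -> 3 * (M * z) <= del ->
  [/\ D * z + 2 * (z / 2) <= 2 * (D * z), 2 * (D * z) <= del,
      D * z <= 2 * (D * z) - 2 * (z / 2) & 2 * (D * z) + 2 * (z / 2) <= del].
Proof.
move=> h1 h2 z0 h3.
have e1 : z <= D * z by rewrite ler_peMl// ltW.
have e2 : D * z <= M * z - z by rewrite -[X in _ - X](mul1r z) -mulrBl ler_pM2r.
by split; lra.
Qed.

Lemma cmp_err_le s y A : measurable A ->
  pr A <= m%:R * (2 * expR (- ((K%:R * h / 2) ^+ 2 / (2 * tau)))) ->
  expR (- (s ^+ 2 / (4 * (c ^+ 2 * tau)))) + 2 * expR (- y) +
  m%:R ^+ 2 * (cmpc * c ^+ 2 * tau * pr (~` ~` A)) <= cmp_err s y.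
Proof.
move=> mA pA; rewrite setCK /cmp_err lerD2l; apply: ler_wpM2l; first exact: sqr_ge0.
apply: ler_wpM2l => //; apply: mulr_ge0 (ltW tau0); apply: mulr_ge0; last exact: sqr_ge0.
by rewrite /cmpc mulr_ge0// exprn_ge0.
Qed.

(** Fine distances along the flow stay below the coarse ones, so the flow is more correlated than
    the Gaussian family at doubled spacing. One Gaussian mean serves every offset [o]. *)
Lemma upper_block o s y : 0 <= s -> 0 <= y ->
  pr [set x | Ex (Yell Y tau c coarse_block) + s + 2 * y <= Xell X tau c (fine_block o) x]
  <= cmp_err s y.
Proof.
move=> s0 y0; have [A [mA pA hA]] := X_near (fine_block o).
apply: le_trans (cmp_err_le s y mA pA).
apply: (Xell_up phi0 phi1 filtF XH YH m0 tau0 c0 (measurableC mA) s0 y0) => x Ax k l r kl r0 rt.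
have /andP[_] := dist_triangle (hA x Ax k r r0 rt) (hA x Ax l r r0 rt).
rewrite fine_blockB => hX.
have d1 := ord_dist kl; have d2 := ord_dist_lt k l.
have nE z : `|z * (K%:R * h)| = `|z| * (K%:R * h) by rewrite normrM (gtr0_norm Kh0).
rewrite nE in hX; have [a1 a2 _ _] := block_arith d1 d2 Kh0 delta_m.
apply: phi_le_norm; rewrite coarse_blockB normrM nE ger0_norm//.
exact: le_trans hX a1.
Qed.

(** Now the flow starts at doubled spacing and its distances stay above the fine ones. A single
    block is enough, since the lower bound asks for a large deviation at one mesh point only. *)
Lemma lower_block s y : 0 <= s -> 0 <= y ->
  pr [set x | Xell X tau c coarse_block x <= Ex (Yell Y tau c (fine_block 0)) - s - 2 * y]
  <= cmp_err s y.
Proof.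
move=> s0 y0; have [A [mA pA hA]] := X_near coarse_block.
apply: le_trans (cmp_err_le s y mA pA).
apply: (Xell_dn phi0 phi1 filtF XH YH m0 tau0 c0 (measurableC mA) s0 y0) => x Ax k l r kl r0 rt.
have /andP[] := dist_triangle (hA x Ax k r r0 rt) (hA x Ax l r r0 rt).
rewrite coarse_blockB => hX1 hX2.
have d1 := ord_dist kl; have d2 := ord_dist_lt k l.
have nE z : `|z * (K%:R * h)| = `|z| * (K%:R * h) by rewrite normrM (gtr0_norm Kh0).
rewrite normrM nE ger0_norm// in hX1 hX2.
have [_ _ a1 a2] := block_arith d1 d2 Kh0 delta_m.
apply: phi_le_norm; last exact: le_trans hX2 a2.
by rewrite fine_blockB nE; exact: le_trans a1 hX1.
Qed.

(** The spacing [h] is kept independent of the time [tau]; for h = sqrt tau and N = mesh_size h the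
    expectation is [Efun]. *)
Definition Ymax N x := \big[Num.max/0]_(k < N) `|Y (k%:R * h) tau x - k%:R * h|.

Lemma Ymax_sub u : subgaussian P (fun x => Y u tau x - u) tau.
Proof.
have := Y_sub phi0 filtF YH u (lexx 0) tau0; rewrite subr0.
by congr (subgaussian P _ _); apply/funext => x; rewrite (Y_0 YH).
Qed.

Lemma Li_Ymax N : (0 < N)%N -> Li (Ymax N).
Proof.
move=> N0; have [] := @subgaussian_max _ _ _ P _ (Ordinal N0)
  (fun k x => Y (k%:R * h) tau x - k%:R * h) tau 1 _ ltr01 => // k.
exact: Ymax_sub.
Qed.

Lemma Ex_Yell_coarse N : ((m * K).*2 <= N)%N ->
  Ex (Yell Y tau c coarse_block) <= `|c| * Ex (Ymax N) + ln m%:R.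
Proof.
move=> mN; have N0 : (0 < N)%N by apply: leq_trans mN; rewrite double_gt0 muln_gt0 m0.
have LY := Li_Yell phi0 phi1 filtF YH m0 tau0 c0 coarse_block.
have LM := LiZl `|c| (Li_Ymax N0).
rewrite -(Ex_cst P (ln m%:R)) -ExZl ?Li_Ymax// -ExD//; last exact: Li_cst.
apply: le_Ex => //; first by apply: LiD => //; exact: Li_cst.
move=> x; apply: ell_le => // k; apply: le_trans (ler_norm _) _.
rewrite normrM; apply: ler_wpM2l => //; rewrite /coarse_block.
have kN : ((k * K).*2 < N)%N.
  by apply: leq_trans mN; rewrite ltn_double ltn_pmul2r.
exact: (@le_bigmax _ _ _ 0 (fun i : 'I_N => `|Y (i%:R * h) tau x - i%:R * h|) (Ordinal kN)).
Qed.

End block.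

Section block_estimate.
Context {R : realType} {d : measure_display} {T : measurableType d}.
Variable P : probability T R.
Local Notation Li := (Li P).
Local Notation Ex := (Ex P).
Local Notation pr := (pr P).
Variables (phi : R -> R) (F : R -> set (set T)) (X Y : R -> R -> T -> R).
Hypothesis phiN : forall x, phi (- x) = phi x.
Hypothesis phi0 : phi 0 = 1.
Hypothesis phi1 : forall x, x != 0 -> `|phi x| < 1.
Hypothesis filtF : is_filtration F.
Hypothesis XH : harris_point_motion P F phi X.
Hypothesis YH : tangent_process P F phi X Y.
Variable delta : R.
Hypothesis phi_decr : forall a b, 0 <= a -> a <= b -> b <= delta -> phi b <= phi a.
Variables (tau h c : R) (K m B N N' : nat).
Hypotheses (tau0 : 0 < tau) (h0 : 0 < h) (c0 : 0 < c) (K0 : (0 < K)%N) (m0 : (0 < m)%N).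
Hypothesis delta_m : 3 * (m%:R * (K%:R * h)) <= delta.
Hypotheses (mN : ((m * K).*2 <= N)%N) (NN : (N <= N')%N) (NB : (N' <= B * (m * K))%N).

(* the points (offset i + j K) h, j < m, i < B K, cover the mesh *)
Definition offset (i : nat) : nat := (i %/ K * (m * K) + i %% K)%N.

Lemma offset_cover k : (k < B * (m * K))%N ->
  exists i : 'I_(B * K), exists j : 'I_m, k = (offset i + j * K)%N.
Proof.
move=> kB; have mK0 : (0 < m * K)%N by rewrite muln_gt0 m0.
have q1 : (k %/ (m * K) < B)%N by rewrite ltn_divLR.
have r1 : (k %% K < K)%N by rewrite ltn_mod.
have iP : (k %/ (m * K) * K + k %% K < B * K)%N.
  apply: (@leq_trans ((k %/ (m * K)).+1 * K)); first by rewrite mulSn addnC ltn_add2r.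
  by rewrite leq_pmul2r.
have jP : (k %/ K %% m < m)%N by rewrite ltn_mod.
(* The index k splits into its cell k / (m K), its position (k / K) mod m along the block, and its
   residue mod K; the cell and the residue together number the block. *)
exists (Ordinal iP), (Ordinal jP); rewrite /offset /=.
have -> : ((k %/ (m * K) * K + k %% K) %/ K = k %/ (m * K))%N.
  by rewrite divnMDl// (divn_small r1) addn0.
have -> : ((k %/ (m * K) * K + k %% K) %% K = k %% K)%N by rewrite modnMDl modn_mod.
rewrite addnAC mulnA -mulnDl [(m * K)%N]mulnC divnMA -divn_eq.
exact: divn_eq.
Qed.

Let c_ (b : bool) : R := if b then c else - c.

Let c_norm b : `|c_ b| = c.
Proof. by rewrite /c_; case: b; rewrite ?normrN gtr0_norm. Qed.

Let c_neq0 b : c_ b != 0.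
Proof. by rewrite -normr_gt0 c_norm. Qed.

Let c_sq b : c_ b ^+ 2 = c ^+ 2.
Proof. by rewrite /c_; case: b; rewrite ?sqrrN. Qed.

Let c_pos (z : R) : exists b, c * `|z| = c_ b * z.
Proof.
by have [_|_] := ger0P z; [exists true|exists false; rewrite /c_ mulNr mulrN].
Qed.

Let N0 : (0 < N)%N.
Proof. by apply: leq_trans mN; rewrite double_gt0 muln_gt0 m0. Qed.

(** Fine blocks with both signs cover the mesh. Their smoothed maxima have nearly equal means by
    [Ex_Yell_le], and the centered parts are subgaussian with proxy 2 c^2 tau, so the maximum over 2
    B K of them adds only the last term. *)
Lemma Ymax_le s y th : 0 <= s -> 0 <= y -> 0 < th ->
  2 * expR (- (s ^+ 2 / (4 * (c ^+ 2 * tau)))) + 2 * expR (- y) < 1 ->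
  forall b, c * Ex (Ymax Y tau h N) <= Ex (Yell Y tau (c_ b) (fine_block h K (m := m) 0)) +
    2 * s + 2 * y + (ln (2 * (B * K * 2)%:R) + 2^-1 * th ^+ 2 * (2 * (c ^+ 2 * tau))) / th.
Proof.
move=> s0 y0 th0 small b.
pose W (i : 'I_(B * K) * bool) x := Yell Y tau (c_ i.2) (fine_block h K (m := m) (offset i.1)) x -
  Ex (Yell Y tau (c_ i.2) (fine_block h K (m := m) (offset i.1))).
have sW i : subgaussian P (W i) (2 * (c ^+ 2 * tau)).
  by rewrite -(c_sq i.2); exact: (Yell_centered phi0 phi1 filtF YH m0 tau0 (c_neq0 _)).
have BK0 : (0 < B * K)%N.
  have := leq_trans N0 (leq_trans NN NB); rewrite !muln_gt0 => /andP[-> _]; exact: K0.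
have [LM EM] := subgaussian_max (Ordinal BK0, true) sW th0.
rewrite card_prod card_ord card_bool in EM.
have LY := Li_Ymax phi0 filtF YH h tau0 N0.
set A0 := Ex (Yell _ _ _ _) + 2 * s + 2 * y.
apply: le_trans (lerD (lexx A0) EM).
rewrite -(Ex_cst P A0) -ExZl// -ExD//; last exact: Li_cst.
apply: le_Ex; [exact: LiZl|by apply: LiD => //; exact: Li_cst|].
move=> x; set mx := \big[_/_]_i `|W i x|.
have key k : (k < N)%N -> c * `|Y (k%:R * h) tau x - k%:R * h| <= A0 + mx.
  move=> kN; have [i [j kE]] := offset_cover (leq_trans kN (leq_trans NN NB)).
  have [b' ->] := c_pos (Y (k%:R * h) tau x - k%:R * h).
  apply: (@le_trans _ _ (Yell Y tau (c_ b') (fine_block h K (m := m) (offset i)) x)).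
    rewrite /Yell kE.
    exact: (@le_ell _ _ m0 (fun k0 => c_ b' * (Y (fine_block h K (offset i) k0) tau x -
      fine_block h K (offset i) k0)) j).
  have h1 : Ex (Yell Y tau (c_ b') (fine_block h K (m := m) (offset i))) <= A0.
    apply: (Ex_Yell_le phi0 phi1 filtF YH m0 tau0 (c_neq0 b)) => //; first by rewrite !c_norm.
      by move=> k1 k2; rewrite !fine_blockB.
    by rewrite c_sq.
  have h2 : W (i, b') x <= mx.
    apply: le_trans (ler_norm _) _.
    exact: (@le_bigmax _ _ _ 0 (fun i => `|W i x|) (i, b')).
  by have := lerD h1 h2; rewrite /W /= addrC subrK.
rewrite -ler_pdivlMl//; apply: bigmax_le => [|k _]; rewrite ler_pdivlMl//; last exact: key.
by rewrite mulr0; apply: le_trans (key 0%N N0); rewrite mulr_ge0// ltW.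
Qed.

(** The upper bound is a union of [upper_block] over all blocks and signs. For the lower bound one
    coarse block is large by [lower_block], and [Ymax_le] relates its level to the whole Gaussian
    mesh. *)
Lemma block_estimate s y s' y' th : 0 <= s -> 0 <= y -> 0 <= s' -> 0 <= y' -> 0 < th ->
  2 * expR (- (s' ^+ 2 / (4 * (c ^+ 2 * tau)))) + 2 * expR (- y') < 1 ->
  exists A, [/\ measurable A, pr A <= (B * K * 2).+1%:R * cmp_err tau h c K m s y &
    forall w, ~ A w ->
    (forall k, (k < N')%N -> `|X (k%:R * h) tau w - k%:R * h| <=
       Ex (Ymax Y tau h N) + (ln m%:R + s + 2 * y) / c) /\
    (exists2 k, (k < N)%N & Ex (Ymax Y tau h N) - (ln m%:R + s + 2 * y + 2 * s' + 2 * y' +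
      (ln (2 * (B * K * 2)%:R) + 2^-1 * th ^+ 2 * (2 * (c ^+ 2 * tau))) / th) / c <=
      `|X (k%:R * h) tau w - k%:R * h|)].
Proof.
move=> s0 y0 s0' y0' th0 small.
pose U (i : 'I_(B * K) * bool) := [set x | Ex (Yell Y tau (c_ i.2) (coarse_block h K (m := m))) + s + 2 * y
  <= Xell X tau (c_ i.2) (fine_block h K (m := m) (offset i.1)) x].
pose D := [set x | Xell X tau c (coarse_block h K (m := m)) x <=
  Ex (Yell Y tau c (fine_block h K (m := m) 0)) - s - 2 * y].
have cn0 : c != 0 := c_neq0 true.
have mU i : measurable (U i).
  by apply: measurable_ge; exact: (measurable_Xell phi0 phi1 filtF XH tau0 (c_neq0 _)).
have mD : measurable D.
  rewrite -[X in measurable X]setTI; apply: measurable_fun_le => //.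
  exact: (measurable_Xell phi0 phi1 filtF XH tau0 cn0).
have pU i : pr (U i) <= cmp_err tau h c K m s y.
  have := upper_block phiN phi0 phi1 filtF XH YH phi_decr tau0 h0 (c_neq0 i.2) K0 m0 delta_m
    (offset i.1) s0 y0.
  have -> : cmp_err tau h (c_ i.2) K m s y = cmp_err tau h c K m s y by rewrite /cmp_err c_sq.
  exact.
have pD : pr D <= cmp_err tau h c K m s y.
  exact: (lower_block phiN phi0 phi1 filtF XH YH phi_decr tau0 h0 cn0 K0 m0 delta_m s0 y0).
exists (D `|` \big[setU/set0]_i U i); split.
- by apply: measurableU => //; exact: bigsetU_measurable.
- apply: (le_trans (pr_setU _ mD _)); first exact: bigsetU_measurable.
  rewrite -natr1 mulrDl mul1r addrC lerD//.
  apply: (@le_trans _ _ (\sum_i pr (U i))); first exact: pr_bigsetU.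
  apply: (@le_trans _ _ (\sum_(i : 'I_(B * K) * bool) cmp_err tau h c K m s y)).
    by apply: ler_sum => i _; exact: pU.
  by rewrite sumr_const card_prod card_ord card_bool -[X in X <= _]mulr_natl.
move=> w /not_orP[Dw Uw]; split.
- move=> k kN; have [i [j kE]] := offset_cover (leq_trans kN NB).
  have [b hb] := c_pos (X (k%:R * h) tau w - k%:R * h).
  have nU : ~ U (i, b) w by move=> hU; apply: Uw; exact: bigsetU_in hU.
  rewrite -(ler_pM2l c0) hb [leRHS]mulrDr [c * (_ / c)]mulrCA divff// mulr1.
  have h1 := Ex_Yell_coarse phi0 phi1 filtF YH h tau0 (c_neq0 b) K0 m0 mN.
  rewrite c_norm in h1.
  have h2 : c_ b * (X (k%:R * h) tau w - k%:R * h) <=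
      Xell X tau (c_ b) (fine_block h K (m := m) (offset i)) w.
    rewrite kE; exact: (@le_ell _ _ m0 (fun k0 => c_ b * (X (fine_block h K (offset i) k0) tau w -
      fine_block h K (offset i) k0)) j).
  have h3 : Xell X tau (c_ b) (fine_block h K (m := m) (offset i)) w <=
      Ex (Yell Y tau (c_ b) (coarse_block h K (m := m))) + s + 2 * y.
    by apply: ltW; rewrite ltNge; apply/negP.
  by apply: le_trans h2 (le_trans h3 _); lra.
have h1 := Ymax_le s0' y0' th0 small true; rewrite {1}/c_ in h1.
have h2 : Ex (Yell Y tau c (fine_block h K (m := m) 0)) - s - 2 * y <
    Xell X tau c (coarse_block h K (m := m)) w by rewrite ltNge; apply/negP.
apply: contrapT => /forall2NP H.
set S := _ + (ln (2 * _) + _) / th in H.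
pose z := Ex (Ymax Y tau h N) - S / c.
have h3 : Xell X tau c (coarse_block h K (m := m)) w <= c * z + ln m%:R.
  apply: ell_le => // k; rewrite ler_pM2l//.
  have kN : ((k * K).*2 < N)%N by apply: leq_trans mN; rewrite ltn_double ltn_pmul2r.
  have [//|/negP] := H (k * K).*2.
  by rewrite -ltNge => /ltW; apply: le_trans; exact: ler_norm.
have cz : c * z = c * Ex (Ymax Y tau h N) - S by rewrite /z mulrBr mulrCA divff// mulr1.
move: h1 h2 h3; rewrite cz /S; set E1 := c * _; set E2 := Ex _; set L := ln (2 * _); set Q := (L + _) / th.
move=> h1 h2 h3; lra.
Qed.

End block_estimate.

(** * Asymptotics *)

Section numerics.
Context {R : realType}.
Implicit Types (L h x : R).

Lemma log_facts L : expR 1 <= L -> [/\ 2 <= L, 1 <= ln L, ln L <= L & expR (ln L) = L].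
Proof.
move=> eL; have e2 : 2 <= expR 1 :> R by have := expR_ge1Dx (1 : R); lra.
have L2 := le_trans e2 eL; have L0 : 0 < L by lra.
have lE : expR (ln L) = L by rewrite lnK// posrE.
split=> //; first by rewrite -(expRK 1) ler_ln ?posrE ?expR_gt0.
by have := expR_ge1Dx (ln L); rewrite lE; lra.
Qed.

Lemma sqrt_facts x : 1 <= x -> [/\ 1 <= Num.sqrt x, Num.sqrt x ^+ 2 = x & Num.sqrt x <= x].
Proof.
move=> x1; have x0 : 0 <= x by lra.
have s1 : 1 <= Num.sqrt x by rewrite -sqrtr1 ler_sqrt// ltr01.
have sE := sqr_sqrtr x0; split=> //; rewrite -{2}sE expr2 ler_peMl//; lra.
Qed.

Lemma expRN_pow n L : 0 < L -> expR (- L) <= n.+1`!%:R / L ^+ n.+1.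
Proof.
move=> L0; have := expR_ge1Dxn n (ltW L0) => h.
rewrite expRN -[leRHS]invrK lef_pV2 ?posrE ?expR_gt0//; last first.
  by rewrite invr_gt0 divr_gt0 ?exprn_gt0// ltr0n fact_gt0.
by rewrite invf_div; apply: le_trans h; rewrite lerDr.
Qed.

Lemma expRN_ln n L : 0 < L -> expR (- (n%:R * ln L)) = (L ^+ n)^-1.
Proof. by move=> L0; rewrite expRN expRM_natl lnK ?posrE. Qed.

(* L = ln (1 / tau) and rho L = sqrt tau *)
Definition rho L : R := expR (- (L / 2)).

Lemma rho_gt0 L : 0 < rho L. Proof. exact: expR_gt0. Qed.

Lemma rho_sq L : rho L ^+ 2 = expR (- L).
Proof. by rewrite /rho -expRM_natl; congr expR; field. Qed.

Lemma sqrt_expRN L : Num.sqrt (expR (- L)) = rho L.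
Proof. by rewrite -rho_sq sqrtr_sqr gtr0_norm ?rho_gt0. Qed.

Lemma rho_le1 L : 0 <= L -> rho L <= 1.
Proof. by move=> L0; rewrite -expR0 ler_expR oppr_le0 divr_ge0. Qed.

Definition mesh_size h : nat := `|Num.ceil h^-1|%N.

Lemma mesh_bounds h : 0 < h -> h^-1 <= (mesh_size h)%:R < h^-1 + 1.
Proof.
move=> h0; have i0 : 0 < h^-1 by rewrite invr_gt0.
have c0 : (0 <= Num.ceil h^-1)%R by rewrite ceil_ge0 (lt_trans _ i0)// ltrN10.
have -> : (mesh_size h)%:R = (Num.ceil h^-1)%:~R :> R.
  by rewrite /mesh_size -[in RHS](gez0_abs c0).
rewrite ceil_ge/= -ltrBlDr; have := ceilB1_lt h^-1.
by rewrite intrD.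
Qed.

Lemma mesh_lt1 h k : 0 < h -> (k < mesh_size h)%N -> k%:R * h < 1.
Proof.
move=> h0 kN; have /andP[_ h2] := mesh_bounds h0.
have : (k.+1%:R : R) <= (mesh_size h)%:R by rewrite ler_nat.
by rewrite -natr1 => h3; rewrite -ltr_pdivlMr// mul1r; lra.
Qed.

Lemma cell_arith (dl q L r h K : R) : 0 < dl -> q ^+ 2 = L -> 0 < q -> 0 < L ->
  r ^+ 2 <= 2 / L ^+ 2 -> 0 < r -> 5202 / dl ^+ 2 <= L -> 0 < h -> h <= r -> K <= 17 * q ->
  0 < K -> 3 * (K * h) <= dl.
Proof.
move=> dl0 qL q0 L0 r2 r0 Ldl h0 hr Kq K0.
apply: (@le_trans _ _ (51 * (q * r))).
  have : K * h <= 17 * q * r by apply: ler_pM => //; exact: ltW.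
  lra.
rewrite -(@ler_pXn2r _ 2)// ?nnegrE ?(ltW dl0)//; last by rewrite !mulr_ge0// ltW.
rewrite !exprMn qL.
have h1 : L * r ^+ 2 <= 2 / L.
  apply: le_trans (ler_wpM2l (ltW L0) r2) _; apply: eq_ler; field; lra.
have h2 : 5202 / L <= dl ^+ 2.
  by rewrite ler_pdivrMr// mulrC -ler_pdivrMr// exprn_gt0.
have -> : 51 ^+ 2 = 2601 :> R by ring.
have : 5202 / L = 2601 * (2 / L) by field; lra.
lra.
Qed.

(** The parameters of [block_estimate] are s = 5 L r, y = 5 lam, s' = 4 L, y' = 4, th = r / L and c
    = L / rh, with r = sqrt lam and lam = ln L. The second constant is 16 + 8 + 4 + 1 + CB, by 8 <=
    4 L. *)
Lemma threshold_arith (rh L lam r lm lB CB : R) : 0 < rh -> 2 <= L -> 1 <= r -> r ^+ 2 = lam ->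
  lam <= L -> lm <= L -> lB <= CB * lam ->
  (lm + 5 * L * r + 2 * (5 * lam)) / (L / rh) <= 16 * (rh * r) /\
  (lm + 5 * L * r + 2 * (5 * lam) + 2 * (4 * L) + 2 * 4 +
    (lB + 2^-1 * (r / L) ^+ 2 * (2 * L ^+ 2)) / (r / L)) / (L / rh) <= (29 + CB) * (rh * r).
Proof.
move=> rh0 L2 r1 rl lL lmL lBC; have L0 : 0 < L by lra.
have r0 : 0 < r by lra.
have E x C : x <= C * (r * L) -> x / (L / rh) <= C * (rh * r).
  move=> h; have -> : x / (L / rh) = rh / L * x by field; rewrite !gt_eqF.
  have -> : C * (rh * r) = rh / L * (C * (r * L)) by field; rewrite gt_eqF.
  by rewrite ler_wpM2l// divr_ge0// ltW.
have LrL : L <= r * L by rewrite ler_peMl// ltW.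
have h1 : lm + 5 * L * r + 2 * (5 * lam) <= 16 * (r * L) by lra.
split; apply: E => //.
have -> : (lB + 2^-1 * (r / L) ^+ 2 * (2 * L ^+ 2)) / (r / L) = lB / r * L + r * L.
  by field; rewrite !gt_eqF.
have h2 : lB / r <= CB * r.
  by rewrite ler_pdivrMr// -mulrA -expr2 rl.
have h3 := ler_wpM2r (ltW L0) h2.
have h4 : CB * r * L = CB * (r * L) by ring.
lra.
Qed.

(** The margin K h / 2 is at least 4 q r, so the exponent is at least 16 L r^2 / (2 r^2) = 8 L, and
    exp (- 8 L) = r^16. *)
Lemma exit_prob_arith (K h q L r : R) : 0 < r -> 16 * q <= K -> r / 2 <= h -> 0 <= q ->
  q ^+ 2 = L -> r ^+ 2 = expR (- L) ->
  expR (- ((K * h / 2) ^+ 2 / (2 * expR (- L)))) <= r ^+ 16.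
Proof.
move=> r0 qK rh q0 qL rL; have -> : r ^+ 16 = expR (- (8 * L)).
  by rewrite (_ : 16 = 2 * 8)%N// exprM rL -expRM_natl mulrN.
rewrite ler_expR lerN2 -rL ler_pdivlMr; last by rewrite mulr_gt0// exprn_gt0.
have h1 : 4 * q * r <= K * h / 2.
  have : (16 * q) * (r / 2) <= K * h.
    by apply: ler_pM => //; [rewrite mulr_ge0|rewrite divr_ge0// ltW].
  lra.
have : (4 * q * r) ^+ 2 <= (K * h / 2) ^+ 2.
  by rewrite ler_pXn2r// nnegrE ?(le_trans _ h1)// !mulr_ge0// ltW.
by apply: le_trans; rewrite -qL; apply: eq_ler; ring.
Qed.

(** The power r^16 outweighs m^3 <= 8 / r^3 by far; of what is left only r^2 <= 7! / L^7 is kept,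
    and the factor L^2 reduces it to L^-5. *)
Lemma err_arith (m r L E D : R) : 0 < r -> r <= 1 -> 0 <= m -> m <= 2 / r -> 2 <= L ->
  0 <= E -> E <= r ^+ 16 -> r ^+ 2 <= 7`!%:R / L ^+ 7 -> 0 <= D ->
  m ^+ 2 * (D * L ^+ 2 * (m * (2 * E))) <= 16 * D * 7`!%:R / L ^+ 5.
Proof.
move=> r0 r1 m0 mr L2 E0 Er rL D0; have L0 : 0 < L by lra.
have m3 : m ^+ 3 * r ^+ 3 <= 8.
  have : (m * r) ^+ 3 <= 2 ^+ 3.
    rewrite ler_pXn2r ?nnegrE ?mulr_ge0 ?(ltW r0)//.
    by rewrite -ler_pdivlMr.
  by rewrite exprMn => /le_trans; apply; rewrite (_ : 2 ^+ 3 = 8)//; ring.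
have h1 : m ^+ 3 * E <= 8 * r ^+ 2.
  apply: (@le_trans _ _ (m ^+ 3 * r ^+ 16)); first by rewrite ler_wpM2l// exprn_ge0.
  have -> : m ^+ 3 * r ^+ 16 = m ^+ 3 * r ^+ 3 * (r ^+ 2 * r ^+ 11) by ring.
  apply: ler_pM => //; rewrite ?mulr_ge0 ?exprn_ge0 ?(ltW r0)//.
  by rewrite ler_piMr ?exprn_ge0 ?(ltW r0)// exprn_ile1// ltW.
have h2 : m ^+ 3 * E <= 8 * (7`!%:R / L ^+ 7) by apply: le_trans h1 _; rewrite ler_wpM2l.
have -> : m ^+ 2 * (D * L ^+ 2 * (m * (2 * E))) = 2 * D * L ^+ 2 * (m ^+ 3 * E) by ring.
have h3 : 0 <= 2 * D * L ^+ 2 by rewrite mulr_ge0 ?sqr_ge0// mulr_ge0.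
apply: le_trans (ler_wpM2l h3 h2) _; apply: eq_ler; field.
by rewrite gt_eqF.
Qed.

Lemma choose_stride (q : R) : 1 <= q -> exists2 K, (0 < K)%N & 16 * q <= K%:R <= 17 * q.
Proof.
move=> q1; exists (Num.truncn (16 * q)).+1 => //.
have q0 : 0 <= 16 * q by lra.
by have /andP[a b] := truncn_itv q0; rewrite (ltW b) -natr1; lra.
Qed.

(** The integer part of x >= 1 is at least x / 2, whence 6 against 3. *)
Lemma choose_length (dl z : R) : 0 < z -> 3 * z <= dl ->
  exists2 m, (0 < m)%N & 3 * (m%:R * z) <= dl <= 6 * (m%:R * z).
Proof.
move=> z0 zdl; have z3 : 0 < 3 * z by lra.
have x1 : 1 <= dl / (3 * z) by rewrite ler_pdivlMr// mul1r.
exists (Num.truncn (dl / (3 * z))); have /andP[m1 m2] := truncn_itv (le_trans ler01 x1).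
  by rewrite -(ltr_nat R) -(ltrD2r 1) add0r natr1; lra.
set m := Num.truncn _ in m1 m2 *.
have m0 : (1 : R) <= m%:R.
  by rewrite ler1n -(ltr_nat R) -(ltrD2r 1) add0r natr1; lra.
apply/andP; split; first by rewrite mulrCA -ler_pdivlMr.
have : dl / (3 * z) <= 2 * m%:R.
  by apply: le_trans (ltW m2) _; rewrite -[m.+1%:R]natr1; lra.
by rewrite ler_pdivrMr// => h; apply: le_trans h _; apply: eq_ler; ring.
Qed.

(** (N + 2) h is at most 4 and m K h is at least dl / 6, hence the number 24 / dl. The two mesh
    points beyond N are there for [sandwich]. *)
Lemma block_count (dl h : R) (K m N B : nat) : 0 < dl -> dl <= 1 -> 0 < h -> h <= 1 ->
  3 * (m%:R * (K%:R * h)) <= dl -> dl <= 6 * (m%:R * (K%:R * h)) -> 24 / dl <= B%:R ->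
  h^-1 <= N%:R -> N%:R < h^-1 + 1 ->
  ((m * K).*2 <= N)%N /\ (N.+2 <= B * (m * K))%N.
Proof.
move=> dl0 dl1 h0 h1 d1 d2 BE N1 N2; split.
  rewrite -(ler_nat R); apply: le_trans N1.
  rewrite -[leRHS]mul1r ler_pdivlMr// -muln2 !natrM; lra.
rewrite -(ler_nat R) -!natr1 !natrM -(ler_pM2r h0).
have e1 : (h^-1 + 3) * h <= 4 by rewrite mulrDl mulVf ?gt_eqF//; lra.
have e2 : (N%:R + 1 + 1) * h <= (h^-1 + 3) * h by rewrite ler_pM2r//; lra.
apply: le_trans e2 (le_trans e1 _).
have e4 : 24 / dl * (dl / 6) <= B%:R * (m%:R * (K%:R * h)).
  apply: ler_pM => //; first by rewrite divr_ge0// ltW.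
    by rewrite divr_ge0// ltW.
  by rewrite ler_pdivrMr// mulrC.
have e5 : 24 / dl * (dl / 6) = 4 by field; rewrite gt_eqF.
by move: e4; rewrite e5 !mulrA.
Qed.

Lemma length_bound (dl h r K m : R) : dl <= 1 -> 0 < r -> r / 2 <= h -> 16 <= K -> 0 <= m ->
  3 * (m * (K * h)) <= dl -> m <= 2 / r.
Proof.
move=> dl1 r0 rh K16 m0 hm; rewrite ler_pdivlMr//.
have : 16 * (r / 2) <= K * h by apply: ler_pM => //; rewrite divr_ge0// ltW.
by move/(ler_wpM2l m0); lra.
Qed.

Lemma ln_length (L m : R) : 2 <= L -> 0 < m -> m <= 2 / rho L -> ln m <= L.
Proof.
move=> L2 m0 mr; have e3 : 2 <= expR (L / 2) by have := expR_ge1Dx (L / 2); lra.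
rewrite -[leRHS](expRK L) ler_ln ?posrE ?expR_gt0//; apply: le_trans mr _.
have -> : expR L = expR (L / 2) / rho L.
  by rewrite /rho expRN invrK -expRD; congr expR; field.
by rewrite ler_pM2r// invr_gt0 rho_gt0.
Qed.

Lemma ln_count (q lam B K : R) : 1 <= B -> 1 <= q -> 1 <= lam -> ln q <= lam -> 0 < K -> K <= 17 * q ->
  ln (2 * (B * K * 2)) <= (ln (68 * B) + 1) * lam.
Proof.
move=> B1 q1 l1 ql K0 Kq; have B0 : 0 < B by lra.
have q0 : 0 < q by lra.
have lnB : 0 <= ln (68 * B) by rewrite ln_ge0//; lra.
apply: (@le_trans _ _ (ln (68 * B * q))).
  rewrite ler_ln ?posrE ?mulr_gt0//.
  have h : B * K <= B * (17 * q) by rewrite ler_pM2l.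
  lra.
rewrite lnM ?posrE ?mulr_gt0//.
have : ln (68 * B) <= ln (68 * B) * lam by rewrite ler_peMr.
by lra.
Qed.

Lemma small_tails (z : R) : z = 4 -> 2 * expR (- z) + 2 * expR (- 4) < 1.
Proof.
move=> ->; have e5 : (5 : R) <= expR 4 by have := expR_ge1Dx (4 : R); lra.
have : expR (- 4) <= 5^-1 :> R by rewrite expRN lef_pV2 ?posrE ?expR_gt0.
lra.
Qed.

Lemma count_bound (L B K : R) : 1 <= B -> 1 <= L -> K <= 17 * L -> B * K * 2 + 1 <= 35 * B * L.
Proof.
move=> B1 L1 KL; have e1 : B * K <= B * (17 * L) by rewrite ler_pM2l; lra.
have e2 : 1 <= B * L by rewrite (le_trans L1)// ler_peMl//; lra.
lra.
Qed.

(** The factors 5 in the thresholds make every term O (L^-5); one power of L is then spent on the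
    number of blocks. *)
Lemma cmp_err_bound (tau h c : R) (K m : nat) (L r q D : R) : 0 < r -> r <= 1 -> 2 <= L -> 0 <= q ->
  16 * q <= K%:R -> r / 2 <= h -> q ^+ 2 = L -> r ^+ 2 = tau -> tau = expR (- L) ->
  c ^+ 2 * tau = L ^+ 2 -> m%:R <= 2 / r -> 0 <= cmpc :> R -> 1 <= ln L -> D ^+ 2 = ln L ->
  cmp_err tau h c K m (5 * L * D) (5 * ln L) <= (3 + 16 * cmpc * 7`!%:R) / L ^+ 5.
Proof.
move=> r0 r1 L2 q0 K1 hr qE rhE tE c2t mr cm0 l1 DE; have Lp : 0 < L by lra.
rewrite /cmp_err -[cmpc * _ * _]mulrA c2t.
have t1 : expR (- ((5 * L * D) ^+ 2 / (4 * L ^+ 2))) <= (L ^+ 5)^-1.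
  rewrite -expRN_ln// ler_expR lerN2.
  have -> : (5 * L * D) ^+ 2 / (4 * L ^+ 2) = 25 / 4 * D ^+ 2 by field; rewrite gt_eqF.
  by rewrite DE; lra.
have t2 : expR (- (5 * ln L)) = (L ^+ 5)^-1 by exact: expRN_ln.
rewrite tE in rhE *.
have E16 := exit_prob_arith r0 K1 hr q0 qE rhE.
have r7 : r ^+ 2 <= 7`!%:R / L ^+ 7 by rewrite rhE; exact: expRN_pow.
have t3 := err_arith r0 r1 (ler0n R m) mr L2 (expR_ge0 _) E16 r7 cm0.
apply: le_trans (lerD (lerD t1 (eq_ler (congr1 ( *%R 2) t2))) t3) _.
by apply: eq_ler; field; rewrite gt_eqF.
Qed.

End numerics.

Lemma cmp_err_ge0 {R : realType} (tau h c : R) K m s y : 0 <= tau -> 0 <= cmp_err tau h c K m s y.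
Proof.
move=> t0; have cm0 : 0 <= cmpc :> R by rewrite /cmpc mulr_ge0// exprn_ge0.
rewrite /cmp_err; apply: addr_ge0; first by rewrite addr_ge0 ?mulr_ge0 ?expR_ge0.
apply: mulr_ge0; first exact: sqr_ge0.
apply: mulr_ge0; first by rewrite mulr_ge0// mulr_ge0// sqr_ge0.
by rewrite mulr_ge0// mulr_ge0// expR_ge0.
Qed.

Section stage.
Context {R : realType} {d : measure_display} {T : measurableType d}.
Variable P : probability T R.
Local Notation Li := (Li P).
Local Notation Ex := (Ex P).
Local Notation pr := (pr P).
Variables (phi : R -> R) (F : R -> set (set T)) (X Y : R -> R -> T -> R).
Hypothesis phiN : forall x, phi (- x) = phi x.
Hypothesis phi0 : phi 0 = 1.
Hypothesis phi1 : forall x, x != 0 -> `|phi x| < 1.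
Hypothesis filtF : is_filtration F.
Hypothesis XH : harris_point_motion P F phi X.
Hypothesis YH : tangent_process P F phi X Y.
Variable delta : R.
Hypothesis delta0 : 0 < delta.
Hypothesis phi_decr : forall a b, 0 <= a -> a <= b -> b <= delta -> phi b <= phi a.

Definition Ymean tau h := Ex (Ymax Y tau h (mesh_size h)).

(** The window for [h] contains both the spacing sqrt tau of the mesh used for the flow and the
    spacing sqrt t of E(t) for t slightly below tau; the constants are uniform over it. *)
Lemma stage : exists C1 C2 L0 : R, [/\ 0 <= C1, 0 <= C2, expR 1 <= L0 &
  forall L h, L0 <= L -> rho L / 2 <= h -> h <= rho L ->
  exists A, [/\ measurable A, pr A <= C2 / L ^+ 4 &
    forall w, ~ A w ->
    (forall k, (k < (mesh_size h).+2)%N -> `|X (k%:R * h) (expR (- L)) w - k%:R * h| <=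
       Ymean (expR (- L)) h + C1 * (rho L * Num.sqrt (ln L))) /\
    (exists2 k, (k < mesh_size h)%N & Ymean (expR (- L)) h - C1 * (rho L * Num.sqrt (ln L)) <=
      `|X (k%:R * h) (expR (- L)) w - k%:R * h|)]].
Proof.
pose dl := Num.min delta 1.
have dl0 : 0 < dl by rewrite lt_min delta0 ltr01.
have dl1 : dl <= 1 by rewrite ge_min lexx orbT.
have dld : dl <= delta by rewrite ge_min lexx.
pose B := (Num.truncn (24 / dl)).+1.
have BE : 24 / dl <= B%:R.
  by apply: ltW; have /andP[] := truncn_itv (divr_ge0 (ler0n R 24) (ltW dl0)).
have B1 : 1 <= B%:R :> R by rewrite ler1n.
have lnB : 0 <= ln (68 * B%:R) :> R by rewrite ln_ge0//; lra.
pose CB : R := ln (68 * B%:R) + 1.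
have cm0 : 0 <= cmpc :> R by rewrite /cmpc mulr_ge0// exprn_ge0.
pose Ce : R := 3 + 16 * cmpc * 7`!%:R.
have Ce0 : 0 <= Ce by rewrite addr_ge0// mulr_ge0// mulr_ge0.
have CB0 : 0 <= CB by rewrite addr_ge0.
(* L >= e ensures ln L >= 1, and L >= 5202 / dl^2 ensures that a block of length at most dl can be
   formed. *)
exists (29 + CB), (35 * B%:R * Ce), (Num.max (expR 1) (5202 / dl ^+ 2)); split.
- by rewrite addr_ge0.
- by rewrite mulr_ge0// mulr_ge0.
- by rewrite le_max lexx.
move=> L h; rewrite ge_max => /andP[eL Ldl] hr rh.
have [L2 lam1 lamL lamE] := log_facts eL.
have L1 : 1 <= L by exact: le_trans (ler1n R 2) L2.
have Lp : 0 < L := lt_le_trans ltr01 L1.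
have [r1 rE rL] := sqrt_facts lam1; set r := Num.sqrt (ln L) in r1 rE rL *.
have [q1 qE qL] := sqrt_facts L1; set q := Num.sqrt L in q1 qE qL.
have rh0 := rho_gt0 L; have rh1 := rho_le1 (ltW Lp).
have rhE := rho_sq L.
have q0 : 0 < q := lt_le_trans ltr01 q1.
have h0 : 0 < h by apply: lt_le_trans hr; rewrite divr_gt0.
have h1 : h <= 1 := le_trans rh rh1.
have [K K0 /andP[K1 K2]] := choose_stride q1.
have Kp : 0 < K%:R :> R by rewrite ltr0n.
have Kh0 : 0 < K%:R * h by rewrite mulr_gt0.
have rh2 : rho L ^+ 2 <= 2 / L ^+ 2 by rewrite rhE; exact: (expRN_pow 1 Lp).
have Kdl := cell_arith dl0 qE q0 Lp rh2 rh0 Ldl h0 rh K2 Kp.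
have [m mp /andP[d1 d2]] := choose_length Kh0 Kdl.
have delta_m := le_trans d1 dld.
have /andP[N1 N2] := mesh_bounds h0.
set N := mesh_size h in N1 N2 *.
have [mN NB] := block_count dl0 dl1 h0 h1 d1 d2 BE N1 N2.
have K16 : 16 <= K%:R :> R by apply: le_trans K1; rewrite ler_peMr.
have m2r := length_bound dl1 rh0 hr K16 (ler0n R m) d1.
have m0r : 0 < m%:R :> R by rewrite ltr0n.
have lm := ln_length L2 m0r m2r.
have lqL : ln q <= ln L by rewrite ler_ln ?posrE.
have lB := ln_count B1 q1 lam1 lqL Kp K2.
have {}lB : ln (2 * (B * K * 2)%:R) <= CB * ln L by rewrite !natrM.
have c0 : 0 < L / rho L by rewrite divr_gt0.
have tau0 : 0 < expR (- L) := expR_gt0 _.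
have c2t : (L / rho L) ^+ 2 * expR (- L) = L ^+ 2 by rewrite -rhE; field; rewrite gt_eqF.
have [up dn] := threshold_arith rh0 L2 r1 rE lamL lm lB.
have small : 2 * expR (- ((4 * L) ^+ 2 / (4 * ((L / rho L) ^+ 2 * expR (- L))))) +
    2 * expR (- 4) < 1 :> R.
  by apply: small_tails; rewrite c2t; field; rewrite gt_eqF.
have r0 : 0 < r := lt_le_trans ltr01 r1.
have s0 : 0 <= 5 * L * r by rewrite mulr_ge0 ?(ltW r0)// mulr_ge0 ?(ltW Lp).
have y0 : 0 <= 5 * ln L by rewrite mulr_ge0// (le_trans ler01).
have s0' : 0 <= 4 * L by rewrite mulr_ge0 ?(ltW Lp).
have th0 : 0 < r / L by rewrite divr_gt0.
have [A [mA pA hA]] := block_estimate phiN phi0 phi1 filtF XH YH phi_decr tau0 h0 c0 K0 mp delta_m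
  mN (leq_trans (leqnSn _) (leqnSn _)) NB s0 y0 s0' (ler0n _ 4) th0 small.
exists A; split => //.
  apply: (le_trans pA).
  have ce := cmp_err_bound rh0 rh1 L2 (ltW q0) K1 hr qE rhE erefl c2t m2r cm0 lam1 rE.
  have nB : (B * K * 2).+1%:R <= 35 * B%:R * L :> R.
    rewrite -natr1 !natrM; apply: count_bound => //.
    by apply: le_trans K2 _; rewrite ler_pM2l.
  apply: (@le_trans _ _ (35 * B%:R * L * (Ce / L ^+ 5))).
    by apply: ler_pM => //; apply: cmp_err_ge0.
  by apply: eq_ler; field; rewrite gt_eqF.
move=> w Aw; have [u1 u2] := hA w Aw; split=> [k kN|].
  apply: le_trans (u1 k kN) _; rewrite lerD2l; apply: le_trans up _.
  by apply: ler_wpM2r; [rewrite mulr_ge0// ltW|rewrite (le_trans (ler_nat R 16 29))// lerDl].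
have [k kN hk] := u2; exists k => //; apply: le_trans hk; rewrite lerD2l lerN2.
by move: dn; rewrite c2t.
Qed.

End stage.

Section borel_cantelli.
Context {R : realType} {d : measure_display} {T : measurableType d}.
Variable P : probability T R.
Local Notation pr := (pr P).

Lemma pr_lt1_ex A : measurable A -> pr A < 1 -> exists w, ~ A w.
Proof.
move=> mA pA; apply: contrapT => /forallNP H.
have AT : A = setT by apply/seteqP; split=> // w _; exact: contrapT (H w).
by move: pA; rewrite AT /pr probability_setT ltxx.
Qed.

(** For x >= 1, 1 / x^2 <= 2 (1 / x - 1 / (x + 1)), so the partial sums telescope. *)
Lemma borel_cantelli_sq (B : nat -> set T) (C : R) : 0 <= C -> (forall n, measurable (B n)) ->
  (forall n, pr (B n) <= C / n.+1%:R ^+ 2) ->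
  {ae P, forall w, exists n0, forall n, (n0 <= n)%N -> ~ B n w}.
Proof.
move=> C0 mB pB.
have part n : \sum_(0 <= i < n) pr (B i) <= 2 * C * (1 - n.+1%:R^-1).
  elim: n => [|n IH]; first by rewrite big_nil invr1 subrr mulr0.
  rewrite big_nat_recr//=; apply: le_trans (lerD IH (pB n)) _.
  have n1 : 1 <= n.+1%:R :> R by rewrite ler1n.
  have -> : n.+2%:R = n.+1%:R + 1 :> R by rewrite natr1.
  move: (n.+1%:R : R) n1 => x x1; have x0 : 0 < x by exact: lt_le_trans ltr01 x1.
  rewrite -subr_ge0; have -> : 2 * C * (1 - (x + 1)^-1) - (2 * C * (1 - x^-1) + C / x ^+ 2) =
    C * (x - 1) / (x ^+ 2 * (x + 1)) by field; rewrite !gt_eqF// addr_gt0.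
  rewrite divr_ge0//; first by rewrite mulr_ge0 ?subr_ge0.
  by rewrite mulr_ge0 ?sqr_ge0// addr_ge0 ?(ltW x0).
have fin : (\sum_(n <oo) P (B n) < +oo)%E.
  apply: (@le_lt_trans _ _ (2 * C)%:E); last exact: ltry.
  apply: lime_le; first by apply: is_cvg_nneseries => n _ _; exact: measure_ge0.
  apply: nearW => n; under eq_bigr do rewrite -EFin_pr//.
  rewrite sumEFin lee_fin; apply: le_trans (part n) _.
  by rewrite ler_piMr ?mulr_ge0// gerBl.
have h0 := lim_sup_set_cvg0 mB fin.
exists (lim_sup_set B); split => //.
  by apply: bigcap_measurable => // k _; apply: bigcup_measurable.
move=> w /= /forallNP H n _; have /existsNP[m /not_implyP[nm /contrapT hB]] := H n.
by exists m.
Qed.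

End borel_cantelli.

Section final_arithmetic.
Context {R : realType}.

Lemma sup_bounds (f : R -> R) (a b : R) : (forall u, 0 <= u <= 1 -> f u <= b) ->
  (exists2 u, 0 <= u <= 1 & a <= f u) -> a <= sup [set f u | u in `[0%R, 1%R]] <= b.
Proof.
move=> hb [u u01 au]; have Su : [set f u | u in `[0%R, 1%R]] (f u).
  by exists u => //=; rewrite in_itv.
have ub : ubound [set f u | u in `[0%R, 1%R]] b.
  by move=> _ [v /=] + <-; rewrite in_itv/= => v01; exact: hb.
apply/andP; split; last by apply: ge_sup ub; exists (f u).
apply: le_trans au _; apply: sup_upper_bound (Su).
by split; [exists (f u)|exists b].
Qed.

(** Over one cell tau shrinks at most by the factor 1 - 1 / (2 L): the cell is short enough for all
    particles of the mesh to move by O (sqrt tau) only, and sqrt t stays in the window of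
    [stage]. *)
Lemma time_cell (L L' t : R) : 1 <= L -> L < L' -> L' - L <= (2 * L)^-1 ->
  expR (- L') <= t -> t <= expR (- L) ->
  [/\ expR (- L) - t <= expR (- L) / (2 * L), expR (- L) <= 4 * t,
     rho L / 2 <= Num.sqrt t, Num.sqrt t <= rho L & 0 < t].
Proof.
move=> L1 LL LLe t1 t2; have Lp : 0 < L := lt_le_trans ltr01 L1.
have t0 : 0 < t := lt_le_trans (expR_gt0 _) t1.
have tau0 : 0 < expR (- L) := expR_gt0 _.
have h1 : expR (- L) - t <= expR (- L) / (2 * L).
  have : 1 - (2 * L)^-1 <= expR (- (L' - L)) by have := expR_ge1Dx (- (L' - L)); lra.
  move/(ler_wpM2l (ltW tau0)); rewrite -expRD.
  have -> : - L + - (L' - L) = - L' by ring.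
  rewrite mulrBr mulr1; lra.
have h2 : expR (- L) <= 4 * t.
  have : expR (- L) / (2 * L) <= expR (- L) / 2.
    by rewrite ler_pM2l// lef_pV2 ?posrE ?mulr_gt0// ler_peMr.
  lra.
split=> //; last by rewrite -sqrt_expRN ler_sqrt.
rewrite -sqrt_expRN; have -> : (2 : R) = Num.sqrt 4.
  by rewrite (_ : 4 = 2 ^+ 2 :> R) ?sqrtr_sqr ?ger0_norm//; ring.
rewrite ler_pdivrMr ?sqrtr_gt0// -sqrtrM ?(ltW t0)//.
by apply: ler_wsqrtr; rewrite mulrC.
Qed.

(** A move by 2 r within time r^2 / (2 L) has exponent at least 4 L, and exp (- 4 L) = r^8 outweighs
    the 4 / r mesh points. *)
Lemma osc_arith (L r b a N : R) : 1 <= L -> 0 < r -> r <= 1 -> r ^+ 2 = b -> b = expR (- L) ->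
  a < b -> b - a <= b / (2 * L) -> 0 <= N -> N <= 4 / r ->
  N * (2 * expR (- ((2 * r) ^+ 2 / (2 * (b - a))))) <= (8 * 4`!%:R) / L ^+ 4.
Proof.
move=> L1 r0 r1 rb bE ab ba N0 Nr; have Lp : 0 < L := lt_le_trans ltr01 L1.
have ba0 : 0 < b - a by rewrite subr_gt0.
have b0 : 0 < b by rewrite bE expR_gt0.
have h1 : expR (- ((2 * r) ^+ 2 / (2 * (b - a)))) <= r ^+ 8.
  have -> : r ^+ 8 = expR (- (4 * L)) by rewrite (_ : 8 = 2 * 4)%N// exprM rb bE -expRM_natl mulrN.
  rewrite ler_expR lerN2 exprMn rb ler_pdivlMr ?mulr_gt0//.
  have := ba; rewrite ler_pdivlMr ?mulr_gt0//; lra.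
have h2 : r ^+ 2 <= 4`!%:R / L ^+ 4 by rewrite rb bE; exact: (expRN_pow 3 Lp).
have h3 : N * r ^+ 8 <= 4 * r ^+ 2.
  have -> : r ^+ 8 = r * (r ^+ 2 * r ^+ 5) by ring.
  rewrite mulrA; apply: ler_pM; rewrite ?mulr_ge0 ?exprn_ge0 ?(ltW r0)//.
    by rewrite -ler_pdivlMr.
  by rewrite ler_piMr ?exprn_ge0 ?(ltW r0)// exprn_ile1// ltW.
have h4 : N * expR (- ((2 * r) ^+ 2 / (2 * (b - a)))) <= N * r ^+ 8 by rewrite ler_wpM2l.
have -> : 8 * 4`!%:R / L ^+ 4 = 8 * (4`!%:R / L ^+ 4) by rewrite mulrA.
have -> : N * (2 * expR (- ((2 * r) ^+ 2 / (2 * (b - a))))) =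
  2 * (N * expR (- ((2 * r) ^+ 2 / (2 * (b - a))))) by ring.
have h5 := le_trans h4 (le_trans h3 (ler_wpM2l (ler0n R 4) h2)).
apply: (@le_trans _ _ (2 * (4 * (4`!%:R / L ^+ 4)))); first by rewrite ler_pM2l.
by apply: eq_ler; ring.
Qed.

Lemma time_max_arith (L r lN v : R) : 0 < r -> 0 < L -> lN <= 2 * L -> v <= r ^+ 2 / (2 * L) ->
  (lN + 2^-1 * (L / r) ^+ 2 * v) / (L / r) <= 3 * r.
Proof.
move=> r0 Lp hl hv; rewrite ler_pdivrMr ?divr_gt0//.
have -> : 3 * r * (L / r) = 3 * L by field; rewrite gt_eqF.
have h0 : 0 <= 2^-1 * (L / r) ^+ 2 by rewrite mulr_ge0// sqr_ge0.
have := ler_wpM2l h0 hv.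
have -> : 2^-1 * (L / r) ^+ 2 * (r ^+ 2 / (2 * L)) = L / 4 by field; rewrite !gt_eqF.
lra.
Qed.

Lemma ln_mesh (L N : R) : 4 <= L -> 0 < N -> N <= 4 / rho L -> ln (2 * N) <= 2 * L.
Proof.
move=> L4 N0 NL; rewrite -[leRHS]expRK ler_ln ?posrE ?expR_gt0 ?mulr_gt0//.
apply: (@le_trans _ _ (8 / rho L)).
  have -> : 8 / rho L = 2 * (4 / rho L) by ring.
  by rewrite ler_pM2l.
have -> : expR (2 * L) = expR (3 / 2 * L) / rho L.
  by rewrite /rho expRN invrK -expRD; congr expR; field.
rewrite ler_pM2r ?invr_gt0 ?rho_gt0//.
have h := expR_ge1Dx (L / 2); have e3 : 3 <= expR (L / 2) by lra.
have -> : 3 / 2 * L = 3%:R * (L / 2) by field.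
rewrite expRM_natl; apply: (@le_trans _ _ (3 ^+ 3)); last first.
  by rewrite ler_pXn2r ?nnegrE ?expR_ge0.
by rewrite !exprS expr0; lra.
Qed.

Lemma sqrt_step (n : nat) : (0 < n)%N ->
  Num.sqrt n%:R < Num.sqrt n.+1%:R :> R /\
  Num.sqrt n.+1%:R - Num.sqrt n%:R <= (2 * Num.sqrt n%:R)^-1 :> R.
Proof.
move=> n0; set a := Num.sqrt n%:R; set b := Num.sqrt n.+1%:R.
have a0 : 0 < a by rewrite sqrtr_gt0 ltr0n.
have ab : a < b by rewrite ltr_sqrt ?ltr0n// ltr_nat.
split=> //; have e : (b - a) * (b + a) = 1.
  by rewrite -subr_sqr !sqr_sqrtr// -natr1; ring.
have h : 0 < b - a by rewrite subr_gt0.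
have h2 : (b - a) * (2 * a) <= 1 by rewrite -[leRHS]e ler_pM2l//; lra.
by rewrite -[leRHS]mul1r ler_pdivlMr ?mulr_gt0.
Qed.

Lemma final_triangle (S Ef Y1 Y2 E r rr : R) : Y1 - E - 4 * r <= S -> S <= Y1 + E + 4 * r + r ->
  Y1 <= Y2 + 2 * E + r -> Y2 <= Y1 + 2 * E + r -> - (3 * r) <= Y2 - Ef -> Y2 - Ef <= 3 * r ->
  r <= rr -> `|S - Ef| <= 3 * E + 9 * rr.
Proof. by move=> *; rewrite ler_norml; apply/andP; split; lra. Qed.

End final_arithmetic.

(** * Uniform control over a time cell *)

Section flow_at_small_times.
Context {R : realType} {d : measure_display} {T : measurableType d}.
Variable P : probability T R.
Local Notation Li := (Li P).
Local Notation Ex := (Ex P).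
Local Notation pr := (pr P).
Variables (phi : R -> R) (F : R -> set (set T)) (X Y : R -> R -> T -> R).
Hypothesis phiN : forall x, phi (- x) = phi x.
Hypothesis phi0 : phi 0 = 1.
Hypothesis phi1 : forall x, x != 0 -> `|phi x| < 1.
Hypothesis filtF : is_filtration F.
Hypothesis XH : harris_point_motion P F phi X.
Hypothesis YH : tangent_process P F phi X Y.
Variable delta : R.
Hypothesis delta0 : 0 < delta.
Hypothesis phi_decr : forall a b, 0 <= a -> a <= b -> b <= delta -> phi b <= phi a.
Local Notation Ymean := (Ymean P Y).

Lemma EfunE t : Efun P Y t = Ymean t (Num.sqrt t).
Proof. by []. Qed.

(** The flow is monotone, so its value at u is enclosed by those at the two neighbouring mesh
    points. For u = 1 the right neighbour can have index N + 1, which is why N + 2 points are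
    controlled. *)
Lemma sandwich h t w b : 0 < h -> 0 <= t ->
  (forall k, (k < (mesh_size h).+2)%N -> `|X (k%:R * h) t w - k%:R * h| <= b) ->
  forall u, 0 <= u <= 1 -> `|X u t w - u| <= b + h.
Proof.
move=> h0 t0 hb u /andP[u0 u1].
have monoX a c : a <= c -> X a t w <= X c t w by case: XH => _ _ _ /(_ t w t0) hm _; exact: hm.
pose k := Num.truncn (u / h).
have /andP[k1 k2] := truncn_itv (divr_ge0 u0 (ltW h0)); rewrite -/k in k1 k2.
have /andP[N1 _] := mesh_bounds h0.
have kN : (k <= mesh_size h)%N.
  rewrite -(ler_nat R); apply: le_trans k1 (le_trans _ N1).
  by rewrite -[leRHS]mul1r ler_pM2r ?invr_gt0.
rewrite ler_pdivlMr// in k1; rewrite ltr_pdivrMr// in k2.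
have b1 := hb k (leq_ltn_trans kN (ltnW (ltnSn _))).
have kN' : (k.+1 < (mesh_size h).+2)%N by rewrite !ltnS.
have b2 := hb k.+1 kN'.
have m1 := monoX _ _ k1; have m2 := monoX _ _ (ltW k2).
have e : k.+1%:R * h = k%:R * h + h by rewrite -natr1 mulrDl mul1r.
move: b1 b2; rewrite !ler_norml => /andP[b1 _] /andP[_ b2]; rewrite e in b2 m2 k2.
by apply/andP; split; lra.
Qed.

(** An inequality between two numbers, read off at one sample: off [A] the flow nearly reaches the
    first mean at a mesh point, off [A'] it stays nearly below the second on all of [0, 1], and a
    sample outside both exists because their probabilities sum to less than 1. *)
Lemma Ymean_mesh C L h h' A A' : 1 <= L ->
  0 < h -> 0 < h' -> h' <= rho L -> measurable A -> measurable A' -> pr A + pr A' < 1 ->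
  (forall w, ~ A w -> exists2 k, (k < mesh_size h)%N & Ymean (expR (- L)) h - C <=
      `|X (k%:R * h) (expR (- L)) w - k%:R * h|) ->
  (forall w, ~ A' w -> forall k, (k < (mesh_size h').+2)%N ->
     `|X (k%:R * h') (expR (- L)) w - k%:R * h'| <= Ymean (expR (- L)) h' + C) ->
  Ymean (expR (- L)) h <= Ymean (expR (- L)) h' + 2 * C + rho L.
Proof.
move=> L1 h0 h0' hr mA mA' pA hA hA'.
have [w /not_orP[Aw Aw']] : exists w, ~ (A `|` A') w.
  apply: pr_lt1_ex; first exact: measurableU.
  exact: le_lt_trans (pr_setU P mA mA') pA.
have [k kN hk] := hA w Aw.
have k01 : 0 <= k%:R * h <= 1.
  by rewrite mulr_ge0 ?(ltW h0)//= ltW// mesh_lt1.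
have := sandwich h0' (ltW (expR_gt0 (- L))) (hA' w Aw') k01; lra.
Qed.

(** Between t and tau the increments of Y have variance at most tau / (2 L), and the mesh has O (1 /
    sqrt tau) points, whose logarithm is O (L); the expected maximal increment is thus O (sqrt
    tau). *)
Lemma Ymax_time L t h : 4 <= L -> 0 < t -> t <= expR (- L) ->
  expR (- L) - t <= expR (- L) / (2 * L) -> rho L / 2 <= h -> h <= 1 ->
  `|Ymean (expR (- L)) h - Ymean t h| <= 3 * rho L.
Proof.
move=> L4 t0 tt dt hr h1; have Lp : 0 < L by exact: lt_le_trans L4.
have rh0 := rho_gt0 L; have tau0 := expR_gt0 (- L).
have h0 : 0 < h by apply: lt_le_trans hr; rewrite divr_gt0.
have /andP[N1 N2] := mesh_bounds h0.
have ih1 : 1 <= h^-1 by rewrite invf_ge1.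
have ih : h^-1 <= 2 / rho L.
  by rewrite -[2 / _]invf_div lef_pV2 ?posrE ?divr_gt0.
rewrite /Ymean; set N := mesh_size h in N1 N2 *.
have N0 : (0 < N)%N by rewrite -(ltr_nat R); exact: lt_le_trans ltr01 (le_trans ih1 N1).
pose W (k : 'I_N) x := Y (k%:R * h) (expR (- L)) x - Y (k%:R * h) t x.
have sW k : subgaussian P (W k) (expR (- L) / (2 * L)).
  have [tl|tE] := ltP t (expR (- L)).
    have [mW hW] := Y_sub phi0 filtF YH (k%:R * h) (ltW t0) tl; split=> // th.
    have [LW EW] := hW th; split=> //; apply: le_trans EW _.
    by rewrite ler_expR ler_wpM2l// mulr_ge0// sqr_ge0.
  have -> : W k = fun=> 0.
    by apply/funext => x; rewrite /W (_ : t = expR (- L)) ?subrr//; apply: le_anti; rewrite tt.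
  split => // th; rewrite mulr0 expR0; split; first exact: Li_cst.
  have v0 : 0 <= expR (- L) / (2 * L) by rewrite divr_ge0 ?(ltW tau0)// mulr_ge0 ?(ltW Lp).
  by rewrite Ex_cst -[X in X <= _]expR0 ler_expR mulr_ge0// mulr_ge0 ?sqr_ge0.
have th0 : 0 < L / rho L by rewrite divr_gt0.
have [LM EM] := subgaussian_max (Ordinal N0) sW th0.
have L1 := Li_Ymax phi0 filtF YH h tau0 N0.
have L2 := Li_Ymax phi0 filtF YH h t0 N0.
have bnd : Ex (fun x => \big[Num.max/0]_k `|W k x|) <= 3 * rho L.
  apply: le_trans EM _; rewrite card_ord; apply: time_max_arith => //.
  - apply: ln_mesh => //; first by rewrite ltr0n.
    have : 1 <= 2 / rho L := le_trans ih1 ih.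
    have -> : 4 / rho L = 2 / rho L + 2 / rho L by ring.
    lra.
  - by rewrite rho_sq.
apply: le_trans bnd; rewrite -ExB//; apply: norm_Ex_le => //; first exact: LiB.
move=> x; set mx := \big[_/_]_k `|W k x|.
have key (f g : 'I_N -> R) : (forall k, f k <= g k + mx) ->
    \big[Num.max/0]_k f k <= \big[Num.max/0]_k g k + mx.
  move=> fg; apply: bigmax_le => [|k _].
    by rewrite addr_ge0 ?bigmax_ge_id.
  by apply: le_trans (fg k) _; rewrite lerD2r; exact: le_bigmax.
have Wk k : `|W k x| <= mx by exact: (@le_bigmax _ _ _ 0 (fun k => `|W k x|) k).
rewrite ler_norml; apply/andP; split.
  rewrite lerNl opprB lerBlDl /Ymax; apply: key => k.
  apply: le_trans (lerD (lexx _) (Wk k)); rewrite -[`|W k x|]normrN.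
  by apply: le_trans (ler_normD _ _); rewrite /W; apply: eq_ler; congr `|_|; ring.
rewrite lerBlDl /Ymax; apply: key => k.
apply: le_trans (lerD (lexx _) (Wk k)).
by apply: le_trans (ler_normD _ _); rewrite /W; apply: eq_ler; congr `|_|; ring.
Qed.

Lemma pow4_ge (L C : R) : 0 <= C -> 1 <= L -> 2 * C + 1 <= L -> C / L ^+ 4 + C / L ^+ 4 < 1.
Proof.
move=> C0 L1 CL; have Lp : 0 < L := lt_le_trans ltr01 L1.
have L4 : L <= L ^+ 4 by rewrite ler_eXnr.
rewrite -mulrDl ltr_pdivrMr ?exprn_gt0// mul1r; apply: lt_le_trans L4.
lra.
Qed.

Lemma time_cell_event : exists C5 C6 L1 : R, [/\ 0 <= C6, 4 <= L1 &
  forall L L', L1 <= L -> L < L' -> L' - L <= (2 * L)^-1 ->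
  exists A, [/\ measurable A, pr A <= C6 / L ^+ 4 &
    forall w, ~ A w -> forall t, expR (- L') <= t -> t <= expR (- L) ->
    `| sup [set `|X u t w - u| | u in `[0%R, 1%R]] - Efun P Y t | <=
      C5 * (rho L * Num.sqrt (ln L))]].
Proof.
have [C1 [C2 [L0 [C10 C20 L0e hst]]]] := stage phiN phi0 phi1 filtF XH YH delta0 phi_decr.
exists (3 * C1 + 9), (C2 + 8 * 4`!%:R), (Num.max (Num.max L0 4) (2 * C2 + 1)); split.
- by rewrite addr_ge0.
- by rewrite !le_max lexx orbT.
move=> L L'; rewrite !ge_max => /andP[/andP[LL0 L4] LC] LL LLe.
have L1 : 1 <= L by apply: le_trans L4; rewrite ler1n.
have Lp : 0 < L := lt_le_trans ltr01 L1.
have [_ lam1 _ _] := log_facts (le_trans L0e LL0).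
have [r1 _ _] := sqrt_facts lam1; set r := Num.sqrt (ln L) in r1 *.
have rh0 := rho_gt0 L; have rh1 := rho_le1 (ltW Lp).
have tau0 := expR_gt0 (- L).
have rhalf : rho L / 2 <= rho L by rewrite ler_pdivrMr// ler_peMr ?ler1n// ltW.
have [A [mA pA hA]] := hst L (rho L) LL0 rhalf (lexx _).
have eLL : expR (- L') < expR (- L) by rewrite ltr_expR ltrN2.
have [dt' _ _ _ _] := time_cell L1 LL LLe (lexx _) (ltW eLL).
(* The maximal inequality runs forward from the early end exp (- L') of the cell; comparing t with
   exp (- L) through that time doubles the bound to 4 rho L. *)
have x0 : 0 < 2 * rho L by rewrite mulr_gt0.
have [B [mB pB hB]] := X_maximal_family filtF XH
  (fun k : 'I_((mesh_size (rho L)).+2) => k%:R * rho L) (expR_ge0 (- L')) eLL x0.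
have /andP[N1 N2] := mesh_bounds rh0.
have ir1 : 1 <= (rho L)^-1 by rewrite invf_ge1.
have N4 : (mesh_size (rho L)).+2%:R <= 4 / rho L.
  have -> : (mesh_size (rho L)).+2%:R = (mesh_size (rho L))%:R + 1 + 1 :> R by rewrite !natr1.
  lra.
have pB' := le_trans pB (osc_arith L1 rh0 rh1 (rho_sq L) erefl eLL dt' (ler0n _ _) N4).
exists (A `|` B); split.
- exact: measurableU.
- by apply: le_trans (pr_setU _ mA mB) _; rewrite mulrDl lerD.
move=> w /not_orP[Aw Bw] t t1 t2.
have [dt _ st1 st2 t0] := time_cell L1 LL LLe t1 t2.
set E := C1 * (rho L * r).
have [up [k kN lo]] := hA w Aw.
have osc j : (j < (mesh_size (rho L)).+2)%N ->
    `|X (j%:R * rho L) t w - X (j%:R * rho L) (expR (- L)) w| <= 4 * rho L.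
  move=> jN; have o1 := hB w Bw (Ordinal jN) t t1 t2.
  have o2 := hB w Bw (Ordinal jN) (expR (- L)) (ltW eLL) (lexx _).
  have := ler_normB (X (j%:R * rho L) t w - X (j%:R * rho L) (expR (- L')) w)
    (X (j%:R * rho L) (expR (- L)) w - X (j%:R * rho L) (expR (- L')) w).
  rewrite opprB addrA subrK => h; apply: le_trans h _.
  by apply: le_trans (lerD o1 o2) _; apply: eq_ler; ring.
have upt j : (j < (mesh_size (rho L)).+2)%N ->
    `|X (j%:R * rho L) t w - j%:R * rho L| <= Ymean (expR (- L)) (rho L) + E + 4 * rho L.
  move=> jN; have := ler_normD (X (j%:R * rho L) t w - X (j%:R * rho L) (expR (- L)) w)
    (X (j%:R * rho L) (expR (- L)) w - j%:R * rho L).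
  rewrite addrA subrK => h; apply: le_trans h _; rewrite addrC.
  by apply: lerD; [exact: up|exact: osc].
have lot : Ymean (expR (- L)) (rho L) - E - 4 * rho L <= `|X (k%:R * rho L) t w - k%:R * rho L|.
  have o := osc k (leq_trans kN (leq_trans (leqnSn _) (leqnSn _))).
  have := ler_normB (X (k%:R * rho L) t w - k%:R * rho L)
    (X (k%:R * rho L) t w - X (k%:R * rho L) (expR (- L)) w).
  rewrite opprB addrC addrA subrK => h.
  by rewrite lerBlDr; apply: le_trans lo (le_trans h _); rewrite lerD2l.
have k01 : 0 <= k%:R * rho L <= 1.
  by rewrite mulr_ge0 ?(ltW rh0)//= ltW// mesh_lt1.
have lo' : exists2 u, 0 <= u <= 1 &
    Ymean (expR (- L)) (rho L) - E - 4 * rho L <= `|X u t w - u|.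
  by exists (k%:R * rho L).
have /andP[S1 S2] := sup_bounds (f := fun u => `|X u t w - u|)
  (sandwich rh0 (ltW t0) upt) lo'.
have ht0 : 0 < Num.sqrt t by rewrite sqrtr_gt0.
(* [A'] depends on t but serves only to compare two deterministic means; it stays out of the
   exceptional event, so no union over t arises. *)
have [A' [mA' pA' hA']] := hst L (Num.sqrt t) LL0 st1 st2.
have sm : C2 / L ^+ 4 + C2 / L ^+ 4 < 1 by exact: pow4_ge.
have m1 := Ymean_mesh L1 rh0 ht0 st2 mA mA' (le_lt_trans (lerD pA pA') sm)
  (fun w Aw => (hA w Aw).2) (fun w Aw => (hA' w Aw).1).
have m2 := Ymean_mesh L1 ht0 rh0 (lexx _) mA' mA (le_lt_trans (lerD pA' pA) sm)
  (fun w Aw => (hA' w Aw).2) (fun w Aw => (hA w Aw).1).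
have := Ymax_time L4 t0 t2 dt st1 (le_trans st2 rh1).
rewrite -EfunE ler_norml => /andP[e1 e2].
have rr : rho L <= rho L * r by rewrite ler_peMr// ltW.
have -> : (3 * C1 + 9) * (rho L * r) = 3 * E + 9 * (rho L * r) by rewrite /E; ring.
exact: final_triangle S1 S2 m1 m2 e1 e2 rr.
Qed.

End flow_at_small_times.

Theorem theorem7 (R : realType) (d : measure_display) (T : measurableType d)
  (P : probability T R) (phi : R -> R) (F : R -> set (set T))
  (X Y : R -> R -> T -> R) :
  positive_definite phi ->
  phi 0 = 1 ->
  (forall x, x != 0 -> `|phi x| < 1) ->
  (exists delta : R, 0 < delta /\ monotone_on_0_delta phi delta) ->
  is_filtration F ->
  harris_point_motion P F phi X ->
  tangent_process P F phi X Y ->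
  {ae P, forall w, exists C t0 : R, 0 < t0 /\
     forall t, 0 < t -> t < t0 ->
       `| sup [set `|X u t w - u| | u in `[0%R, 1%R]] - Efun P Y t |
         <= C * Num.sqrt (t * ln (ln t^-1))}.
Proof.
move=> [phiN _] phi0 phi1 [delta [delta0 mono]] filtF XH YH.
have phi_decr := monotone_phi_decr phi0 phi1 mono.
have [C5 [C6 [L1 [C60 L14 H]]]] := time_cell_event phiN phi0 phi1 filtF XH YH delta0 phi_decr.
pose J := (Num.truncn (L1 ^+ 2)).+1.
have L10 : 0 <= L1 := le_trans (ler0n R 4) L14.
have JL n : (J <= n)%N -> L1 <= Num.sqrt n%:R.
  move=> Jn; rewrite -(ger0_norm L10) -sqrtr_sqr ler_sqrt ?ler0n//.
  have /andP[_ h] := truncn_itv (sqr_ge0 L1).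
  by apply: ltW (lt_le_trans h _); rewrite ler_nat.
have step n : exists B, [/\ measurable B, pr P B <= 4 * C6 / n.+1%:R ^+ 2 &
    (J <= n)%N -> forall w, ~ B w -> forall t, expR (- Num.sqrt n.+1%:R) <= t ->
      t <= expR (- Num.sqrt n%:R) ->
      `| sup [set `|X u t w - u| | u in `[0%R, 1%R]] - Efun P Y t | <=
        C5 * (rho (Num.sqrt n%:R) * Num.sqrt (ln (Num.sqrt n%:R)))].
  have [Jn|nJ] := leqP J n; last first.
    (* For the finitely many cells before J nothing is claimed, and the empty event completes the
       sequence. *)
    exists set0; split => //; rewrite /pr measure0 /=.
    by rewrite divr_ge0 ?mulr_ge0 ?exprn_ge0.
  have n0 : (0 < n)%N := leq_trans (ltn0Sn _) Jn.
  have [s1 s2] := @sqrt_step R n n0.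
  have [B [mB pB hB]] := H _ _ (JL n Jn) s1 s2.
  exists B; split => //; apply: le_trans pB _.
  (* At L = sqrt n the failure probability L^-4 becomes n^-2, and 1 / n^2 <= 4 / (n + 1)^2 gives the
     factor 4. *)
  have -> : Num.sqrt n%:R ^+ 4 = n%:R ^+ 2 :> R.
    by rewrite (_ : 4 = 2 * 2)%N// exprM sqr_sqrtr.
  have n1 : 1 <= n%:R :> R by rewrite ler1n.
  rewrite -[4 * C6]mulrC -mulrA ler_wpM2l// -natr1.
  by rewrite ler_pdivlMr ?exprn_gt0 ?addr_gt0 ?ltr0n// mulrC ler_pdivrMr ?exprn_gt0 ?ltr0n//; nra.
have /choice[B hB] := step.
have mB n : measurable (B n) by case: (hB n).
have pB n : pr P (B n) <= 4 * C6 / n.+1%:R ^+ 2 by case: (hB n).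
have := borel_cantelli_sq (mulr_ge0 (ler0n R 4) C60) mB pB.
apply: filterS => w [n0 hn0].
exists (`|C5| * 2), (expR (- Num.sqrt (maxn J n0)%:R)); split; first exact: expR_gt0.
move=> t t0 tlt; pose l := ln t^-1.
have lE : t = expR (- l) by rewrite /l lnV ?posrE// opprK lnK ?posrE.
have lge : Num.sqrt (maxn J n0)%:R < l by move: tlt; rewrite lE ltr_expR ltrN2.
have l0 : 0 <= l := le_trans (sqrtr_ge0 _) (ltW lge).
(* Selects the cell of t: sqrt n <= ln (1 / t) <= sqrt (n + 1). *)
pose n := Num.truncn (l ^+ 2).
have /andP[nl1 nl2] := truncn_itv (sqr_ge0 l); rewrite -/n in nl1 nl2.
have nmax : (maxn J n0 <= n)%N.
  rewrite -ltnS -(ltr_nat R); apply: le_lt_trans nl2.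
  by rewrite -[leLHS]sqr_sqrtr// ler_pXn2r ?nnegrE ?sqrtr_ge0// ltW.
have Jn : (J <= n)%N := leq_trans (leq_maxl _ _) nmax.
have n0n : (n0 <= n)%N := leq_trans (leq_maxr _ _) nmax.
have nl : Num.sqrt n%:R <= l by rewrite -[leRHS](ger0_norm l0) -sqrtr_sqr ler_wsqrtr.
have nl' : l <= Num.sqrt n.+1%:R.
  by rewrite -[leLHS](ger0_norm l0) -sqrtr_sqr ler_wsqrtr// ltW.
have [_ _ hh] := hB n.
have t1 : expR (- Num.sqrt n.+1%:R) <= t by rewrite lE ler_expR lerN2.
have t2 : t <= expR (- Num.sqrt n%:R) by rewrite lE ler_expR lerN2.
apply: le_trans (hh Jn w (hn0 n n0n) t t1 t2) _.
set L := Num.sqrt n%:R.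
have L4 : 4 <= L := le_trans L14 (JL n Jn).
have L1' : 1 <= L by apply: le_trans L4; rewrite ler1n.
have Lp : 0 < L := lt_le_trans ltr01 L1'.
have [s1 s2] := @sqrt_step R n (leq_trans (ltn0Sn _) Jn).
have [_ h4 _ _ _] := time_cell L1' s1 s2 t1 t2.
have lnL0 : 0 <= ln L by rewrite ln_ge0.
(* From tau <= 4 t and L <= ln (1 / t); the square root of 4 is the factor 2 in the final
   constant. *)
have key : rho L * Num.sqrt (ln L) <= 2 * Num.sqrt (t * ln (ln t^-1)).
  rewrite -sqrt_expRN -sqrtrM ?expR_ge0//.
  have -> : (2 : R) = Num.sqrt 4.
    by rewrite (_ : 4 = 2 ^+ 2 :> R) ?sqrtr_sqr ?ger0_norm//; ring.
  rewrite -sqrtrM//; apply: ler_wsqrtr; rewrite mulrA; apply: ler_pM => //.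
  by rewrite ler_ln ?posrE// (lt_le_trans Lp nl).
have rl0 : 0 <= rho L * Num.sqrt (ln L) by rewrite mulr_ge0 ?expR_ge0 ?sqrtr_ge0.
apply: le_trans (ler_wpM2r rl0 (ler_norm C5)) _.
by rewrite -mulrA ler_wpM2l.
Qed.
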